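(* If $\mathfrak C$ is a pic (an intersection-closed p-clean collection of submanifolds) in a compact manifold with corners $M$, then any size order on $\mathfrak C$ is permissible for resolution and the resulting resolution, denoted $[M;\mathfrak C]$, is independent of the choice of size order.
   Context: Manifolds with corners have embedded boundary hypersurfaces. Adapted coordinates near a point consist of boundary defining functions $x_1,\dots,x_r\ge0$ of the boundary hypersurfaces through the point and further functions $y_l$, giving a diffeomorphism of a neighbourhood onto $[0,\epsilon)^r\times(-\epsilon,\epsilon)^{n-r}$. A p-submanifold is a closed subset which near each of its points is given, in some adapted coordinates, by the vanishing of some of the $x_i$ and some of the $y_l$. Submanifolds are allowed to have a finite number of connected components, all of the same dimension. A finite collection of p-submanifolds is p-clean if near each point of the union there are adapted coordinates $x_j,y_l$ in which each submanifold of the collection containing that point is defined by the vanishing of a subset of the $x_j$ and some linear functions of the $y_l$. A pic is a p-clean collection $\mathfrak C$ such that for $C_1,C_2\in\mathfrak C$ either $C_1\cap C_2=\emptyset$ or $C_1\cap C_2\in\mathfrak C$ (in the sense that each component of the intersection is an element). A size order is a total order on the collection in which the dimension is weakly increasing. Blow-up: for a p-submanifold $C\subset M$, $[M;C]$ is the (real, spherical) blow-up of $M$ along $C$, which as a set is the disjoint union of $M\setminus C$ and the inward-pointing spherical normal bundle of $C$; $\beta:[M;C]\to M$ is the blow-down map. A closed subset $Q\subset M$ is liftable under the blow-up of $C$ if either $Q\subset C$ or $Q\setminus C$ is dense in $Q$; its lift is $\beta^{-1}(Q)$ in the first case and the closure of $\beta^{-1}(Q\setminus C)$ in the second. An order of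 a p-clean collection is permissible for resolution if, blowing up successively the (lifts of the) elements in that order, at each step the next element is liftable through each preceding blow-up and its final lift is a p-submanifold. The manifold resulting from blowing up all elements is the resolution. Two permissible orders are equivalent (give the same resolution) if the identity on the complement of the union of the centres extends to a diffeomorphism of the resolutions.
   Formalization: Distinct elements of the collection are additionally required to share no connected component; otherwise {a}, {a,b} with a, b points is a pic for which the size order {a}, {a,b} is not permissible, since {a,b} is not liftable under the blow-up of {a}. *)

(* Defs.v *)
(* MathComp / MathComp-Analysis *)
From HB Require Import structures.
From mathcomp Require Import all_boot all_order all_algebra.
From mathcomp Require Import all_classical all_reals all_analysis.

Set Implicit Arguments.
Unset Strict Implicit.
Unset Printing Implicit Defensive.

Import Order.TTheory GRing.Theory Num.Theory.
Import numFieldNormedType.Exports.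

Local Open Scope classical_set_scope.
Local Open Scope ring_scope.

(* Smoothness in several variables. *)

Fixpoint Ck (R : realType) (m k : nat) (W : set 'rV[R]_m) (g : 'rV[R]_m -> R)
    : Prop :=
  (forall v, W v -> {for v, continuous g}) /\
  if k is k'.+1 then
    forall i : 'I_m,
      (forall v, W v -> derivable g v (delta_mx ord0 i)) /\
      Ck k' W (fun v => 'D_(delta_mx ord0 i) g v)
  else True.

Definition smooth (R : realType) (m : nat) (W : set 'rV[R]_m)
  (g : 'rV[R]_m -> R) : Prop := forall k, Ck k W g.

(* On A, f is locally a smooth function of phi. The function g is smooth on a
   full open subset of R^m even where phi takes its values in a set with
   boundary, so that smoothness up to the boundary is smooth extendability. *)
Definition smooth_of (R : realType) (T : Type) (m k : nat) (A : set T)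
    (phi : T -> 'rV[R]_m) (f : T -> 'rV[R]_k) : Prop :=
  forall p (i : 'I_k), A p ->
  exists W : set 'rV[R]_m, exists g : 'rV[R]_m -> R,
    [/\ open W, W (phi p), smooth W g &
        forall q, A q -> W (phi q) -> f q ord0 i = g (phi q)].

(* f maps A homeomorphically onto S, for the subspace topologies. *)
Definition homeo_onto (T U : topologicalType) (A : set T) (f : T -> U)
    (S : set U) : Prop :=
  [/\ f @` A = S, {in A &, injective f} &
      forall V, V `<=` A ->
        ((exists2 O, open O & V = A `&` O) <->
         (exists2 W, open W & f @` V = S `&` W))].

(* Manifolds with corners. The coordinates with index in bnd are the
   nonnegative ones (x_j); the remaining ones (y_l) are unrestricted. *)

Record chart (R : realType) (n : nat) (T : topologicalType) := Chart {
  dom : set T;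
  bnd : {set 'I_n};
  coord :> T -> 'rV[R]_n }.

Definition orthant (R : realType) (n : nat) (J : {set 'I_n}) : set 'rV[R]_n :=
  [set v : 'rV[R]_n | forall j, j \in J -> 0 <= v ord0 j].

Definition corner_chart (R : realType) (n : nat) (T : topologicalType)
    (c : chart R n T) : Prop :=
  open (dom c) /\
  exists2 W, open W & homeo_onto (dom c) c (orthant (bnd c) `&` W).

Definition compatible (R : realType) (n : nat) (T : topologicalType)
    (c d : chart R n T) : Prop :=
  smooth_of (dom c `&` dom d) c d /\ smooth_of (dom c `&` dom d) d c.

Record premfd (R : realType) (n : nat) := PreMfd {
  carrier :> topologicalType;
  atlas : set (chart R n carrier);
  atlas_corner : forall c, atlas c -> corner_chart c;
  atlas_cover : forall p : carrier, exists2 c, atlas c & dom c p;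
  atlas_compatible : forall c d, atlas c -> atlas d -> compatible c d;
  carrier_hausdorff : hausdorff_space carrier;
  carrier_second_countable : @second_countable carrier }.

Definition coordinates (R : realType) (n : nat) (M : premfd R n)
    (c : chart R n M) : Prop :=
  corner_chart c /\ forall d, atlas d -> compatible c d.

Definition adapted (R : realType) (n : nat) (M : premfd R n) (p : M)
    (c : chart R n M) : Prop :=
  [/\ coordinates c, dom c p, c p = 0 &
      exists2 e : R, 0 < e &
        c @` dom c =
        orthant (bnd c) `&` [set v : 'rV[R]_n | forall i, `|v ord0 i| < e]].

(* Q is a p-submanifold all of whose components have dimension d. *)
Definition psub (R : realType) (n : nat) (M : premfd R n) (d : nat)
    (Q : set M) : Prop :=
  [/\ closed Q,
      finite_set [set connected_component Q p | p in Q] &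
      forall p, Q p -> exists c, exists I : {set 'I_n},
        [/\ adapted p c, #|~: I| = d &
            forall q, dom c q -> Q q <-> forall i, i \in I -> c q ord0 i = 0]].

Definition codim1_boundary (R : realType) (n : nat) (M : premfd R n) : set M :=
  [set p | exists2 c, adapted p c & #|bnd c| = 1%N].

Definition boundary_hypersurface (R : realType) (n : nat) (M : premfd R n)
    (H : set M) : Prop :=
  exists2 p, codim1_boundary p &
    H = closure (connected_component (@codim1_boundary R n M) p).

(* Embeddedness of a boundary hypersurface is the requirement that near each of
   its points it is a single face x_j = 0, i.e. that it is a p-submanifold. *)
Record mfd (R : realType) (n : nat) := Mfd {
  mfd_pre :> premfd R n;
  mfd_embedded : forall H : set mfd_pre,
    boundary_hypersurface H -> psub n.-1 H }.

Definition smooth_on (R : realType) (n m : nat) (M : mfd R n) (N : mfd R m)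
    (U : set M) (F : M -> N) : Prop :=
  (forall p, U p -> {for p, continuous F}) /\
  forall (c : chart R n M) (d : chart R m N), atlas c -> atlas d ->
    smooth_of (U `&` dom c `&` F @^-1` dom d) c (d \o F).

(* F restricts to a diffeomorphism from the open set U onto the open set V. The
   last two clauses express that the inverse is continuous and smooth. *)
Definition diffeo_on (R : realType) (n : nat) (M N : mfd R n)
    (U : set M) (F : M -> N) (V : set N) : Prop :=
  [/\ F @` U = V, {in U &, injective F}, smooth_on U F,
      (forall O, open O -> O `<=` U -> open (F @` O)) &
      forall (c : chart R n M) (d : chart R n N), atlas c -> atlas d ->
        smooth_of (U `&` dom c `&` F @^-1` dom d) (d \o F) c].

Definition diffeo (R : realType) (n : nat) (M N : mfd R n) (F : M -> N) : Prop :=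
  diffeo_on setT F setT.

(* Real spherical blow-up. *)

(* Polar coordinates in the variables with index in I: the entry 0 of v is the
   radius rho and the entry i.+1 is the component omega_i of the direction if
   i is in I, and the untouched i-th coordinate otherwise. *)
Definition polar (R : realType) (n : nat) (I : {set 'I_n})
    (v : 'rV[R]_n.+1) : 'rV[R]_n :=
  \row_i (if i \in I then v ord0 ord0 * v ord0 (lift ord0 i)
          else v ord0 (lift ord0 i)).

(* For a chart c with image X this is the part lying over X of
   [0, oo[ x S x R^(n - #|I|), where S is the set of the unit vectors of R^I
   pointing into the orthant. *)
Definition polar_dom (R : realType) (n : nat) (J I : {set 'I_n})
    (X : set 'rV[R]_n) : set 'rV[R]_n.+1 :=
  [set v : 'rV[R]_n.+1 | [/\ 0 <= v ord0 ord0,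
               \sum_(i in I) v ord0 (lift ord0 i) ^+ 2 = 1,
               forall i, i \in I -> i \in J -> 0 <= v ord0 (lift ord0 i) &
               X (polar I v)]].

(* beta : B -> M is the blow-down map of the blow-up B = [M; C]: it is a
   diffeomorphism over M \ C, and near C it is, in adapted coordinates c in
   which C is given by the vanishing of the coordinates in I, the introduction
   of polar coordinates P. In particular the fibre over p in C (rho = 0) is the
   inward-pointing part of the unit sphere of the normal space at p; it is empty
   when I is, so that blowing up a component of M deletes it. These conditions
   determine (B, beta) up to a unique diffeomorphism over M. *)
Definition is_blowup (R : realType) (n : nat) (M : mfd R n) (C : set M)
    (B : mfd R n) (beta : B -> M) : Prop :=
  [/\ smooth_on setT beta,
      diffeo_on (beta @^-1` (~` C)) beta (~` C) &
      forall p, C p ->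
      exists c : chart R n M, exists I : {set 'I_n}, exists P : B -> 'rV[R]_n.+1,
        [/\ adapted p c,
            forall q, dom c q -> C q <-> forall i, i \in I -> c q ord0 i = 0,
            homeo_onto (beta @^-1` dom c) P
                       (polar_dom (bnd c) I (c @` dom c)),
            forall b, dom c (beta b) -> c (beta b) = polar I (P b) &
            forall d : chart R n B, atlas d ->
              smooth_of (beta @^-1` dom c `&` dom d) d P /\
              smooth_of (beta @^-1` dom c `&` dom d) P d]].

Definition liftable (T : topologicalType) (C Q : set T) : Prop :=
  closed Q /\ (Q `<=` C \/ Q `<=` closure (Q `\` C)).

Definition blift (T U : topologicalType) (beta : U -> T) (C Q : set T) : set U :=
  [set b | (Q `<=` C /\ Q (beta b)) \/
           (~ Q `<=` C /\ closure (beta @^-1` (Q `\` C)) b)].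

(* A finite collection is given as a family C indexed by a finType and an order
   on it as an enumeration s of the index type. is_resolution C s N gamma says
   that the successive blow-ups of (the lifts of) the C i, in the order s, can
   be carried out, result in N, and have gamma as composite blow-down map. *)
Fixpoint is_resolution (R : realType) (n : nat) (I : finType) (M : mfd R n)
    (C : I -> set M) (s : seq I) (N : mfd R n) (gamma : N -> M) : Prop :=
  match s with
  | [::] => diffeo gamma
  | i :: s' =>
      [/\ exists d, psub d (C i),
          forall j, j \in s' -> liftable (C i) (C j) &
          exists B : mfd R n, exists beta : B -> M, exists gamma' : N -> B,
            [/\ is_blowup (C i) beta,
                is_resolution (fun j => blift beta (C i) (C j)) s' gamma' &
                gamma = beta \o gamma']]
  end.

Definition permissible (R : realType) (n : nat) (I : finType) (M : mfd R n)
    (C : I -> set M) (s : seq I) : Prop :=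
  exists (N : mfd R n) (gamma : N -> M), is_resolution C s gamma.

(* The complement of the union of the centres is regarded as a subset of both
   resolutions by means of the blow-down maps. *)
Definition same_resolution (R : realType) (n : nat) (I : finType) (M : mfd R n)
    (C : I -> set M) (s t : seq I) : Prop :=
  forall (N N' : mfd R n) (gamma : N -> M) (gamma' : N' -> M),
    is_resolution C s gamma -> is_resolution C t gamma' ->
    exists2 F : N -> N', diffeo F &
      forall x, (forall i, ~ C i (gamma x)) -> gamma' (F x) = gamma x.

(* The matrix L collects linear functions of the y-coordinates only. *)
Definition p_clean (R : realType) (n : nat) (I : finType) (M : mfd R n)
    (C : I -> set M) : Prop :=
  (forall i, exists d, psub d (C i)) /\
  forall p, (exists i, C i p) ->
  exists2 c : chart R n M, adapted p c &
    forall i, C i p ->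
    exists (A : {set 'I_n}) (m : nat) (L : 'M[R]_(n, m)),
      [/\ A \subset bnd c,
          forall j k, j \in bnd c -> L j k = 0 &
          forall q, dom c q ->
            C i q <-> (forall j, j \in A -> c q ord0 j = 0) /\ c q *m L = 0].

(* Elements need not be connected, so "C i `&` C j belongs to the collection" is
   read as: each component of C i `&` C j is a component of an element (this
   holds in particular if each such component is itself an element).
   The last clause says that the elements are distinct component by component.
   It is automatic for distinct connected elements. Without it, the collection
   {a}, {a, b} with a, b two points would be a pic, whereas {a, b} is not
   liftable under the blow-up of {a}. *)
Definition is_pic (R : realType) (n : nat) (I : finType) (M : mfd R n)
    (C : I -> set M) : Prop :=
  [/\ p_clean C,
      (forall i j p, C i p -> C j p -> exists k,
         connected_component (C i `&` C j) p = connected_component (C k) p) &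
      (forall i j p, C i p -> C j p ->
         connected_component (C i) p = connected_component (C j) p -> i = j)].

Definition size_order (R : realType) (n : nat) (I : finType) (M : mfd R n)
    (C : I -> set M) (s : seq I) : Prop :=
  perm_eq s (enum I) /\
  exists2 d : I -> nat, (forall i, psub (d i) (C i)) &
    sorted (fun i j => (d i <= d j)%N) s.

(* Main.v *)
Require Import Defs.
From HB Require Import structures.
From mathcomp Require Import all_boot all_order all_algebra.
From mathcomp Require Import all_classical all_reals all_analysis.
From mathcomp Require Import ring lra.

(* Let i come first in a size order. Near a point of C i `&` C j the intersection is
   an element C k whose dimension is at most that of C i; as C i has minimal
   dimension, C k = C i there, hence C i lies in C j near the point. So C j \ C i is
   dense in C j, and in adapted coordinates in which every element through the point
   is a linear subspace V j, the lift of C j to the blow-up of C i is, in the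
   coordinates rho |omega_k|, omega_i / |omega_k|, again a linear subspace of the same
   dimension; intersections and distinctness persist. The lifts of the remaining
   elements thus form a collection of the same local type, and one can continue by
   induction.

   A blow-up is unique up to a unique diffeomorphism over M because a change of
   adapted coordinates induces, by Hadamard's lemma, a smooth change of polar
   coordinates. On a compact manifold it exists, as the closure of a graph.

   Two elements either of which may be blown up first have equal dimensions, so by
   the above they are disjoint; then blowing them up in either order is the same as
   blowing up their union. Any size order is reached from any other one by such
   transpositions. *)

Set Implicit Arguments.
Unset Strict Implicit.
Unset Printing Implicit Defensive.

Import Order.TTheory GRing.Theory Num.Theory.
Import numFieldNormedType.Exports.

Local Open Scope classical_set_scope.
Local Open Scope ring_scope.

(** * Differential calculus *)

(** The definition of a pic speaks of connected components, which are hard to follow through a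
    blow-up; the induction therefore runs on a condition at single points, and compactness is
    carried along to recover the existence of the next blow-up and the finiteness of the number of
    components. Empty elements have every dimension, so dimensions are compared between nonempty
    elements only. A chart with corners covers only a piece of an orthant: smooth functions are
    restrictions of arbitrary extensions, and derivatives can be tested only along inward
    directions. Statements about vectors are proved for inward vectors and extended to their
    differences, and statements at the front face rho = 0 are obtained from rho > 0 by continuity.
    Polar coordinates take values in dimension n + 1 and are not charts, whence a notion of
    coordinates with values in any R^m. The blow-up must again have embedded boundary hypersurfaces;
    this is checked in the form that no connected set of codimension one points meets two faces of a
    suitable chart. *)

Lemma is_derive_line {R : realType} {V W : normedModType R} (f : V -> W) y v x df :
  is_derive (x *: v + y) v f df <-> is_derive x 1 (fun h : R => f (h *: v + y)) df.
Proof.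
have E : (fun h : R => h^-1 *: (f (h *: v + (x *: v + y)) - f (x *: v + y))) =
         (fun h : R => h^-1 *: (f ((h%:A + x) *: v + y) - f (x *: v + y))).
  by apply/funext => h; rewrite [h%:A]mulr1 scalerDl addrA.
have E1 : 'D_v f (x *: v + y) = 'D_1 (fun h : R => f (h *: v + y)) x.
  exact: (congr1 (fun F : R -> W => lim (F @ 0^')) E).
have E2 : derivable f (x *: v + y) v = derivable (fun h : R => f (h *: v + y)) x 1.
  exact: (congr1 (fun F : R -> W => cvg (F @ 0^')) E).
by split => -[D <-]; apply: DeriveDef; rewrite ?E1// ?E2// -E2.
Qed.

(** By the mean value theorem the quantity on the left is [s * (df x - c)] at an intermediate point
    [x]. The bound is uniform in any parameter of [f], as total differentiability and
    differentiation under the integral sign both require. *)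
Lemma mvt_bound {R : realType} (f df : R -> R) (s c e : R) :
  (forall x, `|x| <= `|s| -> is_derive (x : R) (1 : R) f (df x)) ->
  (forall x : R, `|x| <= `|s| -> `|df x - c| <= e) ->
  `|f s - f 0 - s * c| <= e * `|s|.
Proof.
move=> Df Be.
have cont a b : (forall x, x \in `[a, b] -> `|x| <= `|s|) -> {within `[a, b], continuous f}.
  by move=> H; apply: derivable_within_continuous => x /H/Df[D _].
have [s0|s0|->] := ltgtP s 0; last by rewrite subrr mul0r subr0 normr0 mulr0.
- have H x : x \in `[s, 0] -> `|x| <= `|s|.
    by rewrite in_itv/= => /andP[sx x0]; rewrite !ler0_norm ?lerN2// ltW.
  have H2 x : x \in `]s, 0[ -> is_derive x (1 : R) f (df x).
    by move=> /subset_itv_oo_cc/H/Df.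
  have [x /H xs E] := MVT_segment (ltW s0) H2 (cont _ _ H).
  rewrite (_ : f s - f 0 = s * df x); last by rewrite -opprB E sub0r mulrN opprK mulrC.
  by rewrite -mulrBr normrM mulrC ler_wpM2r// Be.
- have H x : x \in `[0, s] -> `|x| <= `|s|.
    by rewrite in_itv/= => /andP[x0 sx]; rewrite !ger0_norm// ltW.
  have H2 x : x \in `]0, s[ -> is_derive x (1 : R) f (df x).
    by move=> /subset_itv_oo_cc/H/Df.
  have [x /H xs E] := MVT_segment (ltW s0) H2 (cont _ _ H).
  by rewrite E subr0 mulrC -mulrBr normrM mulrC ler_wpM2r// Be.
Qed.

Lemma diff_from {R : realType} (V W : normedModType R) (f : V -> W)
    (L : {linear V -> W}) x : continuous L ->
  (forall e : R, 0 < e -> \forall h \near 0, `|f (h + x) - (f x + L h)| <= e * `|h|) ->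
  differentiable f x /\ 'd f x = L :> (V -> W).
Proof.
move=> cL H; have loc : f \o shift x = cst (f x) + L +o_ 0 id.
  by apply/eqaddoP => e e0; exact: H.
have dE := diff_unique cL loc; split => //.
by apply/diff_locallyP; rewrite dE; split.
Qed.

Lemma open_near (T : topologicalType) (O : set T) x :
  open O -> O x -> \forall y \near x, O y.
Proof. by move=> oO Ox; exact: open_nbhs_nbhs. Qed.

Lemma near_and (T : topologicalType) (P Q : T -> Prop) (x : T) :
  (\forall y \near x, P y) -> (\forall y \near x, Q y) ->
  \forall y \near x, P y /\ Q y.
Proof. exact: filterI. Qed.

Lemma near_forall (T : topologicalType) (I : finType) (P : I -> T -> Prop) (x : T) :
  (forall i, \forall y \near x, P i y) -> \forall y \near x, forall i, P i y.
Proof. exact: filter_forall. Qed.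

Lemma near_normP {R : realType} (V : normedModType R) (P : V -> Prop) (v : V) :
  (\forall w \near v, P w) <-> exists2 d : R, 0 < d & forall w, `|w - v| < d -> P w.
Proof.
split.
  move=> /nbhs_ballP[d /= d0 H]; exists d => // w wv; apply: H.
  by rewrite -ball_normE/= distrC.
move=> [d d0 H]; apply/nbhs_ballP; exists d => //= w.
by rewrite -ball_normE/= distrC => /H.
Qed.

Lemma continuous_near_eq (T U : topologicalType) (f g : T -> U) x :
  (\near x, f x = g x) -> {for x, continuous f} -> {for x, continuous g}.
Proof.
move=> fg cf; rewrite /prop_for /continuous_at -(nbhs_singleton fg).
by apply: cvg_trans cf; exact: near_eq_cvg.
Qed.

Section ContinuousAt.
Context {R : realType} {T : topologicalType}.
Implicit Types (f g : T -> R) (x : T).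

Lemma cont_cst (U : topologicalType) (a : U) x : {for x, continuous (fun _ : T => a)}.
Proof. exact: cvg_cst. Qed.

Lemma contD f g x : {for x, continuous f} -> {for x, continuous g} ->
  {for x, continuous (fun y => f y + g y)}.
Proof. by move=> cf cg; apply: cvgD. Qed.

Lemma contN f x : {for x, continuous f} -> {for x, continuous (fun y => - f y)}.
Proof. by move=> cf; apply: cvgN. Qed.

Lemma contM f g x : {for x, continuous f} -> {for x, continuous g} ->
  {for x, continuous (fun y => f y * g y)}.
Proof. by move=> cf cg; apply: cvgM. Qed.

Lemma contV f x : f x != 0 -> {for x, continuous f} ->
  {for x, continuous (fun y => (f y)^-1)}.
Proof. by move=> f0 cf; apply: cvgV. Qed.

Lemma contsqrt f x : {for x, continuous f} ->
  {for x, continuous (fun y => Num.sqrt (f y))}.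
Proof. by move=> cf; apply: continuous_comp => //; exact: sqrt_continuous. Qed.

Lemma cont_sum (I : finType) (P : pred I) (F : I -> T -> R) x :
  (forall i, P i -> {for x, continuous (F i)}) ->
  {for x, continuous (fun y => \sum_(i | P i) F i y)}.
Proof.
move=> cF; rewrite -(_ : (\sum_(i | P i) F i) = fun v => \sum_(i | P i) F i v); last first.
  by apply/funext => v; rewrite fct_sumE.
elim/big_ind : _ => //; first exact: cont_cst.
by move=> f g; exact: contD.
Qed.

End ContinuousAt.

Notation "''e_' i" := (delta_mx ord0 i : 'rV_ _) (at level 8, i at level 2).

Section SmoothFunctions.
Context {R : realType} {m : nat}.
Implicit Types (W : set 'rV[R]_m) (f g : 'rV[R]_m -> R).

Lemma Ck_cont k W g v : Ck k W g -> W v -> {for v, continuous g}.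
Proof. by case: k => [|k] [+ _]; apply. Qed.

Lemma Ck_ext k W f g : open W -> (forall v, W v -> f v = g v) ->
  Ck k W f -> Ck k W g.
Proof.
move=> oW; elim: k f g => [|k IH] f g fg [cf Df].
all: have nW v : W v -> \near v, f v = g v
  by move=> Wv; apply: filterS (open_near oW Wv) => w; exact: fg.
  split => // v Wv; exact: continuous_near_eq (nW _ Wv) (cf _ Wv).
split => [v Wv|i]; first exact: continuous_near_eq (nW _ Wv) (cf _ Wv).
have [D1 D2] := Df i; split => [v Wv|].
  by apply: near_eq_derivable (D1 _ Wv); exact: nW.
apply: IH D2 => v Wv; apply: near_eq_derive; exact: nW.
Qed.

Lemma Ck_sub k W W' g : W' `<=` W -> Ck k W g -> Ck k W' g.
Proof.
move=> sW; elim: k g => [|k IH] g [cg Dg].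
  by split => // v /sW; exact: cg.
split => [v /sW|i]; first exact: cg.
by have [D1 D2] := Dg i; split => [v /sW|]; [exact: D1|exact: IH].
Qed.

Lemma Ck_weak k W g : Ck k.+1 W g -> Ck k W g.
Proof.
elim: k g => [|k IH] g [cg Dg]; first by split.
split => // i; have [D1 D2] := Dg i; split => //; exact: IH.
Qed.

Lemma CkS k W g (dg : 'I_m -> 'rV[R]_m -> R) : open W ->
  (forall v, W v -> {for v, continuous g}) ->
  (forall i v, W v -> is_derive v 'e_i g (dg i v)) ->
  (forall i, Ck k W (dg i)) -> Ck k.+1 W g.
Proof.
move=> oW cg Dg Cdg; split => // i; split => [v Wv|].
  by have [] := Dg i v Wv.
by apply: Ck_ext (Cdg i) => // v Wv; rewrite (@derive_val _ _ _ _ _ _ _ (Dg i v Wv)).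
Qed.

Lemma Ck_is_derive k W g i v : Ck k.+1 W g -> W v ->
  is_derive v 'e_i g ('D_('e_i) g v).
Proof. by move=> [_ /(_ i)[D _]] Wv; apply: DeriveDef => //; exact: D. Qed.

Lemma Ck_derive k W g i : Ck k.+1 W g -> Ck k W ('D_('e_i) g).
Proof. by move=> [_ /(_ i)[]]. Qed.

Lemma Ck_cst k W (a : R) : open W -> Ck k W (fun=> a).
Proof.
move=> oW; elim: k a => [|k IH] a.
  by split => // v _; exact: cont_cst.
apply: (@CkS _ _ _ (fun _ _ => 0)) => // v _; exact: cont_cst.
Qed.

Lemma CkD k W f g : open W -> Ck k W f -> Ck k W g ->
  Ck k W (fun v => f v + g v).
Proof.
move=> oW; elim: k f g => [|k IH] f g Cf Cg.
  split => // v Wv; exact: (contD (Ck_cont Cf Wv) (Ck_cont Cg Wv)).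
apply: (@CkS _ _ _ (fun i v => 'D_('e_i) f v + 'D_('e_i) g v)) => //.
- move=> v Wv; exact: (contD (Ck_cont Cf Wv) (Ck_cont Cg Wv)).
- move=> i v Wv; exact: (is_deriveD (Ck_is_derive i Cf Wv) (Ck_is_derive i Cg Wv)).
- move=> i; apply: IH; exact: Ck_derive.
Qed.

Lemma CkM k W f g : open W -> Ck k W f -> Ck k W g ->
  Ck k W (fun v => f v * g v).
Proof.
move=> oW; elim: k f g => [|k IH] f g Cf Cg.
  split => // v Wv; exact: (contM (Ck_cont Cf Wv) (Ck_cont Cg Wv)).
apply: (@CkS _ _ _ (fun i v => f v * 'D_('e_i) g v + g v * 'D_('e_i) f v)) => //.
- move=> v Wv; exact: (contM (Ck_cont Cf Wv) (Ck_cont Cg Wv)).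
- move=> i v Wv.
  have Hf := Ck_is_derive i Cf Wv; have Hg := Ck_is_derive i Cg Wv.
  exact: (is_deriveM Hf Hg).
- move=> i; apply: CkD => //; apply: IH; first [exact: Ck_weak|exact: Ck_derive].
Qed.

Lemma Ck_coord k W (j : 'I_m) : open W -> Ck k W (fun v => v ord0 j).
Proof.
move=> oW.
have cc (v : 'rV[R]_m) : {for v, continuous (fun v : 'rV[R]_m => v ord0 j)}.
  exact: coord_continuous.
case: k => [|k]; first by split.
apply: (@CkS _ _ _ (fun i v => 'e_i ord0 j)) => // [i v Wv|i]; last exact: Ck_cst.
  have dc : differentiable (fun v : 'rV[R]_m => v ord0 j) v.
    exact: differentiable_coord.
  apply: DeriveDef; first exact: diff_derivable.
  rewrite deriveE//.
  have Lc : linear (fun N : 'rV[R]_m => N ord0 j : R^o) by move=> ? ? ?; rewrite !mxE.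
  pose Lin := HB.pack (fun N : 'rV[R]_m => N ord0 j : R^o) (GRing.isLinear.Build _ _ _ _ _ Lc) : {linear 'rV[R]_m -> R^o}.
  by rewrite (@diff_lin _ _ _ Lin)//=; exact: coord_continuous.
Qed.

Lemma Ck_sum k W (I : finType) (P : pred I) (F : I -> 'rV[R]_m -> R) : open W ->
  (forall i, P i -> Ck k W (F i)) -> Ck k W (fun v => \sum_(i | P i) F i v).
Proof.
move=> oW CF; rewrite -(_ : (\sum_(i | P i) F i) = fun v => \sum_(i | P i) F i v); last first.
  by apply/funext => v; rewrite fct_sumE.
elim/big_ind : _ => //; first exact: Ck_cst.
by move=> f g; exact: CkD.
Qed.

Lemma CkV k W f : open W -> (forall v, W v -> f v != 0) -> Ck k W f ->
  Ck k W (fun v => (f v)^-1).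
Proof.
move=> oW f0; elim: k f f0 => [|k IH] f f0 Cf.
  by split => // v Wv; exact: (contV (f0 v Wv) (Ck_cont Cf Wv)).
apply: (@CkS _ _ _ (fun i v => -1 * ((f v)^-1 * (f v)^-1 * 'D_('e_i) f v))) => //.
- by move=> v Wv; exact: (contV (f0 v Wv) (Ck_cont Cf Wv)).
- move=> i v Wv; have Hf := Ck_is_derive i Cf Wv.
  have [Df _] := Hf; apply: DeriveDef; first exact: derivableV (f0 _ Wv) Df.
  rewrite deriveV ?f0//.
  by rewrite /GRing.scale/= expr2 invfM mulN1r mulNr.
- move=> i; apply: CkM => //; first exact: Ck_cst.
  by do !apply: CkM => //; first [exact: Ck_derive|apply: IH => //; exact: Ck_weak].
Qed.

Lemma is_derive_sqrt_comp f i v df : 0 < f v -> is_derive v 'e_i f df ->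
  {for v, continuous f} ->
  is_derive v 'e_i (fun w => Num.sqrt (f w)) (2^-1 * ((Num.sqrt (f v))^-1 * df)).
Proof.
move=> f0 Df _; rewrite -[v in is_derive v](add0r v) -(scale0r 'e_i).
apply: (is_derive_line _ v 'e_i 0 _).2.
have Df1 : is_derive (0 : R) (1 : R) (fun h => f (h *: 'e_i + v)) df.
  by apply: (is_derive_line f v 'e_i 0 df).1; rewrite scale0r add0r.
have H0 : 0 < f ((0:R) *: 'e_i + v) by rewrite scale0r add0r.
apply: is_derive_eq.
  exact: (@is_derive1_comp _ _ _ _ _ _ (is_derive1_sqrt H0) Df1).
by rewrite scale0r add0r invfM mulrA.
Qed.

Lemma Ck_sqrt k W f : open W -> (forall v, W v -> 0 < f v) -> Ck k W f ->
  Ck k W (fun v => Num.sqrt (f v)).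
Proof.
move=> oW f0; elim: k => [|k IH] Cf.
  by split => // v Wv; exact: (contsqrt (Ck_cont Cf Wv)).
apply: (@CkS _ _ _ (fun i v => 2^-1 * ((Num.sqrt (f v))^-1 * 'D_('e_i) f v))) => //.
- by move=> v Wv; exact: (contsqrt (Ck_cont Cf Wv)).
- move=> i v Wv; apply: is_derive_sqrt_comp; first exact: f0.
    exact: (Ck_is_derive i Cf Wv).
  exact: (Ck_cont Cf).
- move=> i; apply: CkM => //; first exact: Ck_cst.
  apply: CkM => //; last exact: Ck_derive.
  apply: CkV => //; first by move=> v Wv; rewrite sqrtr_eq0 -ltNge f0.
  apply: IH; exact: Ck_weak.
Qed.

(** The corners of the coordinate path from 0 to [h]: consecutive truncations differ in one
    coordinate, so that an increment telescopes into one-variable increments. *)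
Definition trunc (k : nat) (h : 'rV[R]_m) : 'rV[R]_m :=
  \row_j (if (j < k)%N then h ord0 j else 0).

Lemma truncS (k : 'I_m) h : trunc k.+1 h = h ord0 k *: 'e_k + trunc k h.
Proof.
apply/rowP => j; rewrite !mxE eqxx/= ltnS leq_eqVlt.
have [->|jk] := eqVneq j k; first by rewrite eqxx ltnn mulr1 addr0.
by rewrite (negbTE (_ : nat_of_ord j != k))// mulr0 add0r.
Qed.

Lemma norm_row_le (h : 'rV[R]_m) (e : R) : 0 <= e ->
  (forall i, `|h ord0 i| <= e) -> `|h| <= e.
Proof.
move=> e0 H; rewrite [`|h|]mx_normrE; apply: bigmax_le => // -[i j] _ /=.
by rewrite (ord1 i).
Qed.

Lemma norm_coord_le (h : 'rV[R]_m) i : `|h ord0 i| <= `|h|.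
Proof. by rewrite [`|h|]mx_normrE (le_bigmax _ _ (ord0, i)). Qed.

Lemma C1_frechet W g v (e : R) : open W -> Ck 1 W g -> W v -> 0 < e ->
  \forall h \near nbhs (0 : 'rV[R]_m),
    `|g (h + v) - (g v + \sum_i h ord0 i * 'D_('e_i) g v)| <= e * `|h|.
Proof.
move=> oW Cg Wv e0.
  (* The error [e] is shared among the [m] coordinates; [m.+1] keeps the divisor nonzero when
     [m = 0]. *)
  have m0 : 0 < (m.+1)%:R :> R by rewrite ltr0n.
  have [d d0 Hd] : exists2 d : R, 0 < d & forall w, `|w - v| < d -> W w /\
      forall i, `|'D_('e_i) g w - 'D_('e_i) g v| <= e / (m.+1)%:R.
    apply/(@near_normP R 'rV[R]_m); apply: (@near_and 'rV[R]_m).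
      exact: (@open_near 'rV[R]_m).
    apply: (@near_forall 'rV[R]_m) => i.
    have := Ck_cont (Ck_derive i Cg) Wv.
    by move=> /cvgrPdistC_le/(_ _ (divr_gt0 e0 m0)).
  apply/(@near_normP R 'rV[R]_m); exists d => // h; rewrite subr0 => hd.
  pose F k := g (trunc k h + v).
  have F0 : F 0%N = g v by rewrite /F (_ : trunc 0 h = 0) ?add0r//; apply/rowP => j; rewrite !mxE.
  have Fm : F m = g (h + v).
    by rewrite /F (_ : trunc m h = h)//; apply/rowP => j; rewrite !mxE ltn_ord.
  rewrite (_ : _ - _ = \sum_(k < m) (F k.+1 - F k - h ord0 k * 'D_('e_k) g v)); last first.
    rewrite sumrB -(big_mkord xpredT (fun k => F k.+1 - F k)) telescope_sumr// Fm F0.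
    by rewrite /= opprD addrA.
  apply: (le_trans (ler_norm_sum _ _ _)).
  apply: (@le_trans _ _ (\sum_(k < m) (e / (m.+1)%:R * `|h|))); last first.
    rewrite sumr_const card_ord -[X in X <= _]mulr_natr [X in X <= _]mulrAC.
    apply: ler_wpM2r => //; rewrite -mulrA ler_piMr ?(ltW e0)// mulrC.
    by rewrite ler_pdivrMr// mul1r ler_nat.
  apply: ler_sum => k _.
  have near_tr x : `|x| <= `|h ord0 k| -> `|x *: 'e_k + (trunc k h + v) - v| < d.
    move=> xh; rewrite addrA addrK; apply: le_lt_trans hd.
    apply: norm_row_le => // j; rewrite !mxE eqxx/=.
    have [->|jk] := eqVneq j k.
      by rewrite ltnn addr0 mulr1 (le_trans xh)// norm_coord_le.
    by rewrite mulr0 add0r; case: ifP => _; rewrite ?norm_coord_le// normr0.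
  have := @mvt_bound _ (fun s => g (s *: 'e_k + (trunc k h + v)))
    (fun s => 'D_('e_k) g (s *: 'e_k + (trunc k h + v))) (h ord0 k)
    ('D_('e_k) g v) (e / (m.+1)%:R).
  rewrite scale0r add0r addrA -truncS => H; apply: (le_trans (H _ _)).
  - move=> x /near_tr/Hd[Wx _]; exact: ((is_derive_line g (trunc k h + v) 'e_k x _).1 (Ck_is_derive k Cg Wx)).
  - by move=> x /near_tr/Hd[_]; exact.
  - by rewrite ler_wpM2l ?norm_coord_le// divr_ge0// ltW.
Qed.

Lemma C1_diff W g v : open W -> Ck 1 W g -> W v ->
  differentiable g v /\ forall h, 'd g v h = \sum_i h ord0 i * 'D_('e_i) g v.
Proof.
move=> oW Cg Wv.
pose L (h : 'rV[R]_m) : R := \sum_i h ord0 i * 'D_('e_i) g v.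
have linL : linear L.
  move=> a x y; rewrite /L scaler_sumr -big_split/=; apply: eq_bigr => i _.
  by rewrite !mxE mulrDl /GRing.scale/= mulrA.
have [LL LLE] : exists LL : {linear 'rV[R]_m -> R}, LL = L :> (_ -> _).
  pose LL := HB.pack L (GRing.isLinear.Build _ _ _ _ _ linL) : {linear 'rV[R]_m -> R}.
  by exists LL.
have cL : continuous LL.
  rewrite LLE.
  move=> w; apply: cont_sum => i _; apply: contM; last exact: cont_cst.
  exact: coord_continuous.
suff H (e : R) : 0 < e -> \forall h \near nbhs (0 : 'rV[R]_m), `|g (h + v) - (g v + LL h)| <= e * `|h|.
  by have [D1 D2] := diff_from cL H; split => // h; rewrite D2 LLE.
move=> e0; apply: filterS (C1_frechet oW Cg Wv e0) => h.
by rewrite LLE.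
Qed.

Lemma chain_line W g (gam : R -> 'rV[R]_m) (dgam : 'rV[R]_m) (x : R) :
  open W -> Ck 1 W g -> W (gam x) ->
  (forall j, is_derive x (1 : R) (fun t => gam t ord0 j) (dgam ord0 j)) ->
  is_derive x (1 : R) (fun t => g (gam t)) (\sum_j dgam ord0 j * 'D_('e_j) g (gam x)).
Proof.
move=> oW Cg Wx Dgam.
have Dg : derivable gam x (1 : R).
  by apply/derivable_mxP => i j; rewrite (ord1 i); exact: ex_derive.
have dE : 'D_1 gam x = dgam.
  by rewrite derive_mx//; apply/rowP => j; rewrite !mxE derive_val.
have [gd gE] := C1_diff oW Cg Wx.
have Dg1 : differentiable gam x by apply/derivable1_diffP.
have dc : differentiable (g \o gam) x by exact: differentiable_comp.
apply: DeriveDef; first exact/derivable1_diffP.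
rewrite deriveE// diff_comp//= gE; apply: eq_bigr => j _.
by congr (_ * _); rewrite -dE deriveE.
Qed.

End SmoothFunctions.

Lemma cont_row {R : realType} (T : topologicalType) m (F : 'I_m -> T -> R) (x : T) :
  (forall j, {for x, continuous (F j)}) ->
  {for x, continuous (fun t => \row_j F j t : 'rV[R]_m)}.
Proof.
move=> cF; apply/(@cvgrPdist_lt R 'rV[R]_m) => e e0.
have : \forall t \near x, forall j, `|F j x - F j t| <= e / 2.
  apply: near_forall => j.
  by have /cvgrPdist_le/(_ _ (divr_gt0 e0 (ltr0n _ 2))) := cF j.
apply: filterS => t H; apply: (@le_lt_trans _ _ (e / 2)); last first.
  by rewrite ltr_pdivrMr// ltr_pMr// ltr1n.
apply: norm_row_le; first by rewrite divr_ge0// ltW.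
by move=> i; rewrite !mxE.
Qed.

Section Composition.
Context {R : realType} {m m' : nat}.
Implicit Types (W : set 'rV[R]_m) (f : 'rV[R]_m' -> R).

(** The derivatives of the composite are sums of products of derivatives of [g] with partial
    derivatives of [f] composed with [g]; the induction hypothesis is used with [f] replaced by its
    partial derivatives and the same [g]. *)
Lemma Ck_comp k W (W' : set 'rV[R]_m') f (g : 'I_m' -> 'rV[R]_m -> R) :
  open W -> open W' -> (forall j, Ck k W (g j)) -> Ck k W' f ->
  (forall v, W v -> W' (\row_j g j v)) -> Ck k W (fun v => f (\row_j g j v)).
Proof.
move=> oW oW'; elim: k f g => [|k IH] f g Cg Cf gW.
all: have cc v : W v -> {for v, continuous (fun v => f (\row_j g j v))}
  by move=> Wv; apply: (@continuous_comp _ _ _ (fun v => \row_j g j v) f);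
    [apply: cont_row => j; exact: Ck_cont (Cg j) Wv|exact: Ck_cont Cf (gW _ Wv)].
  by split.
apply: (@CkS _ _ _ _ _ (fun i v => \sum_j 'D_('e_i) (g j) v * 'D_('e_j) f (\row_j g j v))) => //.
- move=> i v Wv.
  have C1f : Ck 1 W' f by elim: (k) Cf => // k' IH' /Ck_weak/IH'.
  have -> : v = 0 *: 'e_i + v by rewrite scale0r add0r.
  apply: (is_derive_line _ v 'e_i 0 _).2.
  have := @chain_line _ _ W' f (fun s => \row_j g j (s *: 'e_i + v))
    (\row_j 'D_('e_i) (g j) v) 0 oW' C1f.
  rewrite scale0r add0r => H.
  apply: is_derive_eq; first (apply: H; first exact: gW).
    move=> j; rewrite mxE.
    rewrite (_ : (fun t => _) = (fun t => g j (t *: 'e_i + v))); last first.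
      by apply/funext => t; rewrite mxE.
    apply: (is_derive_line _ v 'e_i 0 _).1; rewrite scale0r add0r.
    exact: (Ck_is_derive i (Cg j) Wv).
  by apply: eq_bigr => j _; rewrite mxE.
- move=> i; apply: Ck_sum => // j _; apply: CkM => //; first exact: Ck_derive.
  apply: (IH ('D_('e_j) f) g) => // [j'|]; [exact: Ck_weak|exact: Ck_derive].
Qed.

End Composition.

Section Smooth.
Context {R : realType} {m : nat}.
Implicit Types (W : set 'rV[R]_m) (f g : 'rV[R]_m -> R).

Lemma smooth_cont W g v : smooth W g -> W v -> {for v, continuous g}.
Proof. by move=> /(_ 0%N)/Ck_cont H; exact: H. Qed.

Lemma smooth_sub W W' g : W' `<=` W -> smooth W g -> smooth W' g.
Proof. by move=> sW Sg k; exact: Ck_sub (Sg k). Qed.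

Lemma smooth_ext W f g : open W -> (forall v, W v -> f v = g v) ->
  smooth W f -> smooth W g.
Proof. by move=> oW fg Sf k; exact: Ck_ext (Sf k). Qed.

Lemma smooth_cst W (a : R) : open W -> smooth W (fun=> a).
Proof. by move=> oW k; exact: Ck_cst. Qed.

Lemma smooth_coord W j : open W -> smooth W (fun v => v ord0 j).
Proof. by move=> oW k; exact: Ck_coord. Qed.

Lemma smoothD W f g : open W -> smooth W f -> smooth W g ->
  smooth W (fun v => f v + g v).
Proof. by move=> oW Sf Sg k; exact: CkD. Qed.

Lemma smoothM W f g : open W -> smooth W f -> smooth W g ->
  smooth W (fun v => f v * g v).
Proof. by move=> oW Sf Sg k; exact: CkM. Qed.

Lemma smooth_sum W (I : finType) (P : pred I) (F : I -> 'rV[R]_m -> R) : open W ->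
  (forall i, P i -> smooth W (F i)) -> smooth W (fun v => \sum_(i | P i) F i v).
Proof. by move=> oW SF k; apply: Ck_sum => // i Pi; exact: SF. Qed.

Lemma smoothV W f : open W -> (forall v, W v -> f v != 0) -> smooth W f ->
  smooth W (fun v => (f v)^-1).
Proof. by move=> oW f0 Sf k; exact: CkV. Qed.

Lemma smooth_sqrt W f : open W -> (forall v, W v -> 0 < f v) -> smooth W f ->
  smooth W (fun v => Num.sqrt (f v)).
Proof. by move=> oW f0 Sf k; exact: Ck_sqrt. Qed.

Lemma smooth_derive W g i : smooth W g -> smooth W ('D_('e_i) g).
Proof. by move=> Sg k; exact: Ck_derive. Qed.

Lemma smooth_comp m' W (W' : set 'rV[R]_m') (f : 'rV[R]_m' -> R)
    (g : 'I_m' -> 'rV[R]_m -> R) :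
  open W -> open W' -> (forall j, smooth W (g j)) -> smooth W' f ->
  (forall v, W v -> W' (\row_j g j v)) -> smooth W (fun v => f (\row_j g j v)).
Proof.
by move=> oW oW' Sg Sf gW k; apply: (@Ck_comp _ _ _ _ W W') => // j; exact: Sg.
Qed.

End Smooth.

(** * Hadamard's lemma *)

Section UnitIntegral.
Context {R : realType}.
Implicit Types f g : R -> R.

Definition int01 f : R := \int[lebesgue_measure]_(t in `[0%R, 1%R]%classic) f t.

Definition cont01 f := forall t : R, 0 <= t <= 1 -> {for t, continuous f}.

Lemma cont01_within f : cont01 f -> {within `[0, 1], continuous f}.
Proof.
move=> cf; apply/continuous_in_subspaceT => z; rewrite inE/= in_itv/=.
exact: cf.
Qed.

Lemma cont01_integrable f : cont01 f ->
  lebesgue_measure.-integrable `[0%R, 1%R]%classic (EFin \o f).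
Proof.
move=> cf; apply: continuous_compact_integrable; first exact: segment_compact.
exact: cont01_within.
Qed.

Lemma int01_cst (a : R) : int01 (fun=> a) = a.
Proof.
rewrite /int01 Rintegral_cst//.
have E := @lebesgue_measure_itv R `[0%R, 1%R].
rewrite /= lte_fin ltr01 -EFinB subr0 in E.
by rewrite [X in fine X]E mulr1.
Qed.

Lemma int01B f g : cont01 f -> cont01 g ->
  int01 (fun t => f t - g t) = int01 f - int01 g.
Proof. by move=> cf cg; rewrite /int01 RintegralB//; exact: cont01_integrable. Qed.

Lemma int01D f g : cont01 f -> cont01 g ->
  int01 (fun t => f t + g t) = int01 f + int01 g.
Proof. by move=> cf cg; rewrite /int01 RintegralD//; exact: cont01_integrable. Qed.

Lemma int01Z (a : R) f : cont01 f -> int01 (fun t => a * f t) = a * int01 f.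
Proof. by move=> cf; rewrite /int01 RintegralZl//; exact: cont01_integrable. Qed.

Lemma eq_int01 f g : (forall t, 0 <= t <= 1 -> f t = g t) -> int01 f = int01 g.
Proof.
move=> fg; apply: eq_Rintegral => t; rewrite inE/= in_itv/=; exact: fg.
Qed.

Lemma int01_le f g : cont01 f -> cont01 g ->
  (forall t, 0 <= t <= 1 -> f t <= g t) -> int01 f <= int01 g.
Proof.
move=> cf cg fg; apply: le_Rintegral => //; first exact: cont01_integrable.
  exact: cont01_integrable.
Qed.

Lemma int01_bound f (e : R) : cont01 f ->
  (forall t, 0 <= t <= 1 -> `|f t| <= e) -> `|int01 f| <= e.
Proof.
move=> cf fe; rewrite ler_norml; apply/andP; split.
  rewrite -(int01_cst (- e)); apply: int01_le => // [t _|t /fe].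
    exact: cont_cst.
  by rewrite ler_norml => /andP[].
rewrite -[leRHS](int01_cst e); apply: int01_le => // [t _|t /fe].
  exact: cont_cst.
by rewrite ler_norml => /andP[].
Qed.

Lemma int01_sum (I : finType) (P : pred I) (F : I -> R -> R) :
  (forall i, P i -> cont01 (F i)) ->
  int01 (fun t => \sum_(i | P i) F i t) = \sum_(i | P i) int01 (F i).
Proof.
move=> cF; rewrite -(_ : (\sum_(i | P i) F i) = fun v => \sum_(i | P i) F i v); last first.
  by apply/funext => v; rewrite fct_sumE.
suff : cont01 (\sum_(i | P i) F i) /\ int01 (\sum_(i | P i) F i) = \sum_(i | P i) int01 (F i) by case.
elim/big_rec2 : _ => [|i y f Pi [cf fE]].
  by split; [move=> t _; exact: cont_cst|exact: int01_cst].
split; first by move=> t Ht; apply: contD; [exact: cF|exact: cf].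
by rewrite -fE -int01D//; exact: cF.
Qed.

Lemma FTC01 f df : (forall t : R, 0 <= t <= 1 -> is_derive t (1 : R) f (df t)) ->
  cont01 df -> int01 df = f 1 - f 0.
Proof.
move=> Df cdf.
have cf (t : R) : 0 <= t <= 1 -> {for t, continuous f}.
  move=> /Df[D _]; apply: differentiable_continuous; exact/derivable1_diffP.
rewrite /int01 /Rintegral (@continuous_FTC2 _ df f)//.
- exact: cont01_within.
- split.
  + by move=> x; rewrite in_itv/= => /andP[x0 x1]; have [] := Df x; rewrite ?ltW.
  + by apply: cvg_at_right_filter; apply: cf; rewrite lexx ler01.
  + by apply: cvg_at_left_filter; apply: cf; rewrite lexx ler01.
- move=> x; rewrite in_itv/= => /andP[x0 x1]; rewrite derive1E.
  by have [|_ ->] := Df x; rewrite ?ltW.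
Qed.

End UnitIntegral.

Lemma cont_id (T : topologicalType) (x : T) : {for x, continuous (fun y : T => y)}.
Proof. exact: cvg_id. Qed.

Lemma near_mono (T : topologicalType) (P Q : T -> Prop) (x : T) :
  (forall y, P y -> Q y) -> (\forall y \near x, P y) -> \forall y \near x, Q y.
Proof. by move=> PQ; exact: filterS. Qed.

Lemma derive_eps {R : realType} (f : R -> R) (c : R) :
  (forall e : R, 0 < e -> \forall s \near (0 : R), `|f s - f 0 - s * c| <= e * `|s|) ->
  is_derive (0 : R) (1 : R) f c.
Proof.
move=> H; have linL : linear (fun h : R => h * c : R).
  by move=> a x y; rewrite mulrDl /GRing.scale/= mulrA.
pose L := HB.pack (fun h : R => h * c : R) (GRing.isLinear.Build _ _ _ _ _ linL) : {linear R -> R}.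
have cL : continuous L.
  by move=> x; apply: contM; [exact: cont_id|exact: cont_cst].
have [|df dE] := @diff_from R R R f L 0 cL.
  move=> e /H; apply: filterS => s; rewrite addr0 opprD addrA; exact.
apply: DeriveDef; first exact/derivable1_diffP.
by rewrite deriveE// dE/= mul1r.
Qed.

Lemma is_derive_affine {R : realType} (a b y : R) :
  is_derive y (1 : R) (fun t : R => t * a + b) a.
Proof.
apply: is_derive_eq.
by rewrite ?scaler0 ?addr0 /GRing.scale/= ?mulr1 ?mul1r ?add0r ?mulr0 ?add0r.
Qed.

Lemma cont_epsP {R : realType} (T : topologicalType) (f : T -> R) (x : T) :
  {for x, continuous f} <->
  (forall e : R, 0 < e -> \forall y \near x, `|f y - f x| <= e).
Proof.
split; first by move=> /cvgrPdistC_le.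
by move=> H; apply/cvgrPdistC_le.
Qed.

Section Hadamard.
Context {R : realType} {m : nat} (I : {set 'I_m}).
Implicit Types (W : set 'rV[R]_m) (H g : 'rV[R]_m -> R) (v : 'rV[R]_m).

Definition sc (t : R) v : 'rV[R]_m :=
  \row_i (if i \in I then t * v ord0 i else v ord0 i).

Definition star W := forall v (t : R), W v -> 0 <= t <= 1 -> W (sc t v).

(** Hadamard's integral. Each derivative in a direction of [I] brings out one factor [t] from the
    contraction [sc t]; with the weight [t ^+ j] the family is closed under partial derivatives, so
    that its smoothness can be proved by induction. *)
Definition avg j H v := int01 (fun t => t ^+ j * H (sc t v)).

Lemma sc1 v : sc 1 v = v.
Proof. by apply/rowP => i; rewrite mxE mul1r if_same. Qed.

Lemma sc_delta t v i s : sc t (s *: 'e_i + v) =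
  (s * (if i \in I then t else 1)) *: 'e_i + sc t v.
Proof.
apply/rowP => j; rewrite !mxE eqxx/=; have [->|ji] := eqVneq j i.
  by case: ifP => _; rewrite !mulr1// mulrDr [t * s]mulrC.
by rewrite !mulr0 !add0r.
Qed.

Lemma sc_cont2 (p : R * 'rV[R]_m) : {for p, continuous (fun q => sc q.1 q.2)}.
Proof.
apply: cont_row => j.
have c1 : {for p, continuous (fun q : R * 'rV[R]_m => q.1)} by exact: cvg_fst.
have c2 : {for p, continuous (fun q : R * 'rV[R]_m => q.2 ord0 j)}.
  by apply: (@continuous_comp _ _ _ snd (fun v : 'rV[R]_m => v ord0 j));
    [exact: cvg_snd|exact: coord_continuous].
by case: (j \in I) => //; exact: contM.
Qed.

Lemma cont_sc W H v : star W -> (forall v, W v -> {for v, continuous H}) -> W v ->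
  cont01 (fun t => H (sc t v)).
Proof.
move=> sW cH Wv t t01.
apply: (@continuous_comp _ _ _ (fun t => sc t v) H); last by apply: cH; exact: sW.
apply: cont_row => i; case: (i \in I); last exact: cont_cst.
by apply: contM; [exact: cont_id|exact: cont_cst].
Qed.

Lemma cont_avg_fun j W H v : star W -> (forall v, W v -> {for v, continuous H}) -> W v ->
  cont01 (fun t => t ^+ j * H (sc t v)).
Proof.
move=> sW cH Wv t t01; apply: contM; first exact: exprn_continuous.
exact: (cont_sc sW cH Wv t01).
Qed.

(** Compactness of the interval from 0 to 1 makes the continuity of [H (sc t w)] in [w] uniform in
    [t]. *)
Lemma sc_unif W H v (e : R) : open W -> star W ->
  (forall v, W v -> {for v, continuous H}) -> W v -> 0 < e ->
  \forall w \near v, forall t, 0 <= t <= 1 -> `|H (sc t w) - H (sc t v)| <= e.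
Proof.
move=> oW sW cH Wv e0.
have /compact_near_coveringP cpt := @segment_compact R 0 1.
have := cpt 'rV[R]_m (nbhs v) (fun w t => `|H (sc t w) - H (sc t v)| <= e) _ _.
have H1 : forall t : R, `[0, 1]%classic t -> \forall t' \near t & w \near nbhs v,
    `|H (sc t' w) - H (sc t' v)| <= e.
  move=> t; rewrite /= in_itv/= => t01.
  have cG : {for (t, v), continuous (fun q : R * 'rV[R]_m => H (sc q.1 q.2))}.
    apply: (@continuous_comp _ _ _ (fun q : R * 'rV[R]_m => sc q.1 q.2) H).
      exact: sc_cont2.
    by apply: cH; exact: sW.
  have /cvgrPdist_le/(_ _ (divr_gt0 e0 (ltr0n _ 2)))[[A B]/= [At Bv] AB] := cG.
  exists (A, B) => // -[t' w] /= [At' Bw].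
  have := AB (t', w) (conj At' Bw); have := AB (t', v) (conj At' (nbhs_singleton Bv)).
  move=> /= H1 H2; rewrite -(subrKA (H (sc t v))) (le_trans (ler_normD _ _))//.
  by rewrite [leRHS]splitr lerD// distrC.
move=> /(_ _ H1) HH; apply: filterS HH => w Hw t t01; apply: Hw.
by rewrite /= in_itv.
Qed.

Lemma avg_cont j W H v : open W -> star W ->
  (forall v, W v -> {for v, continuous H}) -> W v -> {for v, continuous (avg j H)}.
Proof.
move=> oW sW cH Wv; apply/(@cont_epsP R 'rV[R]_m) => e e0.
apply: near_mono (near_and (open_near oW Wv) (sc_unif oW sW cH Wv e0)).
move=> w [Ww Hw]; rewrite /avg -int01B; do ?exact: (cont_avg_fun sW cH).
apply: int01_bound => [t t01|t t01].
  by apply: contD; [|apply: contN]; exact: (cont_avg_fun sW cH).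
rewrite -mulrBr normrM; have /andP[t0 t1] := t01.
rewrite -[leRHS]mul1r ler_pM// ?Hw// normrX ger0_norm//.
exact: exprn_ile1.
Qed.

(** Differentiation under the integral sign by a direct estimate: the integrand deviates from its
    linear part by at most [e * |s|], uniformly in [t], hence so does the integral. *)
Lemma avg_derive j W H v i : open W -> star W -> Ck 1 W H -> W v ->
  is_derive v 'e_i (avg j H) (avg (j + (i \in I)) ('D_('e_i) H) v).
Proof.
move=> oW sW CH Wv; have cH w : W w -> {for w, continuous H} by exact: (Ck_cont CH).
have cDH w : W w -> {for w, continuous ('D_('e_i) H)}.
  exact: (Ck_cont (Ck_derive i CH)).
rewrite -[v in is_derive v](add0r v) -(scale0r 'e_i).
apply: (is_derive_line _ v 'e_i 0 _).2; apply: derive_eps => e e0.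
have [d d0 Hd] := (@near_normP R 'rV[R]_m _ v).1
  (near_and (open_near oW Wv) (sc_unif oW sW cDH Wv e0)).
apply/(@near_normP R R^o); exists d => // s; rewrite subr0 => sd.
have Ny (y : R) : `|y| <= `|s| -> `|y *: 'e_i + v - v| < d.
  move=> ys; rewrite addrK; apply: le_lt_trans sd; apply: norm_row_le => // l.
  rewrite !mxE eqxx/=; case: (l == i); first by rewrite mulr1.
  by rewrite mulr0 normr0.
(* The rate at which [sc t] moves when the [i]-th coordinate does. *)
pose ct (t : R) := if i \in I then t else 1.
have ct1 (t : R) : 0 <= t <= 1 -> `|ct t| <= 1.
  rewrite /ct; case: (i \in I) => [/andP[t0 t1]|_]; last by rewrite normr1.
  by rewrite ger0_norm.
have Bt (t : R) : 0 <= t <= 1 ->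
    `|H (sc t (s *: 'e_i + v)) - H (sc t v) - s * (ct t * 'D_('e_i) H (sc t v))|
      <= e * `|s|.
  move=> t01; have := @mvt_bound R (fun y => H (sc t (y *: 'e_i + v)))
    (fun y => ct t * 'D_('e_i) H (sc t (y *: 'e_i + v))) s
    (ct t * 'D_('e_i) H (sc t v)) e.
  rewrite scale0r add0r; apply.
  - move=> y /Ny/Hd[Wy _].
    apply: is_derive_eq.
      apply: (@chain_line _ _ W H (fun y => sc t (y *: 'e_i + v)) (ct t *: 'e_i) y oW CH).
        exact: sW.
      move=> l.
      have -> : (fun y : R => sc t (y *: ('e_i : 'rV[R]_m) + v) ord0 l) =
                (fun y : R => y * (ct t *: ('e_i : 'rV[R]_m)) ord0 l + (sc t v) ord0 l).
        by apply/funext => z; rewrite sc_delta/= !mxE -!mulrA.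
      exact: is_derive_affine.
    rewrite (bigD1 i)//= !mxE !eqxx mulr1 big1 ?addr0// => l li.
    by rewrite !mxE (negbTE li) andbF mulr0 mul0r.
  - move=> y /Ny/Hd[_ Hy]; rewrite -mulrBr normrM -[leRHS]mul1r.
    by rewrite ler_pM// ?ct1// Hy.
have Ws : W (s *: 'e_i + v) by have [] := Hd _ (Ny s (lexx _)).
have c1 := cont_avg_fun (j := j) sW cH Ws; have c2 := cont_avg_fun (j := j) sW cH Wv.
have c3 := cont_avg_fun (j := j + (i \in I)) sW cDH Wv.
have c4 : cont01 (fun t => s * (t ^+ (j + (i \in I)) * 'D_('e_i) H (sc t v))).
  by move=> t t01; apply: contM; [exact: cont_cst|exact: c3].
have c5 : cont01 (fun t => t ^+ j * H (sc t (s *: 'e_i + v)) - t ^+ j * H (sc t v)).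
  by move=> t t01; apply: contD; [exact: c1|apply: contN; exact: c2].
rewrite scale0r add0r /avg -int01B// -int01Z// -int01B//.
apply: int01_bound.
  by move=> t t01; apply: contD; [exact: c5|apply: contN; exact: c4].
move=> t t01; have -> : t ^+ j * H (sc t (s *: 'e_i + v)) - t ^+ j * H (sc t v) -
    s * (t ^+ (j + (i \in I)) * 'D_('e_i) H (sc t v)) =
  t ^+ j * (H (sc t (s *: 'e_i + v)) - H (sc t v) - s * (ct t * 'D_('e_i) H (sc t v))).
  rewrite exprD /ct; case: (i \in I); rewrite ?expr1 ?expr0; ring.
have /andP[t0 t1] := t01.
rewrite normrM -[leRHS]mul1r ler_pM// ?Bt// normrX ger0_norm//.
exact: exprn_ile1.
Qed.

Lemma Ck_avg k j W H : open W -> star W -> Ck k W H -> Ck k W (avg j H).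
Proof.
move=> oW sW; elim: k j H => [|k IH] j H CH.
  by split => // v Wv; apply: (avg_cont oW sW _ Wv) => w; exact: Ck_cont CH.
apply: (@CkS _ _ _ _ _ (fun i v => avg (j + (i \in I)) ('D_('e_i) H) v)) => //.
- by move=> v Wv; apply: (avg_cont oW sW _ Wv) => w; exact: Ck_cont CH.
- move=> i v Wv; apply: avg_derive Wv => //.
  by elim: (k) CH => // k' IH' /Ck_weak/IH'.
- by move=> i; apply: IH; exact: Ck_derive.
Qed.

(** The fundamental theorem of calculus along [t |-> sc t v]; [h i] is the mean of the [i]-th
    partial derivative over this segment. *)
Lemma hadamard W g : open W -> star W -> smooth W g ->
  exists h : 'I_m -> 'rV[R]_m -> R, (forall i, smooth W (h i)) /\
    forall v, W v -> g v = g (sc 0 v) + \sum_(i in I) v ord0 i * h i v.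
Proof.
move=> oW sW Sg; exists (fun i => avg 0 ('D_('e_i) g)); split.
  by move=> i k; apply: Ck_avg => //; exact: smooth_derive.
move=> v Wv; pose df t := \sum_(i in I) v ord0 i * 'D_('e_i) g (sc t v).
have cD i : cont01 (fun t => 'D_('e_i) g (sc t v)).
  apply: (@cont_sc W ('D_('e_i) g) v) => // w Ww; apply: smooth_cont Ww; exact: smooth_derive.
have cdf : cont01 df.
  move=> t t01; apply: cont_sum => i _; apply: contM; first exact: cont_cst.
  exact: cD.
have Dg (t : R) : 0 <= t <= 1 -> is_derive t (1 : R) (fun t => g (sc t v)) (df t).
  move=> t01; rewrite /df.
  apply: is_derive_eq.
    apply: (@chain_line _ _ W g (fun t => sc t v)
      (\row_i (if i \in I then v ord0 i else 0)) t oW (Sg 1%N) (sW _ _ Wv t01)).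
    move=> i; rewrite mxE.
    have -> : (fun t : R => sc t v ord0 i) = fun t : R =>
        t * (if i \in I then v ord0 i else 0) + (if i \in I then 0 else v ord0 i).
      by apply/funext => s; rewrite mxE; case: ifP; rewrite ?addr0// mulr0 add0r.
    exact: is_derive_affine.
  rewrite [RHS]big_mkcond; apply: eq_bigr => i _; rewrite mxE.
  by case: ifP => _//; rewrite mul0r.
have := FTC01 Dg cdf; rewrite sc1 => E.
rewrite -[LHS](subrK (g (sc 0 v))) addrC -E; congr (_ + _).
rewrite int01_sum; last first.
  by move=> i _ t t01; apply: contM; [exact: cont_cst|exact: cD].
apply: eq_bigr => i _; rewrite int01Z//; congr (_ * _); apply: eq_int01 => t _.
by rewrite expr0 mul1r.
Qed.

End Hadamard.

(** * Charts and diffeomorphisms *)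

Section SmoothOf.
Context {R : realType}.

Lemma so_sub (T : Type) m k (A A' : set T) (phi : T -> 'rV[R]_m) (f : T -> 'rV[R]_k) :
  A' `<=` A -> smooth_of A phi f -> smooth_of A' phi f.
Proof.
move=> sA H p i /sA Ap; have [W [g [ oW Wp Sg E]]] := H p i Ap.
by exists W, g; split=> // q /sA; exact: E.
Qed.

Lemma so_ext (T : Type) m k (A : set T) (phi phi' : T -> 'rV[R]_m) (f f' : T -> 'rV[R]_k) :
  (forall q, A q -> phi q = phi' q) -> (forall q, A q -> f q = f' q) ->
  smooth_of A phi f -> smooth_of A phi' f'.
Proof.
move=> Ep Ef H p i Ap; have [W [g [ oW Wp Sg E]]] := H p i Ap.
by exists W, g; split=> // [|q Aq]; rewrite -?Ep// -?Ef//; exact: E.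
Qed.

Lemma so_smooth (T : Type) m k (A : set T) (W : set 'rV[R]_m) (g : 'I_k -> 'rV[R]_m -> R)
    (phi : T -> 'rV[R]_m) (f : T -> 'rV[R]_k) :
  open W -> (forall i, smooth W (g i)) -> (forall q, A q -> W (phi q)) ->
  (forall q i, A q -> f q ord0 i = g i (phi q)) -> smooth_of A phi f.
Proof. by move=> oW Sg AW E p i Ap; exists W, (g i); split=> // [|q Aq _]; [exact: AW|exact: E]. Qed.

Lemma so_id (T : Type) m (A : set T) (phi : T -> 'rV[R]_m) : smooth_of A phi phi.
Proof.
apply: (@so_smooth _ _ _ _ setT (fun i v => v ord0 i)) => //; first exact: openT.
by move=> i; apply: smooth_coord; exact: openT.
Qed.

(** Localization takes place in the values of [phi]: [smooth_of] asks for [f = g (phi q)] at every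
    point of [A] whose value lies in [W], even one far from [p] in [T]. Neighbourhoods of points are
    turned into such [W] by [homeo_push] and [homeo_nbhs]. *)
Lemma so_local (T : Type) m k (A : set T) (phi : T -> 'rV[R]_m) (f : T -> 'rV[R]_k) :
  (forall p, A p -> exists W, [/\ open W, W (phi p) & smooth_of (A `&` phi @^-1` W) phi f]) ->
  smooth_of A phi f.
Proof.
move=> H p i Ap; have [W [ oW Wp S]] := H p Ap.
have [W' [g [ oW' Wp' Sg E]]] := S p i (conj Ap Wp).
exists (W `&` W'), g; split => //; first exact: openI.
  by apply: smooth_sub Sg => v [].
by move=> q Aq [Wq Wq']; apply: E.
Qed.

Lemma so_pre (S T : Type) m k (h : S -> T) (A : set T) (phi : T -> 'rV[R]_m) (f : T -> 'rV[R]_k) :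
  smooth_of A phi f -> smooth_of (h @^-1` A) (phi \o h) (f \o h).
Proof.
move=> H p i Ap; have [W [g [ oW Wp Sg E]]] := H (h p) i Ap.
by exists W, g; split=> // q Aq; exact: E.
Qed.

Lemma open_pre m (W : set 'rV[R]_m) k (W' : set 'rV[R]_k) (g : 'I_k -> 'rV[R]_m -> R) :
  open W -> open W' -> (forall j v, W v -> {for v, continuous (g j)}) ->
  open [set v | W v /\ W' (\row_j g j v)].
Proof.
move=> oW oW' cg; rewrite openE => v [Wv W'v].
apply: (@near_and 'rV[R]_m); first exact: (@open_near 'rV[R]_m).
have cr : {for v, continuous (fun v => \row_j g j v)}.
  by apply: cont_row => j; exact: cg.
by apply: cr; exact: (@open_near 'rV[R]_k).
Qed.

Lemma bigcap_open (T : topologicalType) (I : finType) (W : I -> set T) :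
  (forall i, open (W i)) -> open [set v | forall i, W i v].
Proof.
move=> oW; rewrite openE => v Wv; apply: near_forall => i.
exact: open_near.
Qed.

Lemma so_comp (T : Type) m k l (A : set T) (phi : T -> 'rV[R]_m) (psi : T -> 'rV[R]_k)
    (f : T -> 'rV[R]_l) :
  smooth_of A phi psi -> smooth_of A psi f -> smooth_of A phi f.
Proof.
move=> H1 H2 p i Ap; have [W' [h [ oW' Wp' Sh Eh]]] := H2 p i Ap.
have /choice[Wj /choice[gj Hj]] : forall j : 'I_k, exists W : set 'rV[R]_m, exists g,
    [/\ open W, W (phi p), smooth W g & forall q, A q -> W (phi q) -> psi q ord0 j = g (phi q)].
  by move=> j; exact: H1.
pose W0 := [set v | forall j, Wj j v].
have oW0 : open W0 by apply: bigcap_open => j; have [] := Hj j.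
have S0 j : smooth W0 (gj j).
  by have [_ _ S _] := Hj j; apply: smooth_sub S => v; exact.
pose W := [set v | W0 v /\ W' (\row_j gj j v)].
have E q : A q -> W0 (phi q) -> \row_j gj j (phi q) = psi q.
  by move=> Aq Wq; apply/rowP => j; rewrite mxE; have [_ _ _ ->] := Hj j.
have oW : open W.
  by apply: open_pre => // j v W0v; apply: smooth_cont W0v.
exists W, (fun v => h (\row_j gj j v)); split => //.
- have W0p : W0 (phi p) by move=> j; have [] := Hj j.
  by split => //; rewrite E.
- apply: (@smooth_comp _ _ _ W W') => //; last by move=> v [].
  by move=> j; apply: smooth_sub (S0 j) => v [].
- move=> q Aq [W0q]; rewrite E// => W'q; exact: Eh.
Qed.

Lemma so_cont (T : topologicalType) m k (A : set T) (phi : T -> 'rV[R]_m) (f : T -> 'rV[R]_k) p :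
  open A -> A p -> {for p, continuous phi} -> smooth_of A phi f -> {for p, continuous f}.
Proof.
move=> oA Ap cphi H.
have -> : f = (fun q => \row_i f q ord0 i) by apply/funext => q; apply/rowP => i; rewrite mxE.
apply: cont_row => i; have [W [g [ oW Wp Sg E]]] := H p i Ap.
apply: (@continuous_near_eq _ _ (g \o phi)).
  have N : \forall q \near p, A q /\ W (phi q).
    by apply: near_and; [exact: open_near|apply: cphi; exact: (@open_near 'rV[R]_m)].
  by apply: near_mono N => q [Aq Wq]; rewrite /= -E.
by apply: continuous_comp => //; exact: smooth_cont Wp.
Qed.

End SmoothOf.

Arguments so_pre {R S T m k} h {A phi f}.

(** * Topological embeddings *)

Section HomeoOnto.
Context {T U : topologicalType}.
Implicit Types (A : set T) (f : T -> U) (S : set U).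

Lemma homeo_inj A f S x y : homeo_onto A f S -> A x -> A y -> f x = f y -> x = y.
Proof. by move=> [_ + _] Ax Ay; apply; exact/mem_set. Qed.

Lemma homeo_image A f S : homeo_onto A f S -> f @` A = S.
Proof. by case. Qed.

Lemma homeo_push A f S O : homeo_onto A f S -> open O ->
  exists2 W, open W & forall q, A q -> (O q <-> W (f q)).
Proof.
move=> hA oO; have [fA _ H] := hA.
have [] := H (A `&` O) (@subIsetl _ _ _); move=> /(_ (ex_intro2 _ _ _ oO erefl))[W oW E] _.
exists W => // q Aq; split => [ Oq|Wq].
  by have : (f @` (A `&` O)) (f q) by [exists q]; rewrite E => -[].
have : (S `&` W) (f q) by split=> //; rewrite -fA; exists q.
by rewrite -E => -[q' [Aq' Oq']] /(homeo_inj hA Aq' Aq) <-.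
Qed.

Lemma homeo_pull A f S W : homeo_onto A f S -> open W ->
  exists2 O, open O & forall q, A q -> (W (f q) <-> O q).
Proof.
move=> hA oW; have [fA _ H] := hA.
have [] := H (A `&` f @^-1` W) (@subIsetl _ _ _); move=> _ [].
  exists W => //; rewrite -fA; apply/seteqP; split => [_ [q [Aq Wq] <-]|_ [[q Aq <-] Wq]].
    by split => //; exists q.
  by exists q.
move=> O oO E; exists O => // q Aq; split => [Wq|Oq].
  by have : (A `&` f @^-1` W) q by []; rewrite E => -[].
by have : (A `&` O) q by []; rewrite -E => -[].
Qed.

Lemma homeo_nbhs A f S O p : homeo_onto A f S -> A p -> (\forall q \near p, O q) ->
  exists W, [/\ open W, W (f p) & forall q, A q -> W (f q) -> O q].
Proof.
move=> hA Ap N; have : nbhs p O by exact: N.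
rewrite nbhsE => -[ O' [ oO' O'p] sO].
have [W oW E] := homeo_push hA oO'.
exists W; split => //; first exact/(E p Ap).1.
by move=> q Aq /(E q Aq)/sO.
Qed.

Lemma homeo_cont A f S p : homeo_onto A f S -> open A -> A p -> {for p, continuous f}.
Proof.
move=> hA oA Ap B; rewrite nbhsE => -[W [ oW Wp] sW].
have [ O oO E] := homeo_pull hA oW.
have N : \forall q \near p, A q /\ O q.
  by apply: near_and; apply: open_near => //; exact/(E p Ap).1.
by apply: near_mono N => q [Aq /(E q Aq)/sW].
Qed.

Lemma homeo_intro A f : open A -> (forall p, A p -> {for p, continuous f}) ->
  (forall x y, A x -> A y -> f x = f y -> x = y) ->
  (forall p O, A p -> open O -> O p ->
     exists W, [/\ open W, W (f p) & forall q, A q -> W (f q) -> O q]) ->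
  homeo_onto A f (f @` A).
Proof.
move=> oA cf fI H; split => //.
  by move=> x y /set_mem Ax /set_mem Ay; exact: fI.
move=> V sV; split => [[ O oO VE]|[W oW E]].
  (* The largest admissible set; no neighbourhood has to be chosen for each point. *)
  pose W := \bigcup_(W in [set W | open W /\ forall q, A q -> W (f q) -> O q]) W.
  exists W; first by apply: bigcup_open => ? [].
  apply/seteqP; split => [_ [q Vq <-]|_ [[q Aq <-] [W' [ oW' HW'] W'q]]].
    split; first by exists q => //; exact: sV.
    have Aq := sV _ Vq; have : O q by move: Vq; rewrite VE => -[].
    by move=> /(H _ _ Aq oO)[W' [ oW' W'q HW']]; exists W'.
  by exists q => //; rewrite VE; split => //; exact: HW'.
exists (A `&` f @^-1` W).
  rewrite openE => q [Aq Wq]; apply: near_and; first exact: open_near.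
  by apply: (cf _ Aq); exact: open_near.
apply/seteqP; split => [q Vq|q [Aq [_ Wq]]].
  have Aq := sV _ Vq; split => //; split => //.
  by have : (f @` V) (f q) by [exists q]; rewrite E => -[].
have : (f @` A `&` W) (f q) by split => //; exists q.
by rewrite -E => -[q' Vq'] /(fI _ _ (sV _ Vq') Aq) <-.
Qed.

Lemma homeo_restrict A f S O : homeo_onto A f S -> open A -> open O ->
  homeo_onto (A `&` O) f (f @` (A `&` O)).
Proof.
move=> hA oA oO; apply: homeo_intro; first exact: openI.
- by move=> p [Ap _]; exact: (homeo_cont hA).
- by move=> x y [Ax _] [Ay _]; exact: (homeo_inj hA).
- move=> p O' [Ap Op] oO' O'p.
  have [W [ oW Wp H]] := homeo_nbhs hA Ap (open_near oO' O'p).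
  by exists W; split => // q [Aq _]; exact: H.
Qed.

End HomeoOnto.

(** * Generalized coordinates *)

Section GCoord.
Context {R : realType} {n : nat}.

(* A generalized coordinate map: an embedding of the open set O into some R^m,
   m arbitrary, smooth in both directions. Charts are the case m = n; the polar
   coordinates of a blow-up are the case m = n + 1. *)
Definition gcoord (M : premfd R n) (O : set M) (m : nat) (P : M -> 'rV[R]_m) :=
  [/\ open O, homeo_onto O P (P @` O) &
      forall d : chart R n M, atlas d ->
        smooth_of (O `&` dom d) d P /\ smooth_of (O `&` dom d) P d].

Lemma g_open (M : premfd R n) (O : set M) m (P : M -> 'rV[R]_m) : gcoord O P -> open O.
Proof. by case. Qed.

Lemma g_homeo (M : premfd R n) (O : set M) m (P : M -> 'rV[R]_m) :
  gcoord O P -> homeo_onto O P (P @` O).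
Proof. by case. Qed.

Lemma g_cont (M : premfd R n) (O : set M) m (P : M -> 'rV[R]_m) p :
  gcoord O P -> O p -> {for p, continuous P}.
Proof. by move=> [ oO hO _] Op; exact: (homeo_cont hO oO Op). Qed.

Lemma g_sub (M : premfd R n) (O O' : set M) m (P : M -> 'rV[R]_m) :
  open O' -> O' `<=` O -> gcoord O P -> gcoord O' P.
Proof.
move=> oO' sO [ oO hO HO]; split => //.
  by have := homeo_restrict hO oO oO'; rewrite (setIidr sO).
move=> d ad; have [S1 S2] := HO d ad.
by split; [apply: so_sub S1|apply: so_sub S2] => q [/sO].
Qed.

Lemma g_coordinates (M : premfd R n) (c : chart R n M) :
  coordinates c -> gcoord (dom c) c.
Proof.
move=> [[ oc [W oW hc]] cc]; split => //; first by rewrite (homeo_image hc).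
by move=> d ad; have [] := cc d ad.
Qed.

Lemma atlas_coordinates (M : premfd R n) (c : chart R n M) : atlas c -> coordinates c.
Proof.
move=> ac; split; first exact: atlas_corner.
by move=> d ad; exact: atlas_compatible.
Qed.

Lemma g_atlas (M : premfd R n) (c : chart R n M) : atlas c -> gcoord (dom c) c.
Proof. by move=> /atlas_coordinates/g_coordinates. Qed.

(** Transitivity of compatibility, through an atlas chart around each point. *)
Lemma g_compat (M : premfd R n) (O O' : set M) m m' (P : M -> 'rV[R]_m) (P' : M -> 'rV[R]_m') :
  gcoord O P -> gcoord O' P' -> smooth_of (O `&` O') P P'.
Proof.
move=> [ oO hO HO] [ oO' hO' HO']; apply: so_local => p [ Op O'p].
have [d ad dp] := atlas_cover p.
have [ od _] := atlas_corner ad.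
have [W [ oW Wp H]] := homeo_nbhs hO Op (open_near od dp).
exists W; split => //; apply: (@so_comp _ _ _ _ _ _ _ d).
  by have [_ +] := HO d ad; apply: so_sub => q [[ Oq O'q] Wq]; split => //; exact: H.
by have [+ _] := HO' d ad; apply: so_sub => q [[ Oq O'q] Wq]; split => //; exact: H.
Qed.

Lemma homeo_change (T : topologicalType) (O : set T) m k (P : T -> 'rV[R]_m) (Q : T -> 'rV[R]_k) :
  open O -> homeo_onto O P (P @` O) -> smooth_of O P Q -> smooth_of O Q P ->
  homeo_onto O Q (Q @` O).
Proof.
move=> oO hO SPQ SQP.
have QP p (W : set 'rV[R]_m) : O p -> open W -> W (P p) ->
    exists W' : set 'rV[R]_k, [/\ open W', W' (Q p) & forall q, O q -> W' (Q q) -> W (P q)].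
  move=> Op oW Wp.
  have /choice[Wj /choice[gj Hj]] : forall j : 'I_m, exists W : set 'rV[R]_k, exists g,
      [/\ open W, W (Q p), smooth W g & forall q, O q -> W (Q q) -> P q ord0 j = g (Q q)].
    by move=> j; exact: SQP.
  pose W0 := [set v | forall j, Wj j v].
  have oW0 : open W0 by apply: bigcap_open => j; have [] := Hj j.
  have S0 j : smooth W0 (gj j).
    by have [_ _ S _] := Hj j; apply: smooth_sub S => v; exact.
  have E q : O q -> W0 (Q q) -> \row_j gj j (Q q) = P q.
    by move=> Oq Wq; apply/rowP => j; rewrite mxE; have [_ _ _ ->] := Hj j.
  exists [set v | W0 v /\ W (\row_j gj j v)]; split.
  - by apply: open_pre => // j v W0v; apply: smooth_cont W0v.
  - have W0p : W0 (Q p) by move=> j; have [] := Hj j.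
    by split => //; rewrite E.
  - by move=> q Oq [W0q]; rewrite E.
apply: homeo_intro => //.
- by move=> p Op; exact: (so_cont oO Op (homeo_cont hO oO Op) SPQ).
- move=> x y Ox Oy Qxy; apply: (homeo_inj hO) => //; apply/rowP => j.
  have [W [g [ oW Wx Sg E]]] := SQP x j Ox.
  by rewrite E// E// -?Qxy.
- move=> p O' Op oO' O'p; have [W [ oW Wp H]] := homeo_nbhs hO Op (open_near oO' O'p).
  have [W' [ oW' W'p H']] := QP p W Op oW Wp.
  by exists W'; split => // q Oq W'q; apply: H => //; exact: H'.
Qed.

Lemma g_change (M : premfd R n) (O : set M) m k (P : M -> 'rV[R]_m) (Q : M -> 'rV[R]_k) :
  gcoord O P -> smooth_of O P Q -> smooth_of O Q P -> gcoord O Q.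
Proof.
move=> gO SPQ SQP; have [ oO hO HO] := gO; split => //; first exact: homeo_change SPQ SQP.
move=> d ad; have [S1 S2] := HO d ad; split.
  by apply: so_comp S1 _; apply: so_sub SPQ => q [].
by apply: so_comp S2; apply: so_sub SQP => q [].
Qed.

Lemma g_chart (M : premfd R n) (O : set M) (P : M -> 'rV[R]_n) (J : {set 'I_n}) W :
  gcoord O P -> open W -> P @` O = orthant J `&` W -> coordinates (Chart O J P).
Proof.
move=> [ oO hO HO] oW E; split; last by move=> d ad; have [] := HO d ad.
by split => //=; exists W => //; rewrite -E.
Qed.

End GCoord.

(** * Diffeomorphisms between open sets *)

Section DiffeoOn.
Context {R : realType} {n : nat}.
Implicit Types M N K : mfd R n.

Lemma d_cont M N (U : set M) (F : M -> N) V p :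
  diffeo_on U F V -> U p -> {for p, continuous F}.
Proof. by move=> [_ _ [+ _] _ _]; exact. Qed.

Lemma d_inj M N (U : set M) (F : M -> N) V x y :
  diffeo_on U F V -> U x -> U y -> F x = F y -> x = y.
Proof. by move=> [_ + _ _ _] Ux Uy; apply; exact/mem_set. Qed.

Lemma d_openV M N (U : set M) (F : M -> N) V : diffeo_on U F V -> open U -> open V.
Proof. by move=> [<- _ _ + _] oU; apply. Qed.

Lemma cont_open_pre (S T : topologicalType) (U : set S) (F : S -> T) (O : set T) :
  (forall p, U p -> {for p, continuous F}) -> open U -> open O -> open (U `&` F @^-1` O).
Proof.
move=> cF oU oO; rewrite openE => p [Up Op]; apply: near_and; first exact: open_near.
by apply: (cF _ Up); exact: open_near.
Qed.

Lemma g_pull M N (U : set M) (F : M -> N) V (O : set N) m (P : N -> 'rV[R]_m) :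
  diffeo_on U F V -> open U -> gcoord O P -> O `<=` V ->
  gcoord (U `&` F @^-1` O) (P \o F).
Proof.
move=> dF oU gO sO; have [FU FI [cF SF] FO SFi] := dF; have [ oO hO HO] := gO.
have oUO : open (U `&` F @^-1` O) by exact: cont_open_pre.
split; first exact: oUO.
  apply: homeo_intro; first exact: oUO.
  - move=> p [Up Op]; apply: continuous_comp; first exact: cF.
    exact: g_cont gO Op.
  - move=> x y [Ux Ox] [Uy Oy] /= /(homeo_inj hO Ox Oy); exact: d_inj dF Ux Uy.
  - move=> p O' [Up Op] oO' O'p.
    have oFO : open (F @` (U `&` O')) by apply: FO; [exact: openI|move=> ? []].
    have Fp : (F @` (U `&` O')) (F p) by exists p.
    have [W [ oW Wp H]] := homeo_nbhs hO Op (open_near oFO Fp).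
    exists W; split => // q [Uq Oq] /(H _ Oq)[q' [Uq' O'q']].
    by move=> /(d_inj dF Uq' Uq) <-.
move=> c ac; split.
  apply: so_local => p [[Up Op] cp]; have [d ad dp] := atlas_cover (F p).
  have [ od _] := atlas_corner ad.
  have oUd : open (U `&` F @^-1` dom d) by exact: cont_open_pre.
  have [W [ oW Wp H]] := homeo_nbhs (g_homeo (g_atlas ac)) cp (open_near oUd (conj Up dp)).
  exists W; split => //; apply: (@so_comp _ _ _ _ _ _ _ (d \o F)).
    by apply: so_sub (SF c d ac ad) => q [[[Uq Oq] cq] Wq]; have [_ dq] := H q cq Wq.
  have [S1 _] := HO d ad; apply: so_sub (so_pre F S1) => q [[[Uq Oq] cq] Wq].
  by have [_ dq] := H q cq Wq.
apply: so_local => p [[Up Op] cp]; have [d ad dp] := atlas_cover (F p).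
have [ od _] := atlas_corner ad.
have [W [ oW Wp H]] := homeo_nbhs hO Op (open_near od dp).
exists W; split => //; apply: (@so_comp _ _ _ _ _ _ _ (d \o F)).
  have [_ S2] := HO d ad; apply: so_sub (so_pre F S2) => q [[[Uq Oq] cq] Wq].
  by split => //; exact: H.
apply: so_sub (SFi c d ac ad) => q [[[Uq Oq] cq] Wq].
by split => //; exact: H.
Qed.

(** A converse of [g_pull]: around each point it is enough that some generalized coordinates of the
    target pull back to generalized coordinates of the source. As polar coordinates may serve as
    [P], maps between blow-ups are tested in them directly. *)
Lemma d_crit M N (U : set M) (F : M -> N) (V : set N) :
  open U -> open V -> F @` U = V -> (forall x y, U x -> U y -> F x = F y -> x = y) ->
  (forall p, U p -> exists (O : set N) m (P : N -> 'rV[R]_m),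
     [/\ gcoord O P, O (F p) & gcoord (U `&` F @^-1` O) (P \o F)]) ->
  diffeo_on U F V.
Proof.
move=> oU oV FU FI H.
have cF p : U p -> {for p, continuous F}.
  move=> Up; have [ O [m [P [gO Op gPF]]]] := H p Up.
  move=> B; rewrite nbhsE => -[ O1 [ oO1 O1p] sO1].
  have [W [ oW Wp HW]] := homeo_nbhs (g_homeo gO) Op (open_near oO1 O1p).
  have cPF := g_cont gPF (conj Up Op).
  have N1 : \forall q \near p, W ((P \o F) q).
    by apply: cPF; exact: (@open_near 'rV[R]_m).
  apply: near_mono (near_and (open_near (g_open gPF) (conj Up Op)) N1) => q [[Uq Oq] Wq].
  by apply: sO1; exact: HW.
split => //.
- by move=> x y /set_mem Ux /set_mem Uy; exact: FI.
- split => // c d ac ad; apply: so_local => p [[Up cp] dp].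
  have [ O [m [P [gO Op gPF]]]] := H p Up.
  have oUO := g_open gPF.
  have [W [ oW Wp HW]] := homeo_nbhs (g_homeo (g_atlas ac)) cp (open_near oUO (conj Up Op)).
  exists W; split => //; apply: (@so_comp _ _ _ _ _ _ _ (P \o F)).
    apply: so_sub (g_compat (g_atlas ac) gPF) => q [[[Uq cq] dq] Wq].
    by split => //; exact: HW.
  apply: so_sub (so_pre F (g_compat gO (g_atlas ad))) => q [[[Uq cq] dq] Wq].
  by split => //; have [] := HW q cq Wq.
- move=> O1 oO1 sO1; rewrite openE => _ [p O1p <-].
  have Up := sO1 _ O1p; have [ O [m [P [gO Op gPF]]]] := H p Up.
  have [W [ oW Wp HW]] := homeo_nbhs (g_homeo gPF) (conj Up Op) (open_near oO1 O1p).
  have N1 : \forall y \near F p, V y by apply: open_near => //; rewrite -FU; exists p.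
  have N2 : \forall y \near F p, W (P y).
    by apply: (g_cont gO Op); exact: (@open_near 'rV[R]_m).
  apply: near_mono (near_and (open_near (g_open gO) Op) (near_and N1 N2)).
  move=> y [ Oy [Vy Wy]]; move: Vy Oy Wy; rewrite -FU => -[q Uq <-] Oq Wq.
  by exists q => //; exact: HW.
- move=> c d ac ad; apply: so_local => p [[Up cp] dp].
  have [ O [m [P [gO Op gPF]]]] := H p Up.
  have [W [ oW Wp HW]] := homeo_nbhs (g_homeo (g_atlas ad)) dp (open_near (g_open gO) Op).
  exists W; split => //; apply: (@so_comp _ _ _ _ _ _ _ (P \o F)).
    apply: so_sub (so_pre F (g_compat (g_atlas ad) gO)) => q [[[Uq cq] dq] Wq].
    by split => //; exact: HW.
  apply: so_sub (g_compat gPF (g_atlas ac)) => q [[[Uq cq] dq] Wq].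
  by split => //; split => //; exact: HW.
Qed.

Lemma d_comp M N K (U : set M) (F : M -> N) (V : set N) (G : N -> K) (W : set K) :
  open U -> diffeo_on U F V -> diffeo_on V G W -> diffeo_on U (G \o F) W.
Proof.
move=> oU dF dG; have oV := d_openV dF oU; have oW := d_openV dG oV.
have [FU _ _ _ _] := dF; have [GV _ _ _ _] := dG.
apply: d_crit => //.
- by rewrite -GV -FU image_comp.
- move=> x y Ux Uy /= E; apply: (d_inj dF) => //; apply: (d_inj dG) => //.
    by rewrite -FU; exists x.
  by rewrite -FU; exists y.
- move=> p Up; have [d ad dp] := atlas_cover (G (F p)).
  have gd : gcoord (W `&` dom d) d.
    apply: g_sub (g_atlas ad); last by move=> ? [].
    by apply: openI => //; exact: g_open (g_atlas ad).
  have WGF x : U x -> W (G (F x)).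
    by move=> Ux; rewrite -GV; exists (F x) => //; rewrite -FU; exists x.
  exists (W `&` dom d), n, d; split => //; first by split => //; exact: WGF.
  have g1 := g_pull dG oV gd (@subIsetl _ _ _).
  have := g_pull dF oU g1 (@subIsetl _ _ _).
  rewrite [X in gcoord X](_ : _ = U `&` (G \o F) @^-1` (W `&` dom d))//.
  apply/seteqP; split => x /=; first by move=> [? [? ?]].
  by move=> [Ux ?]; split => //; split => //; rewrite -FU; exists x.
Qed.

Lemma d_sub M N (U U' : set M) (F : M -> N) V :
  open U -> open U' -> U' `<=` U -> diffeo_on U F V -> diffeo_on U' F (F @` U').
Proof.
move=> oU oU' sU dF; have [FU _ _ FO _] := dF.
apply: d_crit => //; first exact: FO.
  by move=> x y /sU Ux /sU Uy; exact: d_inj dF Ux Uy.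
move=> p U'p; have [d ad dp] := atlas_cover (F p).
have oV := d_openV dF oU.
have gd : gcoord (V `&` dom d) d.
  apply: g_sub (g_atlas ad); last by move=> ? [].
  by apply: openI => //; exact: g_open (g_atlas ad).
exists (V `&` dom d), n, d; split => //.
  by split => //; rewrite -FU; exists p => //; exact: sU.
have g1 := g_pull dF oU gd (@subIsetl _ _ _).
have cF x : U' x -> {for x, continuous F} by move=> /sU; exact: d_cont dF.
by apply: g_sub g1; [exact: cont_open_pre cF oU' (g_open gd)|move=> q [/sU Uq]].
Qed.

Lemma d_inv M N (U : set M) (F : M -> N) V (G : N -> M) :
  open U -> diffeo_on U F V -> (forall x, U x -> G (F x) = x) -> diffeo_on V G U.
Proof.
move=> oU dF GF; have [FU _ _ FO _] := dF; have oV := d_openV dF oU.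
have VP y : V y -> U (G y) /\ F (G y) = y.
  by rewrite -FU => -[x Ux <-]; rewrite GF.
apply: d_crit => //.
- apply/seteqP; split => [_ [y /VP[Uy _] <-]//|x Ux].
  by exists (F x); rewrite ?GF//; rewrite -FU; exists x.
- by move=> x y /VP[_ {2}<-] /VP[_ {2}<-] ->.
- move=> y Vy; have [Uy FGy] := VP _ Vy.
  have [c ac cy] := atlas_cover (G y); have [d ad dy] := atlas_cover y.
  have gd : gcoord (V `&` dom d) d.
    apply: g_sub (g_atlas ad); last by move=> ? [].
    by apply: openI => //; exact: g_open (g_atlas ad).
  have gF := g_pull dF oU gd (@subIsetl _ _ _).
  pose O := (U `&` F @^-1` (V `&` dom d)) `&` dom c.
  have gO : gcoord O c.
    apply: g_sub (g_atlas ac); last by move=> ? [].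
    by apply: openI; [exact: g_open gF|exact: g_open (g_atlas ac)].
  exists O, n, c; split => //; first by split => //; split => //; rewrite /= FGy.
  have E : V `&` G @^-1` O = F @` O.
    apply/seteqP; split => [z [Vz Oz]|_ [x [[Ux [Vx dx]] cx] <-]].
      by exists (G z) => //; have [] := VP _ Vz.
    by split => //; rewrite /= GF.
  have oVO : open (V `&` G @^-1` O).
    by rewrite E; apply: FO; [exact: g_open gO|move=> ? [[]]].
  have sVO : V `&` G @^-1` O `<=` V `&` dom d.
    by move=> z [Vz [[_ [_ +]] _]]; rewrite /=; have [_ ->] := VP _ Vz.
  have g2 := g_sub oVO sVO gd.
  apply: (g_change g2).
    apply: so_ext (so_sub _ (so_pre G (g_compat gF gO))) => [z [Vz Oz]|//|z [Vz Oz]].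
      by rewrite /=; have [_ ->] := VP _ Vz.
    by split => //; have [[]] := Oz.
  apply: so_ext (so_sub _ (so_pre G (g_compat gO gF))) => [//|z [Vz Oz]|z [Vz Oz]].
    by rewrite /=; have [_ ->] := VP _ Vz.
  by split => //; have [[]] := Oz.
Qed.

Lemma diffeo_id M : diffeo (@id M).
Proof.
apply: d_crit => //; try exact: openT.
  by rewrite image_id.
move=> p _; have [d ad dp] := atlas_cover p.
exists (dom d), n, d; split => //; first exact: g_atlas.
by rewrite setTI; exact: g_atlas.
Qed.

End DiffeoOn.

(** * Tangent spaces *)

Section LinearAlgebra.
Context {F : fieldType} {n : nat}.
Implicit Types (A J : {set 'I_n}) (V : 'M[F]_n) (v : 'rV[F]_n).

(** The span of the basis vectors with index in [A]; subspaces are encoded as row spaces. *)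
Definition csp A : 'M[F]_n := \matrix_(i, j) ((i == j) && (i \in A))%:R.

Lemma mul_csp A v : v *m csp A = \row_i (if i \in A then v ord0 i else 0).
Proof.
apply/rowP => i; rewrite !mxE (bigD1 i)//= mxE eqxx/= big1 ?addr0; last first.
  by move=> j ji; rewrite mxE (negbTE ji) mulr0.
by case: ifP; rewrite ?mulr1 ?mulr0.
Qed.

Lemma sub_csp A v : (v <= csp A)%MS <-> forall i, i \notin A -> v ord0 i = 0.
Proof.
split=> [/submxP[D ->] i iA|H]; first by rewrite mul_csp mxE (negbTE iA).
apply/submxP; exists v; rewrite mul_csp; apply/rowP => i; rewrite mxE.
by case: ifPn => // /H.
Qed.

Lemma rank_csp_le A : (\rank (csp A) <= #|A|)%N.
Proof.
have -> : csp A = \sum_(i in A) delta_mx i i.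
  apply/matrixP => i j; rewrite !mxE summxE.
  have [iA|iA] := boolP (i \in A).
    rewrite (bigD1 i)//= !mxE eqxx andbT/= big1 ?addr0 1?eq_sym//.
    by move=> k /andP[_ ki]; rewrite mxE eq_sym (negbTE ki).
  rewrite andbF big1// => k kA; rewrite mxE.
  by have [E|//] := eqVneq i k; rewrite -E (negbTE iA) in kA.
rewrite -sum1_card; elim/big_rec2 : _ => [|i k M iA H]; first by rewrite mxrank0.
by rewrite (leq_trans (mxrank_add _ _))// mxrank_delta leq_add2l.
Qed.

Lemma rank_csp A : \rank (csp A) = #|A|.
Proof.
apply/eqP; rewrite eqn_leq rank_csp_le/=.
have H : csp A + csp (~: A) = 1%:M.
  apply/matrixP => i j; rewrite !mxE inE; case: (i == j); case: (i \in A) => //=;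
  by rewrite ?addr0 ?add0r.
have := mxrank_add (csp A) (csp (~: A)); rewrite H mxrank1 => H1.
have H2 := rank_csp_le (~: A).
rewrite -[leqLHS]card_ord -(cardsC A) in H1.
by rewrite -(leq_add2r #|~: A|) (leq_trans H1)// leq_add2l.
Qed.

(** [V] is stable under the projections onto the axes in [J]; equivalently, each such axis lies in
    [V] or its coordinate vanishes on [V]. With [J] the boundary coordinates this is the p-clean
    form (some x_j and some linear functions of the y_l vanish), in a shape that passes to
    intersections. *)
Definition stab V J := forall j, j \in J -> (V *m delta_mx j j <= V)%MS.

Lemma mul_delta v j : v *m delta_mx j j = v ord0 j *: delta_mx ord0 j.
Proof.
apply/rowP => i; rewrite !mxE (bigD1 j)//= big1 ?addr0; last first.
  by move=> k kj; rewrite mxE (negbTE kj) mulr0.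
by rewrite !mxE !eqxx.
Qed.

Lemma stabP V J : stab V J <-> forall v j, j \in J -> (v <= V)%MS ->
  (v ord0 j *: (delta_mx ord0 j : 'rV_n) <= V)%MS.
Proof.
split=> [H v j jJ vV|H j jJ].
  rewrite -mul_delta; apply: submx_trans (H _ jJ); exact: submxMr.
apply/row_subP => i; rewrite row_mul mul_delta; apply: H => //; exact: row_sub.
Qed.

Lemma stab_coord V J j : stab V J -> j \in J ->
  ~~ ((delta_mx ord0 j : 'rV_n) <= V)%MS -> forall v, (v <= V)%MS -> v ord0 j = 0.
Proof.
move=> /stabP sV jJ jV v vV; apply/eqP; apply: contraNT jV => v0.
have := sV v j jJ vV; move/(scalemx_sub (v ord0 j)^-1).
by rewrite scalerA mulVf// scale1r.
Qed.

Lemma stab_cap V V' J : stab V J -> stab V' J -> stab (V :&: V')%MS J.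
Proof.
move=> /stabP sV /stabP sV'; apply/stabP => v j jJ; rewrite !sub_capmx => /andP[H H'].
by rewrite sV// sV'.
Qed.

Lemma stab_csp A J : stab (csp A) J.
Proof.
apply/stabP => v j jJ /sub_csp vA; apply/sub_csp => i iA; rewrite !mxE eqxx/=.
by have [E|_] := eqVneq i j; rewrite ?mulr0// mulr1 -E vA.
Qed.

(** [I] is maximal with [csp I] meeting [V] trivially, hence indexes a complement of [V]. [Q]
    replaces the coordinates in [I] by the projection onto [csp I] along [V]; stability of [V] makes
    it leave the coordinates in [J] alone. *)
Lemma straighten V J : stab V J -> exists (Q : 'M[F]_n) (I : {set 'I_n}),
  [/\ Q \in unitmx, forall v j, j \in J -> (v *m Q) ord0 j = v ord0 j,
      forall j, j \in J -> (delta_mx ord0 j : 'rV_n) *m Q = delta_mx ord0 j,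
      forall v, (v <= V)%MS <-> forall i, i \in I -> (v *m Q) ord0 i = 0 &
      #|~: I| = \rank V].
Proof.
move=> sV.
pose P (A : {set 'I_n}) := (V :&: csp A)%MS == 0.
have P0 : P finset.set0.
  rewrite /P -submx0; apply/rV_subP => v; rewrite sub_capmx => /andP[_ /sub_csp v0].
  by rewrite submx0; apply/eqP/rowP => i; rewrite v0 ?inE// mxE.
have [I /maxsetP[PI maxI] _] := maxset_exists P0.
have cap0 v : (v <= V)%MS -> (v <= csp I)%MS -> v = 0.
  move=> v1 v2; apply/eqP; rewrite -submx0 -(eqP PI) sub_capmx v1 v2//.
have eI j : j \in I -> ((delta_mx ord0 j : 'rV[F]_n) <= csp I)%MS.
  move=> jI; apply/sub_csp => i iI; rewrite mxE eqxx/=.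
  by have [E|//] := eqVneq i j; rewrite -E (negbTE iI) in jI.
(* For [j] outside [I], maximality yields a vector of [V] supported in [j |: I] with nonzero [j]-th
   entry; solving it for the [j]-th basis vector puts the latter in the sum. *)
have full v : (v <= V + csp I)%MS.
  have ej j : ((delta_mx ord0 j : 'rV[F]_n) <= V + csp I)%MS.
    have [jI|jI] := boolP (j \in I); first exact: submx_trans (eI _ jI) (addsmxSr _ _).
    have : ~~ P (j |: I)%SET.
      apply/negP => Pj; have := maxI _ Pj (subsetU1 _ _) => E.
      by rewrite -E setU11 in jI.
    rewrite /P -submx0 => /rV_subP/existsNP[x /not_implyP[]].
    rewrite sub_capmx submx0 => /andP[xV /sub_csp xI] x0.
    have xj : x ord0 j != 0.
      apply/negP => /eqP xj; apply: x0; apply/eqP; apply: cap0 => //.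
      apply/sub_csp => i iI; have [->//|ij] := eqVneq i j.
      by apply: xI; rewrite !inE negb_or ij.
    have -> : delta_mx ord0 j = (x ord0 j)^-1 *: x +
        (delta_mx ord0 j - (x ord0 j)^-1 *: x) by rewrite addrC subrK.
    apply: addmx_sub_adds; first exact: scalemx_sub.
    apply/sub_csp => i iI; rewrite !mxE eqxx/=; have [->|ij] := eqVneq i j.
      by rewrite mulVf// subrr.
    have -> : x ord0 i = 0 by apply: xI; rewrite !inE negb_or ij.
    by rewrite mulr0 subr0.
  rewrite (row_sum_delta v) summx_sub// => i _; exact: scalemx_sub.
have capE : (csp I :&: V)%MS = 0 by rewrite capmxC; exact/eqP.
pose PE := proj_mx (csp I) V.
pose Q := PE + csp (~: I).
have PEV v : (v <= V)%MS -> v *m PE = 0 by exact: proj_mx_0.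
have PEI v : (v <= csp I)%MS -> v *m PE = v by exact: proj_mx_id.
have PEsub v : (v *m PE <= csp I)%MS by exact: proj_mx_sub.
have PEcompl v : (v - v *m PE <= V)%MS.
  by apply: proj_mx_compl_sub; rewrite addsmxC.
have QI v i : i \in I -> (v *m Q) ord0 i = (v *m PE) ord0 i.
  by move=> iI; rewrite mulmxDr mul_csp !mxE inE iI addr0.
have QnI v i : i \notin I -> (v *m Q) ord0 i = v ord0 i.
  move=> iI; rewrite mulmxDr mul_csp mxE [X in _ + X]mxE inE iI.
  by have /sub_csp -> := PEsub v; rewrite ?add0r.
have inV v : (v <= V)%MS <-> forall i, i \in I -> (v *m Q) ord0 i = 0.
  split=> [vV i iI|H]; first by rewrite QI// PEV// mxE.
  have : v *m PE = 0.
    apply/rowP => i; rewrite [RHS]mxE; have [iI|iI] := boolP (i \in I).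
      by rewrite -QI// H.
    by have /sub_csp -> := PEsub v.
  by move=> E; have := PEcompl v; rewrite E subr0.
have Qu : Q \in unitmx.
  rewrite -row_free_unit -kermx_eq0 -submx0; apply/rV_subP => v /sub_kermxP vQ.
  rewrite submx0; apply/eqP; apply: cap0.
    by apply/inV => i _; rewrite vQ mxE.
  by apply/sub_csp => i iI; rewrite -QnI// vQ mxE.
have JV j : j \in J -> j \notin I -> ((delta_mx ord0 j : 'rV[F]_n) <= V)%MS.
  move=> jJ jI; apply: contraT => jV.
  have vj0 := stab_coord sV jJ jV.
  have /sub_addsmxP[[a b] /= E] := full (delta_mx ord0 j).
  have : (delta_mx ord0 j : 'rV[F]_n) ord0 j = 0.
    rewrite E mxE vj0 ?submxMl// add0r; have /sub_csp -> // := submxMl b (csp I).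
  by rewrite mxE !eqxx => /eqP; rewrite oner_eq0.
exists Q, I; split => //.
- move=> v j jJ; have [jI|jI] := boolP (j \in I); last exact: QnI.
  have jV : ~~ ((delta_mx ord0 j : 'rV[F]_n) <= V)%MS.
    apply/negP => jV; have /rowP/(_ j) := cap0 _ jV (eI _ jI).
    by rewrite !mxE !eqxx => /eqP; rewrite oner_eq0.
  have := stab_coord sV jJ jV (PEcompl v).
  by rewrite QI// mxE => /eqP; rewrite mxE subr_eq0 => /eqP.
- move=> j jJ; have [jI|jI] := boolP (j \in I).
    rewrite mulmxDr PEI ?eI// mul_csp; apply/rowP => i; rewrite !mxE inE eqxx/=.
    have [->|ij] := eqVneq i j; first by rewrite jI addr0.
    by rewrite if_same addr0.
  rewrite mulmxDr PEV ?JV// add0r mul_csp; apply/rowP => i; rewrite !mxE inE eqxx/=.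
  by have [->|ij] := eqVneq i j; rewrite ?jI// if_same.
- rewrite -(rank_csp (~: I)).
  rewrite -(@mxrankMfree _ _ _ _ V Q) ?row_free_unit//.
  apply/eqP; rewrite eqn_leq; apply/andP; split; apply: mxrankS; apply/rV_subP => v.
    move=> /sub_csp vI; rewrite -(mulmxKV Qu v); apply: submxMr; apply/inV => i iI.
    by rewrite mulmxKV// vI// inE iI.
  move=> /submxP[D ->]; rewrite mulmxA; apply/sub_csp => i; rewrite inE negbK => iI.
  by have /inV -> := submxMl D V.
Qed.

End LinearAlgebra.

Section RowBounds.
Context {R : realType}.

Lemma norm_row_lt n (h : 'rV[R]_n) (e : R) : 0 < e ->
  (forall i, `|h ord0 i| < e) -> `|h| < e.
Proof.
move=> e0 H; rewrite [`|h|]mx_normrE; apply: bigmax_lt => // -[i j] _ /=.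
by rewrite (ord1 i).
Qed.

Lemma mulmx_bound n k (A : 'M[R]_(n, k)) :
  exists2 K : R, 0 < K & forall v : 'rV[R]_n, `|v *m A| <= K * `|v|.
Proof.
exists (1 + \sum_i \sum_j `|A i j|).
  by rewrite ltr_pwDl// sumr_ge0// => i _; rewrite sumr_ge0.
move=> v; apply: norm_row_le.
  by rewrite mulr_ge0// addr_ge0// sumr_ge0// => i _; rewrite sumr_ge0.
move=> j; rewrite mxE (le_trans (ler_norm_sum _ _ _))// mulrDl mul1r.
apply: (@le_trans _ _ ((\sum_i \sum_j `|A i j|) * `|v|)); last by rewrite lerDr.
rewrite mulr_suml; apply: ler_sum => i _; rewrite normrM mulrC.
rewrite ler_pM// ?norm_coord_le//.
by rewrite (bigD1 j)//= lerDl sumr_ge0.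
Qed.

Lemma cont_mulmx n k (A : 'M[R]_(n, k)) (T : topologicalType) (f : T -> 'rV[R]_n) x :
  {for x, continuous f} -> {for x, continuous (fun y => f y *m A)}.
Proof.
move=> cf.
have -> : (fun y => f y *m A) = (fun y => \row_j \sum_l f y ord0 l * A l j).
  by apply/funext => y; apply/rowP => j; rewrite !mxE.
apply: cont_row => j; apply: cont_sum => l _; apply: contM; last exact: cont_cst.
by apply: (@continuous_comp _ _ _ f (fun v : 'rV[R]_n => v ord0 l)) => //; exact: coord_continuous.
Qed.

Lemma cont_coord n (T : topologicalType) (f : T -> 'rV[R]_n) x l :
  {for x, continuous f} -> {for x, continuous (fun y => f y ord0 l)}.
Proof.
move=> cf.
by apply: (@continuous_comp _ _ _ f (fun v : 'rV[R]_n => v ord0 l)) => //; exact: coord_continuous.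
Qed.

Lemma cont_addrow n (T : topologicalType) (f g : T -> 'rV[R]_n) x :
  {for x, continuous f} -> {for x, continuous g} -> {for x, continuous (fun y => f y + g y)}.
Proof. by move=> cf cg; exact: (@cvgD R 'rV[R]_n). Qed.

Lemma open_ltf (T : topologicalType) (f g : T -> R) x :
  {for x, continuous f} -> {for x, continuous g} -> f x < g x ->
  \forall y \near x, f y < g y.
Proof.
move=> cf cg fg; pose h y := g y - f y.
have ch : {for x, continuous h} by apply: contD => //; exact: contN.
have h0 : 0 < h x by rewrite subr_gt0.
have := (cont_epsP h x).1 ch (h x / 2) (divr_gt0 h0 (ltr0n _ 2)).
apply: near_mono => y Hy; rewrite -subr_gt0 -/(h y).
move: Hy; rewrite ler_norml => /andP[H _]; rewrite -(ltrD2r (- h x)) sub0r.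
by apply: lt_le_trans H; rewrite ltrN2 ltr_pdivrMr// ltr_pMr// ltr1n.
Qed.

Lemma open_box n (e : R) : open [set v : 'rV[R]_n | forall i, `|v ord0 i| < e].
Proof.
apply: bigcap_open => i; rewrite openE => v vi.
apply: (@open_ltf 'rV[R]_n (fun v => `|v ord0 i|) (fun=> e)) => //; last exact: cont_cst.
apply: (@continuous_comp _ _ _ (fun v : 'rV[R]_n => v ord0 i) (fun x : R => `|x|)).
  exact: coord_continuous.
exact: norm_continuous.
Qed.

Lemma cont_dist (V : normedModType R) (T : topologicalType) (f : T -> V) x (d : R) :
  0 < d -> {for x, continuous f} -> \forall y \near x, `|f y - f x| < d.
Proof. by move=> d0 /cvgrPdistC_lt/(_ _ d0). Qed.

Lemma so_affine (T : Type) n k (A : set T) (phi : T -> 'rV[R]_n) (f : T -> 'rV[R]_k)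
    (Q : 'M[R]_(n, k)) (a : 'rV[R]_n) (b : 'rV[R]_k) :
  (forall q, A q -> f q = (phi q - a) *m Q + b) -> smooth_of A phi f.
Proof.
move=> E; apply: (@so_smooth _ _ _ _ _ setT
  (fun j v => \sum_l (v ord0 l + - a ord0 l) * Q l j + b ord0 j)) => //.
- exact: openT.
- move=> j; apply: smoothD; [exact: openT| |by apply: smooth_cst; exact: openT].
  apply: smooth_sum => [|l _]; first exact: openT.
  apply: smoothM; [exact: openT| |by apply: smooth_cst; exact: openT].
  apply: smoothD; [exact: openT| |by apply: smooth_cst; exact: openT].
  by apply: smooth_coord; exact: openT.
- by move=> q j Aq; rewrite E// !mxE; congr (_ + _); apply: eq_bigr => l _; rewrite !mxE.
Qed.

End RowBounds.

(** * Adapted charts, Jacobians and tangent cones *)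

Section Charts.
Context {R : realType} {n : nat} (M : premfd R n).
Implicit Types (c : chart R n M) (p q : M) (O : set M).

Lemma coord_open c : coordinates c -> open (dom c).
Proof. by move=> [[]]. Qed.

Lemma coord_near_image c p O : coordinates c -> dom c p -> open O -> O p ->
  exists2 e : R, 0 < e & forall v, orthant (bnd c) v -> `|v - c p| < e ->
    exists q, [/\ dom c q, O q & c q = v].
Proof.
move=> cc cp oO Op; have [[_ [W oW /homeo_image E]] _] := cc.
have Wp : W (c p) by have : (orthant (bnd c) `&` W) (c p) by [rewrite -E; exists p]; case.
have [WO oWO HWO] := homeo_push (g_homeo (g_coordinates cc)) oO.
have [e e0 He] := (@near_normP R 'rV[R]_n _ (c p)).1
  (near_and (open_near oW Wp) (open_near oWO ((HWO p cp).1 Op))).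
exists e => // v Jv /He[Wv WOv].
have : (orthant (bnd c) `&` W) v by [].
by rewrite -E => -[q cq Eq]; exists q; split => //; apply/HWO => //; rewrite Eq.
Qed.

Lemma coord_orthant c p : coordinates c -> dom c p -> orthant (bnd c) (c p).
Proof.
move=> [[_ [W _ /homeo_image E]] _] cp.
by have : (orthant (bnd c) `&` W) (c p) by [rewrite -E; exists p]; case.
Qed.

(** Boundary coordinates that are positive at [p] become ordinary ones after recentring, since on a
    small domain their sign is no constraint; [Q] has to fix those that vanish at [p]. *)
Lemma adapted_reparam c p O (Q : 'M[R]_n) : coordinates c -> dom c p -> open O -> O p ->
  Q \in unitmx ->
  (forall (v : 'rV[R]_n) j, j \in bnd c -> c p ord0 j = 0 -> (v *m Q) ord0 j = v ord0 j) ->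
  exists c', [/\ adapted p c', forall q, dom c' q -> dom c q /\ O q,
    bnd c' = [set j in bnd c | c p ord0 j == 0]%SET &
    forall q, c' q = (c q - c p) *m Q].
Proof.
move=> cc cp oO Op Qu HQ; pose J := [set j in bnd c | c p ord0 j == 0]%SET.
pose u q := (c q - c p) *m Q.
have uE q : c q = u q *m invmx Q + c p by rewrite /u mulmxK// subrK.
have gu : gcoord (dom c) u.
  apply: (g_change (g_coordinates cc)).
    by apply: (@so_affine _ _ _ _ _ _ _ Q (c p) 0) => q _; rewrite addr0.
  by apply: (@so_affine _ _ _ _ _ _ _ (invmx Q) 0 (c p)) => q _; rewrite subr0.
have [e1 e10 He1] := coord_near_image cc cp oO Op.
have Hpos : \forall v \near nbhs (c p : 'rV[R]_n), forall j : 'I_n,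
    j \in bnd c -> j \notin J -> 0 < (v : 'rV[R]_n) ord0 j.
  apply: (@near_forall 'rV[R]_n) => j.
  have [/andP[jb jJ]|H] := boolP ((j \in bnd c) && (j \notin J)); last first.
    by apply: filterE => v jb jJ; move: H; rewrite jb jJ.
  have := @open_ltf R 'rV[R]_n (fun=> 0) (fun v => v ord0 j) (c p).
  have c1 : {for (c p), continuous (fun _ : 'rV[R]_n => 0 : R)} by exact: cont_cst.
  move=> /(_ c1 (@coord_continuous _ _ _ _ _ (c p))) H1.
  have : 0 < c p ord0 j.
    rewrite lt_neqAle eq_sym; have := coord_orthant cc cp jb => ->.
    by move: jJ; rewrite inE jb => ->.
  by move=> /H1; apply: near_mono => v.
have [e2 e20 He2] := (@near_normP R 'rV[R]_n _ (c p)).1 Hpos.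
have [K K0 HK] := mulmx_bound (invmx Q).
(* [e1] keeps vectors inside the image of the chart, [e2] keeps the other boundary coordinates
   positive, and [K] bounds the inverse of [Q]. *)
pose e := Num.min e1 e2 / K.
have e0 : 0 < e by rewrite divr_gt0// lt_min e10.
have small v : `|v| < e -> `|v *m invmx Q + c p - c p| < e1 /\ `|v *m invmx Q + c p - c p| < e2.
  move=> ve; rewrite addrK.
  have H : `|v *m invmx Q| < Num.min e1 e2.
    by apply: le_lt_trans (HK v) _; rewrite mulrC -ltr_pdivlMr.
  by split; apply: lt_le_trans H _; rewrite ge_min lexx ?orbT.
have obox := @open_box R n e.
pose D := dom c `&` u @^-1` [set v : 'rV[R]_n | forall i, `|v ord0 i| < e].
have oD : open D.
  by apply: (cont_open_pre _ (coord_open cc) obox) => q cq; exact: (g_cont gu).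
have imD : u @` D = orthant J `&` [set v : 'rV[R]_n | forall i, `|v ord0 i| < e].
  apply/seteqP; split => [_ [q [cq bq] <-]|v [Jv bv]].
    split => // j; rewrite inE => /andP[jb /eqP pj].
    by rewrite /u HQ// !mxE pj subr0; exact: coord_orthant cc cq _ jb.
  have [v1 v2] := small v (norm_row_lt e0 bv).
  have [|q [cq Oq Eq]] := He1 (v *m invmx Q + c p) _ v1.
    move=> j jb; have [jJ|jJ] := boolP (j \in J); last first.
      by apply: ltW; exact: He2.
    move: (jJ); rewrite inE jb => /eqP pj.
    by rewrite mxE pj addr0 -HQ// mulmxKV//; exact: Jv.
  have uv : u q = v by rewrite /u Eq addrK mulmxKV.
  by exists q => //; split => //=; rewrite uv.
have gD : gcoord D u by apply: (g_sub oD _ gu) => q [].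
exists (Chart D J u); split => //=; last first.
  move=> q [cq bq]; split => //.
  have [v1 v2] := small (u q) (norm_row_lt e0 bq); rewrite -uE in v1.
  have [q' [cq' Oq' Eq]] := He1 (c q) (coord_orthant cc cq) v1.
  by rewrite -(homeo_inj (g_homeo (g_coordinates cc)) cq' cq Eq).
have u0 : u p = 0 by rewrite /u subrr mul0mx.
split => //=.
- exact: (g_chart gD obox imD).
- by split => // i; rewrite /= u0 mxE normr0.
- by exists e.
Qed.

(** [J] is the derivative of a chosen smooth extension; the estimate involves points of the manifold
    only. *)
Lemma jacobian_of c c' p : coordinates c -> coordinates c' -> dom c p -> dom c' p ->
  exists J : 'M[R]_n, forall e : R, 0 < e -> \forall q \near p,
    `|c' q - c' p - (c q - c p) *m J| <= e * `|c q - c p|.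
Proof.
move=> cc cc' cp cp'.
have gc := g_coordinates cc; have gc' := g_coordinates cc'.
have /choice[W /choice[g Hg]] : forall i : 'I_n, exists W : set 'rV[R]_n, exists g,
    [/\ open W, W (c p), smooth W g &
     forall q, (dom c `&` dom c') q -> W (c q) -> c' q ord0 i = g (c q)].
  by move=> i; exact: (g_compat gc gc').
exists (\matrix_(l, i) 'D_('e_l) (g i) (c p)) => e e0.
have Hi i : \forall q \near p,
    `|(c' q - c' p - (c q - c p) *m \matrix_(l, i) 'D_('e_l) (g i) (c p)) ord0 i|
      <= e * `|c q - c p|.
  have [ oW Wp Sg E] := Hg i.
  have [d d0 Hd] := (@near_normP R 'rV[R]_n _ 0).1 (C1_frechet oW (Sg 1%N) Wp e0).
  have N1 : \forall q \near p, W i (c q) /\ `|c q - c p| < d.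
    apply: near_and; first by apply: (g_cont gc cp); exact: (@open_near 'rV[R]_n).
    exact: (@cont_dist R 'rV[R]_n M c p d d0 (g_cont gc cp)).
  have N2 : \forall q \near p, dom c q /\ dom c' q.
    by apply: near_and; apply: open_near => //; exact: coord_open.
  apply: near_mono (near_and N1 N2) => q [[Wq dq] [cq cq']].
  have := Hd (c q - c p); rewrite subr0 subrK => /(_ dq).
  rewrite !mxE E// E// opprD addrA; congr (`| _ - _ | <= _).
  by apply: eq_bigr => l _; rewrite !mxE.
apply: near_mono (near_forall Hi) => q Hq; apply: norm_row_le => //.
by rewrite mulr_ge0// ltW.
Qed.

(** The tangent cone at [p], read in the chart [c]. *)
Definition inward c p (w : 'rV[R]_n) :=
  forall j, j \in bnd c -> c p ord0 j = 0 -> 0 <= w ord0 j.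

Lemma inward_point c p w O : coordinates c -> dom c p -> inward c p w ->
  (\forall q \near p, O q) ->
  exists2 e : R, 0 < e & forall s : R, 0 <= s < e ->
    exists q, [/\ dom c q, O q & c q = c p + s *: w].
Proof.
move=> cc cp iw N; have : nbhs p O by exact: N.
rewrite nbhsE => -[ O' [ oO' O'p] sO].
have [e1 e10 He1] := coord_near_image cc cp oO' O'p.
have Hpos : \forall s \near nbhs (0 : R), forall j : 'I_n, j \in bnd c -> 0 < c p ord0 j ->
    0 < c p ord0 j + s * w ord0 j.
  apply: (@near_forall R) => j.
  have [jp|jp] := ltP 0 (c p ord0 j); last by apply: filterE => s _.
  have := @open_ltf R R (fun=> 0) (fun s => c p ord0 j + s * w ord0 j) 0.
  have c1 : {for (0 : R), continuous (fun _ : R => 0 : R)} by exact: cont_cst.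
  have cs : {for (0:R), continuous (fun s : R => c p ord0 j + s * w ord0 j)}.
    apply: contD; first exact: cont_cst.
    by apply: contM; [exact: cont_id|exact: cont_cst].
  by move=> /(_ c1 cs); rewrite mul0r addr0 => /(_ jp); apply: filterS => s.
have [e2 e20 He2] := (@near_normP R R _ 0).1 Hpos.
have w1 : 0 < `|w| + 1 by rewrite ltr_wpDl.
exists (Num.min (e1 / (`|w| + 1)) e2); first by rewrite lt_min divr_gt0.
move=> s /andP[s0]; rewrite lt_min => /andP[s1 s2].
have [||q [cq Oq Eq]] := He1 (c p + s *: w).
- move=> j jb; rewrite !mxE.
  have := coord_orthant cc cp jb; rewrite le_eqVlt => /predU1P[j0|j0].
    by rewrite -j0 add0r mulr_ge0// iw.
  by apply: ltW; apply: He2; rewrite // subr0 ger0_norm.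
- rewrite addrAC subrr add0r normrZ ger0_norm//; move: s1; rewrite ltr_pdivlMr// => H.
  by apply: le_lt_trans H; rewrite ler_wpM2l// lerDl.
- by exists q; split => //; exact: sO.
Qed.

Lemma norm_sub_eps (v : 'rV[R]_n) (K : R) : 0 < K ->
  (forall e : R, 0 < e -> `|v| <= e * K) -> v = 0.
Proof.
move=> K0 H; apply/eqP; rewrite -normr_le0; apply/ler_addgt0Pl => e e0.
by rewrite addr0 (le_trans (H (e / K) _)) ?divr_gt0// divfK// gt_eqF.
Qed.

(** The chain rule, tested at the points [c p + s *: w] with small [s], which lie in the chart
    because [w] is inward. *)
Lemma jacobian_inward c c' p (J J' : 'M[R]_n) w : coordinates c -> coordinates c' ->
  dom c p -> dom c' p ->
  (forall e : R, 0 < e -> \forall q \near p,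
    `|c' q - c' p - (c q - c p) *m J| <= e * `|c q - c p|) ->
  (forall e : R, 0 < e -> \forall q \near p,
    `|c q - c p - (c' q - c' p) *m J'| <= e * `|c' q - c' p|) ->
  inward c p w -> w *m J *m J' = w.
Proof.
move=> cc cc' cp cp' HJ HJ' iw.
have [K1 K10 HK1] := mulmx_bound J; have [K2 K20 HK2] := mulmx_bound J'.
have w1 : 0 < `|w| + 1 by rewrite ltr_wpDl.
have K11 : 0 < K1 + 1 by rewrite addr_gt0.
have B0 : 0 < (K1 + 1) * (`|w| + 1) + K2 * (`|w| + 1) by rewrite addr_gt0// mulr_gt0.
apply/eqP; rewrite eq_sym -subr_eq0; apply/eqP.
apply: (@norm_sub_eps _ ((K1 + 1) * (`|w| + 1) + K2 * (`|w| + 1))).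
  exact: B0.
(* The cap 1 makes the bound on the displacement in [c'] independent of [e]. *)
move=> e' e'0; pose e := Num.min e' 1.
have e0 : 0 < e by rewrite lt_min e'0 ltr01.
apply: (@le_trans _ _ (e * ((K1 + 1) * (`|w| + 1) + K2 * (`|w| + 1)))); last first.
  rewrite ler_wpM2r//; last by rewrite ge_min lexx.
  exact: ltW.
have [d d0 Hd] := inward_point cc cp iw (near_and (HJ e e0) (HJ' e e0)).
have s0 : 0 < d / 2 by rewrite divr_gt0.
have [|q [cq [H1 H2] Eq]] := Hd (d / 2).
  by rewrite ltW//= ltr_pdivrMr// ltr_pMr// ltr1n.
set s := d / 2 in s0 Eq; have Ew : c q - c p = s *: w by rewrite Eq addrC addKr.
rewrite Ew in H1 H2; set D := c' q - c' p in H1 H2; clearbody D.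
have ns : `|s *: w| = s * `|w| by rewrite normrZ ger0_norm// ltW.
have D1 : `|D| <= s * ((K1 + 1) * (`|w| + 1)).
  rewrite -(subrK (s *: w *m J) D) (le_trans (ler_normD _ _))//.
  apply: (@le_trans _ _ (e * (s * `|w|) + K1 * (s * `|w|))).
    by apply: lerD; rewrite -ns.
  rewrite -mulrDl mulrCA ler_wpM2l// ?(ltW s0)// ler_pM//.
  - by rewrite addr_ge0// ltW.
  - by rewrite addrC lerD2l ge_min lexx orbT.
  - by rewrite lerDl.
have -> : w - w *m J *m J' = s^-1 *: ((s *: w - D *m J') + (D - s *: w *m J) *m J').
  rewrite mulmxBl subrKA -!scalemxAl -scalerBr scalerA mulVf ?scale1r//.
  by rewrite gt_eqF.
rewrite normrZ ger0_norm ?invr_ge0 ?(ltW s0)// ler_pdivrMl//.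
rewrite (le_trans (ler_normD _ _))// mulrDr mulrDr; apply: lerD.
  apply: (le_trans H2); rewrite mulrCA; apply: ler_wpM2l; first exact: ltW.
  exact: D1.
rewrite ns in H1; apply: (le_trans (HK2 _)).
have -> : s * (e * (K2 * (`|w| + 1))) = K2 * (e * (s * (`|w| + 1))) by ring.
apply: ler_wpM2l; first exact: ltW.
apply: (le_trans H1); rewrite ler_wpM2l ?(ltW e0)// ler_wpM2l ?(ltW s0)//.
by rewrite lerDl.
Qed.

(** [w2] collects the negative parts of the coordinates in [J]. Stability of [V] keeps both summands
    in [V], so that linear statements about [V] need only be tested on inward vectors. *)
Lemma inward_split (w : 'rV[R]_n) (J : {set 'I_n}) : exists w1 w2 : 'rV[R]_n,
  [/\ w = w1 - w2, forall j, j \in J -> 0 <= w1 ord0 j, forall j, j \in J -> 0 <= w2 ord0 j &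
   forall V : 'M[R]_n, stab V J -> (w <= V)%MS -> (w1 <= V)%MS /\ (w2 <= V)%MS].
Proof.
pose w2 : 'rV[R]_n := \sum_(j in J) Num.max 0 (- w ord0 j) *: 'e_j.
have w2j j : w2 ord0 j = if j \in J then Num.max 0 (- w ord0 j) else 0.
  rewrite summxE; have [jJ|jJ] := boolP (j \in J).
    rewrite (bigD1 j)//= !mxE !eqxx mulr1 big1 ?addr0// => i /andP[_ ij].
    by rewrite !mxE [j == i]eq_sym (negbTE ij) andbF mulr0.
  rewrite big1// => i iJ; rewrite !mxE; have [E|_] := eqVneq j i; last by rewrite andbF mulr0.
  by rewrite E iJ in jJ.
exists (w + w2), w2; split; first by rewrite addrK.
- by move=> j jJ; rewrite mxE w2j jJ -lerBlDl sub0r le_max lexx orbT.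
- by move=> j jJ; rewrite w2j jJ le_max lexx.
- move=> V /stabP sV wV; suff H : (w2 <= V)%MS by split => //; exact: addmx_sub.
  apply: summx_sub => j jJ; have [H|H] := leP 0 (- w ord0 j).
    by have := scalemx_sub (-1) (sV w j jJ wV); rewrite scalerA mulN1r.
  by rewrite scale0r sub0mx.
Qed.

Lemma jacobian_inv c c' p : coordinates c -> coordinates c' -> dom c p -> dom c' p ->
  exists J J' : 'M[R]_n, [/\ J *m J' = 1%:M,
    forall e : R, 0 < e -> \forall q \near p,
      `|c' q - c' p - (c q - c p) *m J| <= e * `|c q - c p| &
    forall e : R, 0 < e -> \forall q \near p,
      `|c q - c p - (c' q - c' p) *m J'| <= e * `|c' q - c' p|].
Proof.
move=> cc cc' cp cp'.
have [J HJ] := jacobian_of cc cc' cp cp'; have [J' HJ'] := jacobian_of cc' cc cp' cp.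
exists J, J'; split => //; apply/row_matrixP => i; rewrite !rowE.
have [w1 [w2 [-> H1 H2 _]]] := inward_split (delta_mx 0 i) (bnd c).
rewrite mulmx1 mulmxA !mulmxBl !(jacobian_inward cc cc' cp cp' HJ HJ')//.
  by move=> j jb _; exact: H2.
by move=> j jb _; exact: H1.
Qed.

(* A direction w inward at p is the velocity of a curve c = c p + s w, whose
   velocity in the chart c' is w J. *)
Lemma velocity c c' p (J : 'M[R]_n) w (e : R) O : coordinates c -> dom c p -> inward c p w ->
  (forall e : R, 0 < e -> \forall q \near p,
      `|c' q - c' p - (c q - c p) *m J| <= e * `|c q - c p|) ->
  0 < e -> (\forall q \near p, O q) ->
  exists q s, [/\ O q, dom c q, c q = c p + s *: w, 0 < s &
    `|s^-1 *: (c' q - c' p) - w *m J| <= e].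
Proof.
move=> cc cp iw HJ e0 nO.
have w1 : 0 < `|w| + 1 by rewrite ltr_wpDl.
have [d d0 Hd] := inward_point cc cp iw (near_and nO (HJ _ (divr_gt0 e0 w1))).
have s0 : 0 < d / 2 by rewrite divr_gt0.
have [|q [cq [ Oq H1] Eq]] := Hd (d / 2).
  by rewrite ltW//= ltr_pdivrMr// ltr_pMr// ltr1n.
set s := d / 2 in s0 Eq; exists q, s; split => //.
have Ew : c q - c p = s *: w by rewrite Eq addrC addKr.
rewrite Ew -scalemxAl normrZ (ger0_norm (ltW s0)) in H1.
have -> : s^-1 *: (c' q - c' p) - w *m J = s^-1 *: (c' q - c' p - s *: (w *m J)).
  by rewrite [RHS]scalerBr scalerA mulVf ?scale1r// gt_eqF.
rewrite normrZ ger0_norm ?invr_ge0 ?(ltW s0)// ler_pdivrMl//.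
apply: (le_trans H1); rewrite mulrCA ler_wpM2l ?(ltW s0)//.
by rewrite mulrAC -mulrA ler_piMr ?(ltW e0)// ler_pdivrMr// mul1r lerDl.
Qed.

(** Inward vectors of [V] are velocities of points with coordinates in [V], and a subspace is
    closed, so the Jacobian maps them into [V']. By splitting it maps all of [V] into [V'], and it
    is injective. *)
Lemma rank_le_of_sub c c' p (V V' : 'M[R]_n) : coordinates c -> coordinates c' ->
  dom c p -> dom c' p -> c p = 0 -> c' p = 0 -> stab V (bnd c) ->
  (\forall q \near p, (c q <= V)%MS -> (c' q <= V')%MS) -> (\rank V <= \rank V')%N.
Proof.
move=> cc cc' cp cp' c0 c0' sV nV.
have [J [J' [JJ HJ _]]] := jacobian_inv cc cc' cp cp'.
have VJ w : inward c p w -> (w <= V)%MS -> (w *m J <= V')%MS.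
  move=> iw wV; rewrite submxE; apply/eqP.
  have [K K0 HK] := mulmx_bound (cokermx V').
  apply: (@norm_sub_eps _ _ K0) => e e0.
  have [q [s [Vq cq Eq s0 H]]] := velocity cc cp iw HJ e0 nV.
  have c'V : (c' q <= V')%MS.
    by apply: Vq; rewrite Eq c0 add0r scalemx_sub.
  have -> : w *m J *m cokermx V' = - ((s^-1 *: (c' q - c' p) - w *m J) *m cokermx V').
    rewrite mulmxBl c0' subr0 -scalemxAl.
    by move: c'V; rewrite submxE => /eqP ->; rewrite scaler0 sub0r opprK.
  by rewrite normrN (le_trans (HK _))// mulrC ler_wpM2r// ltW.
have VJ' : (V *m J <= V')%MS.
  apply/row_subP => i; rewrite row_mul.
  have [w1 [w2 [E H1 H2 /(_ V sV (row_sub i V))[V1 V2]]]] := inward_split (row i V) (bnd c).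
  rewrite E mulmxBl addmx_sub//; first by apply: VJ => // j jb _; exact: H1.
  by rewrite eqmx_opp; apply: VJ => // j jb _; exact: H2.
rewrite -(@mxrankMfree _ _ _ _ V J); first exact: mxrankS.
by apply/row_freeP; exists J'.
Qed.

(** The subspace where the vanishing boundary coordinates are zero consists of the [w] for which [w]
    and [- w] are both inward, a property that the Jacobian preserves. *)
Lemma rank_le_bnd c c' p : coordinates c -> coordinates c' -> dom c p -> dom c' p ->
  (#|[set j in bnd c' | c' p ord0 j == 0%R]%SET| <= #|[set j in bnd c | c p ord0 j == 0%R]%SET|)%N.
Proof.
move=> cc cc' cp cp'; set A := [set j in bnd c | _]%SET; set A' := [set j in bnd c' | _]%SET.
have [J [J' [JJ HJ _]]] := jacobian_inv cc cc' cp cp'.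
have H (w : 'rV[R]_n) : (w <= csp (~: A))%MS -> forall j, j \in A' -> 0 <= (w *m J) ord0 j.
  move=> /sub_csp wA j; rewrite inE => /andP[jb /eqP j0].
  have iw : inward c p w.
    by move=> i ib i0; rewrite wA// !inE ib i0 eqxx.
  apply/ler_addgt0Pl => e e0.
  have N := open_near (coord_open cc') cp'.
  have [q [s [cq' cq Eq s0 /(le_trans (norm_coord_le _ j)) B]]] := velocity cc cp iw HJ e0 N.
  move: B; rewrite !mxE j0 subr0 ler_norml => /andP[_]; rewrite lerBlDr.
  by apply: le_trans; rewrite mulr_ge0 ?invr_ge0 ?(ltW s0)//; exact: coord_orthant cc' cq' _ jb.
have VJ : (csp (~: A) *m J <= csp (~: A'))%MS.
  apply/rV_subP => v /submxP[D ->]; rewrite mulmxA; apply/sub_csp => j; rewrite inE negbK => jA.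
  have := H _ (submxMl D (csp (~: A))) j jA.
  have := H (- (D *m csp (~: A))); rewrite eqmx_opp submxMl => /(_ isT j jA).
  by rewrite mulNmx [X in 0 <= X]mxE oppr_ge0 => H1 H2; apply/eqP; rewrite eq_le H1.
have := mxrankS VJ; rewrite mxrankMfree; last by apply/row_freeP; exists J'.
rewrite !rank_csp => H1.
have := cardsC A; have := cardsC A'; rewrite !card_ord => E1 E2.
by rewrite -(leq_add2r #|~: A'|) (leq_trans _ (leq_add (leqnn #|A|) H1))// E1 E2.
Qed.

Lemma corner_codim c c' p : coordinates c -> coordinates c' -> dom c p -> dom c' p ->
  #|[set j in bnd c' | c' p ord0 j == 0]%SET| = #|[set j in bnd c | c p ord0 j == 0]%SET|.
Proof. by move=> cc cc' cp cp'; apply/eqP; rewrite eqn_leq !rank_le_bnd. Qed.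

End Charts.

(** * Polar coordinates *)

Lemma near_open (T : topologicalType) (P : T -> Prop) (x : T) :
  (\forall y \near x, P y) -> exists O : set T, [/\ open O, O x & O `<=` P].
Proof.
move=> N; have : nbhs x P by exact: N.
by rewrite nbhsE => -[ O [ oO Ox] sO]; exists O.
Qed.

Section PolarSegment.
Context {R : realType} {n : nat}.

(** A closed condition passes to the end point of a segment. It is applied to segments along which
    the radius increases, to reach rho = 0 from rho > 0. *)
Lemma seg_ge0 m (Psi : 'rV[R]_m -> R) (v w : 'rV[R]_m) (d : R) :
  {for v, continuous Psi} -> 0 < d ->
  (forall t : R, 0 < t < d -> 0 <= Psi (v + t *: w)) -> 0 <= Psi v.
Proof.
move=> cP d0 H; rewrite leNgt; apply/negP => Pv.
have c0 : {for v, continuous (fun _ : 'rV[R]_m => 0 : R)} by exact: cont_cst.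
have [d1 d10 H1] := (@near_normP R 'rV[R]_m _ v).1
  (@open_ltf R 'rV[R]_m Psi (fun=> 0) v cP c0 Pv).
have w1 : 0 < `|w| + 1 by rewrite ltr_wpDl.
pose t := Num.min d (d1 / (`|w| + 1)) / 2.
have m0 : 0 < Num.min d (d1 / (`|w| + 1)) by rewrite lt_min d0 divr_gt0.
have t0 : 0 < t by rewrite divr_gt0.
have tm : t < Num.min d (d1 / (`|w| + 1)) by rewrite ltr_pdivrMr// ltr_pMr// ltr1n.
have [td td1] : t < d /\ t < d1 / (`|w| + 1) by move: tm; rewrite lt_min => /andP[].
have := H t; rewrite t0 td => /(_ isT); rewrite leNgt H1//.
rewrite addrAC subrr add0r normrZ gtr0_norm//; move: td1; rewrite ltr_pdivlMr//.
by apply: le_lt_trans; rewrite ler_wpM2l ?(ltW t0)// lerDl.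
Qed.

Lemma seg_eq0 m (Psi : 'rV[R]_m -> R) (v w : 'rV[R]_m) (d : R) :
  {for v, continuous Psi} -> 0 < d ->
  (forall t : R, 0 < t < d -> Psi (v + t *: w) = 0) -> Psi v = 0.
Proof.
move=> cP d0 H; apply/eqP; rewrite eq_le; apply/andP; split; last first.
  by apply: (@seg_ge0 _ _ _ w _ cP d0) => t /H ->.
by rewrite -oppr_ge0; apply: (@seg_ge0 _ _ _ w _ (contN cP) d0) => t /H ->; rewrite oppr0.
Qed.

Notation e0 := (delta_mx ord0 ord0 : 'rV[R]_n.+1).

Lemma addt0 (v : 'rV[R]_n.+1) (t : R) : (v + t *: e0) ord0 ord0 = v ord0 ord0 + t.
Proof. by rewrite !mxE !eqxx mulr1. Qed.

Lemma addtl (v : 'rV[R]_n.+1) (t : R) (i : 'I_n) :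
  (v + t *: e0) ord0 (lift ord0 i) = v ord0 (lift ord0 i).
Proof. by rewrite !mxE/= mulr0 addr0. Qed.

Lemma cont_polar (I : {set 'I_n}) (T : topologicalType) (f : T -> 'rV[R]_n.+1) (x : T) :
  {for x, continuous f} -> {for x, continuous (fun y => polar I (f y))}.
Proof.
move=> cf; apply: cont_row => i; case: (i \in I); last exact: cont_coord.
by apply: contM; exact: cont_coord.
Qed.

(** Increasing the radius moves [polar I v] along an inward direction; the new point stays in the
    image of [c], which is relatively open in the orthant. *)
Lemma polar_dom_seg (M : premfd R n) (c : chart R n M) (I : {set 'I_n}) (U : set M)
    (v : 'rV[R]_n.+1) : coordinates c -> open U -> U `<=` dom c ->
  polar_dom (bnd c) I (c @` U) v ->
  exists2 d : R, 0 < d & forall t : R, 0 <= t < d ->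
    polar_dom (bnd c) I (c @` U) (v + t *: e0).
Proof.
move=> cc oU sU [v0 v1 vJ [q Uq Eq]].
have [e e_gt0 He] := coord_near_image cc (sU _ Uq) oU Uq.
have cpol : {for (0:R), continuous (fun t : R => polar I (v + t *: e0))}.
  apply: cont_polar; apply: cont_addrow; first exact: cont_cst.
  exact: (@scalel_continuous _ _ _).
have [d d0 Hd] := (@near_normP R R _ 0).1 (@cont_dist R 'rV[R]_n _ _ _ _ e_gt0 cpol).
exists d => // t /andP[t0 td]; split.
- by rewrite addt0 addr_ge0.
- by rewrite -v1; apply: eq_bigr => i _; rewrite addtl.
- by move=> i iI iJ; rewrite addtl; exact: vJ.
- have := Hd t; rewrite subr0 ger0_norm// => /(_ td).
  rewrite scale0r addr0 -Eq => /He[|q' [cq' Uq' Eq']]; last by exists q'.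
  move=> j jJ; rewrite mxE addt0 addtl.
  have := coord_orthant cc (sU _ Uq) jJ; rewrite Eq mxE.
  by case: ifP => // jI _; rewrite mulr_ge0 ?addr_ge0// vJ.
Qed.

End PolarSegment.

Section HalfChange.
Context {R : realType} {n : nat} (M : premfd R n).
Implicit Types (c : chart R n M) (I : {set 'I_n}) (U : set M).

(** Data for one direction of a change of charts mapping the centre of [c] into that of [c']: [g]
    extends [c'] smoothly as a function of [c], and [h] holds the Hadamard quotients of its
    components in [I']. On the centre the matrix [h] is the normal derivative. *)
Definition half c c' I I' U W (g : 'I_n -> 'rV[R]_n -> R) (h : 'I_n -> 'I_n -> 'rV[R]_n -> R) :=
  [/\ open W /\ U `<=` dom c `&` dom c', forall i, smooth W (g i),
      forall i k, smooth W (h i k),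
      forall q, U q -> W (c q) /\ forall i, c' q ord0 i = g i (c q) &
      forall q, U q -> forall i, i \in I' ->
        c' q ord0 i = \sum_(k in I) c q ord0 k * h i k (c q)].

Lemma half_exists c c' I I' p : coordinates c -> coordinates c' -> dom c p -> dom c' p ->
  (forall i, i \in I -> c p ord0 i = 0) ->
  (\forall q \near p, (forall i, i \in I -> c q ord0 i = 0) -> forall i, i \in I' -> c' q ord0 i = 0) ->
  exists U W g h, [/\ open U, U p & half c c' I I' U W g h].
Proof.
move=> cc cc' cp cp' pI HI.
have gc := g_coordinates cc; have gc' := g_coordinates cc'.
have /choice[W /choice[g Hg]] : forall i : 'I_n, exists W : set 'rV[R]_n, exists g,
    [/\ open W, W (c p), smooth W g &
     forall q, (dom c `&` dom c') q -> W (c q) -> c' q ord0 i = g (c q)].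
  by move=> i; exact: (g_compat gc gc').
have oW0 : open [set v | forall i, W i v] by apply: bigcap_open => i; have [] := Hg i.
have W0p : [set v | forall i, W i v] (c p) by move=> i; have [] := Hg i.
have [e1 e10 He1] := (@near_normP R 'rV[R]_n _ (c p)).1 (open_near oW0 W0p).
have : \forall q \near p, dom c' q /\ ((forall i, i \in I -> c q ord0 i = 0) -> forall i, i \in I' -> c' q ord0 i = 0).
  by apply: near_and => //; apply: open_near => //; exact: coord_open.
move=> /near_open[ O [ oO Op sO]].
have [e2 e20 He2] := coord_near_image cc cp oO Op.
pose e := Num.min e1 e2; have e_gt0 : 0 < e by rewrite lt_min e10.
pose box : set 'rV[R]_n := [set v | (forall i, `|v ord0 i - c p ord0 i| < e)].
have obox : open box.
  have -> : box = setT `&` (fun v : 'rV[R]_n => v - c p) @^-1` [set v : 'rV[R]_n | forall i, `|v ord0 i| < e].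
    apply/seteqP; split => [v Hv|v [_ Hv]] => [|i]; last by have := Hv i; rewrite !mxE.
    by split => // i; rewrite /= !mxE; exact: Hv.
  apply: (@cont_open_pre 'rV[R]_n 'rV[R]_n); [|exact: openT|exact: open_box].
  by move=> v _; apply: (@cont_addrow R n 'rV[R]_n id (fun=> - c p)); [exact: cont_id|exact: cont_cst].
have box_norm v : box v -> `|v - c p| < e.
  by move=> Hv; apply: norm_row_lt => // i; rewrite !mxE; exact: Hv.
have boxW v i : box v -> W i v.
  by move=> /box_norm H; apply: He1; apply: lt_le_trans H _; rewrite ge_min lexx.
have star_box : star I box.
  move=> v t Hv /andP[t0 t1] i; rewrite mxE; case: ifPn => // iI.
  rewrite (pI _ iI) subr0; have := Hv i; rewrite (pI _ iI) subr0.
  by apply: le_lt_trans; rewrite normrM ger0_norm// ler_piMl.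
have Sg i : smooth box (g i).
  by have [_ _ S _] := Hg i; apply: smooth_sub S => v; exact: boxW.
have /choice[h Hh] : forall i : 'I_n, exists h : 'I_n -> 'rV[R]_n -> R, (forall k, smooth box (h k)) /\
    forall v, box v -> g i v = g i (sc I 0 v) + \sum_(k in I) v ord0 k * h k v.
  by move=> i; exact: hadamard.
pose U := (dom c `&` c @^-1` box) `&` (dom c `&` dom c').
have oc := coord_open cc; have oc' := coord_open cc'.
have oU : open U.
  by apply: openI; [apply: (cont_open_pre _ oc obox) => q; exact: g_cont gc|exact: openI].
have Up : U p by split; split => //= i; rewrite subrr normr0.
have gE q i : U q -> c' q ord0 i = g i (c q).
  move=> [[cq bq] [_ cq']]; have [_ _ _ E] := Hg i; apply: E => //; exact: boxW.
exists U, box, g, h; split => //; split => //.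
- by split => // q [].
- by move=> i k; have [] := Hh i.
- by move=> q Uq; split=> [|i]; [by have [[]] := Uq|exact: gE].
- move=> q Uq i iI'; rewrite (gE _ _ Uq); have [[cq bq] _] := Uq.
  have [_ ->//] := Hh i; rewrite [X in X + _](_ : _ = 0) ?add0r//.
  (* The extension [g i] is controlled only at coordinates of points of the manifold; [sc I 0 (c q)]
     lies in the orthant and close to [c p], hence comes from a point of the centre. *)
  have b0 : box (sc I 0 (c q)) by apply: star_box => //; rewrite lexx ler01.
  have [||q' [cq' /sO[cq'' Z] Eq']] := He2 (sc I 0 (c q)).
  - move=> j jb; rewrite mxE mul0r; case: ifP => // _; exact: coord_orthant cc cq _ jb.
  - by apply: lt_le_trans (box_norm _ b0) _; rewrite ge_min lexx orbT.
  have [_ _ _ E] := Hg i; rewrite -Eq' -E//; last by rewrite Eq'; exact: boxW.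
  by apply: Z => // k kI; rewrite Eq' mxE kI mul0r.
Qed.

End HalfChange.

Section PolarChange.
Context {R : realType} {n : nat}.
Implicit Types (I : {set 'I_n}) (v : 'rV[R]_n.+1).

Notation e0 := (delta_mx ord0 ord0 : 'rV[R]_n.+1).

(** On the polar domain the [i]-th coordinate of [c'] is rho times [etaf I h i v] for [i] in [I'].
    Thus [etaf] is the new direction before normalization, [polN] its length, and [polG] the induced
    change of polar coordinates. *)
Definition etaf I (h : 'I_n -> 'I_n -> 'rV[R]_n -> R) (i : 'I_n) v : R :=
  \sum_(k in I) v ord0 (lift ord0 k) * h i k (polar I v).

Definition polN I I' h v : R := Num.sqrt (\sum_(i in I') etaf I h i v ^+ 2).

Definition polG I I' (g : 'I_n -> 'rV[R]_n -> R) h v : 'rV[R]_n.+1 :=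
  \row_j (if unlift ord0 j is Some i then
            (if i \in I' then etaf I h i v / polN I I' h v else g i (polar I v))
          else v ord0 ord0 * polN I I' h v).

Lemma polG0 I I' g h v : polG I I' g h v ord0 ord0 = v ord0 ord0 * polN I I' h v.
Proof. by rewrite mxE unlift_none. Qed.

Lemma polGl I I' g h v i : polG I I' g h v ord0 (lift ord0 i) =
  if i \in I' then etaf I h i v / polN I I' h v else g i (polar I v).
Proof. by rewrite mxE liftK. Qed.

Variables (M : premfd R n) (c c' : chart R n M) (I I' : {set 'I_n}).
Variables (U : set M) (W W' : set 'rV[R]_n).
Variables (g g' : 'I_n -> 'rV[R]_n -> R) (h h' : 'I_n -> 'I_n -> 'rV[R]_n -> R).
Hypothesis (cc : coordinates c) (cc' : coordinates c') (oU : open U).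
Hypothesis (H1 : half c c' I I' U W g h) (H2 : half c' c I' I U W' g' h').

Let D := polar_dom (bnd c) I (c @` U).
Let D' := polar_dom (bnd c') I' (c' @` U).
Let sU : U `<=` dom c. Proof. by have [[_ s] _ _ _ _] := H1; move=> q /s[]. Qed.
Let sU' : U `<=` dom c'. Proof. by have [[_ s] _ _ _ _] := H1; move=> q /s[]. Qed.

Lemma smooth_polar_comp (f : 'rV[R]_n -> R) : smooth W f ->
  smooth [set v : 'rV[R]_n.+1 | W (polar I v)] (fun v => f (polar I v)).
Proof.
have [[ oW _] _ _ _ _] := H1; move=> Sf.
have oWp : open [set v : 'rV[R]_n.+1 | W (polar I v)].
  have -> : [set v : 'rV[R]_n.+1 | W (polar I v)] = setT `&` (polar I) @^-1` W by rewrite setTI.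
  apply: (@cont_open_pre 'rV[R]_n.+1 'rV[R]_n) => //; last exact: openT.
  move=> v _; apply: (@cont_polar _ _ I 'rV[R]_n.+1 (fun y => y) v).
  exact: cont_id.
apply: (@smooth_comp _ _ _ _ W f (fun i v => if i \in I then v ord0 ord0 * v ord0 (lift ord0 i)
          else v ord0 (lift ord0 i))) => //.
move=> j; case: (j \in I); last exact: smooth_coord.
by apply: smoothM => //; exact: smooth_coord.
Qed.

Let Wp := [set v : 'rV[R]_n.+1 | W (polar I v)].

Let oWp : open Wp.
Proof.
have [[ oW _] _ _ _ _] := H1.
have -> : Wp = setT `&` (polar I) @^-1` W by rewrite setTI.
apply: (@cont_open_pre 'rV[R]_n.+1 'rV[R]_n) => //; last exact: openT.
move=> v _; apply: (@cont_polar _ _ I 'rV[R]_n.+1 (fun y => y) v).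
exact: cont_id.
Qed.

Lemma smooth_etaf i : smooth Wp (etaf I h i).
Proof.
have [_ _ Sh _ _] := H1; apply: smooth_sum => // k kI; apply: smoothM => //.
  exact: smooth_coord.
exact: smooth_polar_comp.
Qed.

Lemma D_Wp v : D v -> exists q, [/\ U q, c q = polar I v & Wp v].
Proof.
move=> [_ _ _ [q Uq Eq]]; exists q; split => //; have [_ _ _ + _] := H1.
by move=> /(_ q Uq)[+ _]; rewrite /Wp/= -Eq.
Qed.

Lemma gE v q i : U q -> c q = polar I v -> g i (polar I v) = c' q ord0 i.
Proof. by move=> Uq <-; have [_ _ _ /(_ q Uq)[_ ->]] := H1. Qed.

Lemma rho_etaf v q i : U q -> c q = polar I v -> i \in I' ->
  c' q ord0 i = v ord0 ord0 * etaf I h i v.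
Proof.
move=> Uq Eq iI'; have [_ _ _ _ ->//] := H1.
rewrite Eq mulr_sumr; apply: eq_bigr => k kI; rewrite mxE kI mulrA//.
Qed.

(* The normal derivatives of the two changes of coordinates are mutually inverse
   along the centre: clear when rho > 0, and extended to rho = 0 by continuity. *)
Lemma etaf_inv v q k : D v -> U q -> c q = polar I v -> k \in I ->
  \sum_(i in I') etaf I h i v * h' k i (c' q) = v ord0 (lift ord0 k).
Proof.
move=> Dv Uq Eq kI; have [[ oW _] Sg _ _ _] := H1; have [[ oW' _] _ Sh' HW' _] := H2.
pose Psi v := \sum_(i in I') etaf I h i v * h' k i (\row_j g j (polar I v)) - v ord0 (lift ord0 k).
have rowg w q' : U q' -> c q' = polar I w -> \row_j g j (polar I w) = c' q'.
  by move=> Uq' Eq'; apply/rowP => j; rewrite mxE (gE _ Uq').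
suff : Psi v = 0 by rewrite /Psi (rowg _ _ Uq Eq) => /eqP; rewrite subr_eq0 => /eqP.
have pos w q' : U q' -> c q' = polar I w -> w ord0 ord0 != 0 -> Psi w = 0.
  move=> Uq' Eq' w0; rewrite /Psi (rowg _ _ Uq' Eq'); apply/eqP; rewrite subr_eq0.
  apply/eqP/(mulfI w0); rewrite mulr_sumr.
  have [_ _ _ _ /(_ q' Uq' k kI)] := H2.
  rewrite Eq' mxE kI => ->; apply: eq_bigr => i iI'.
  by rewrite mulrA -(rho_etaf Uq' Eq').
have [v0|v0] := eqVneq (v ord0 ord0) 0; last exact: pos Uq Eq v0.
have [q1 [Uq1 Eq1 Wv]] := D_Wp Dv.
have cPsi : {for v, continuous Psi}.
  apply: contD; last by apply: contN; exact: coord_continuous.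
  apply: cont_sum => i iI'; apply: contM; first by apply: smooth_cont Wv; exact: smooth_etaf.
  apply: (@continuous_comp 'rV[R]_n.+1 'rV[R]_n _ (fun v => \row_j g j (polar I v)) (h' k i)).
    by apply: cont_row => j; apply: smooth_cont Wv; exact: smooth_polar_comp.
  rewrite /= (rowg _ _ Uq Eq); apply: smooth_cont (Sh' k i) _.
  by have [] := HW' q Uq.
have [d d0 Hd] := polar_dom_seg cc oU sU Dv.
apply: (@seg_eq0 _ _ _ _ e0 _ cPsi d0) => t /andP[t0 td].
have /D_Wp[q' [Uq' Eq' _]] : D (v + t *: e0) by apply: Hd; rewrite ltW.
by apply: (pos _ _ Uq' Eq'); rewrite addt0 v0 add0r gt_eqF.
Qed.

Let N2 v := \sum_(i in I') etaf I h i v ^+ 2.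

(** By [etaf_inv] the unit vector omega is a linear image of [etaf], which therefore cannot
    vanish. *)
Lemma N2_gt0 v : D v -> 0 < N2 v.
Proof.
move=> Dv; have [q [Uq Eq _]] := D_Wp Dv.
have N0 : 0 <= N2 v by apply: sumr_ge0 => i _; exact: sqr_ge0.
rewrite lt_neqAle N0 andbT eq_sym; apply/negP => /eqP N20.
have E0 i : i \in I' -> etaf I h i v = 0.
  move=> iI'; apply/eqP; rewrite -sqrf_eq0; apply/eqP; move: i iI'.
  by apply: psumr_eq0P => // i _; exact: sqr_ge0.
have [_ S1 _ _] := Dv; have := oner_neq0 R; rewrite -S1 big1 ?eqxx// => k kI.
by rewrite -(etaf_inv Dv Uq Eq kI) big1 ?expr0n// => i iI'; rewrite E0// mul0r.
Qed.

Lemma polN_gt0 v : D v -> 0 < polN I I' h v.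
Proof. by move=> /N2_gt0; rewrite sqrtr_gt0. Qed.

Lemma polG_polar v q : D v -> U q -> c q = polar I v -> polar I' (polG I I' g h v) = c' q.
Proof.
move=> Dv Uq Eq; have N0 := polN_gt0 Dv; apply/rowP => i; rewrite mxE polG0 polGl.
have [iI'|iI'] := boolP (i \in I'); last by rewrite (gE _ Uq Eq).
by rewrite (rho_etaf Uq Eq iI'); field; rewrite gt_eqF.
Qed.

Lemma etaf_ge0 v i : D v -> i \in I' -> i \in bnd c' -> 0 <= etaf I h i v.
Proof.
move=> Dv iI' ib; have [q [Uq Eq Wv]] := D_Wp Dv.
have pos w q' : U q' -> c q' = polar I w -> 0 < w ord0 ord0 -> 0 <= etaf I h i w.
  move=> Uq' Eq' w0; rewrite -(pmulr_rge0 _ w0) -(rho_etaf Uq' Eq' iI').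
  exact: coord_orthant cc' (sU' Uq') _ ib.
have [v0 _ _ _] := Dv; move: v0; rewrite le_eqVlt => /predU1P[v0|]; last exact: pos Uq Eq.
have cPsi : {for v, continuous (etaf I h i)} by apply: smooth_cont Wv; exact: smooth_etaf.
have [d d0 Hd] := polar_dom_seg cc oU sU Dv.
apply: (@seg_ge0 _ _ _ _ e0 _ cPsi d0) => t /andP[t0 td].
have /D_Wp[q' [Uq' Eq' _]] : D (v + t *: e0) by apply: Hd; rewrite ltW.
by apply: (pos _ _ Uq' Eq'); rewrite addt0 -v0 add0r.
Qed.

Lemma polG_dom v : D v -> D' (polG I I' g h v).
Proof.
move=> Dv; have [q [Uq Eq _]] := D_Wp Dv; have N0 := polN_gt0 Dv; split.
- by have [v0 _ _ _] := Dv; rewrite polG0 mulr_ge0// ltW.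
- transitivity (\sum_(i in I') (polN I I' h v ^- 2 * etaf I h i v ^+ 2)).
    by apply: eq_bigr => i iI'; rewrite polGl iI' expr_div_n mulrC.
  have N2v := N2_gt0 Dv.
  by rewrite -mulr_sumr -/(N2 v) /polN sqr_sqrtr ?(ltW N2v)// mulVf// gt_eqF.
- by move=> i iI' ib; rewrite polGl iI' divr_ge0 ?(ltW N0)// etaf_ge0.
- by rewrite (polG_polar Dv Uq Eq); exists q.
Qed.

Let WG := [set v | Wp v /\ 0 < N2 v].

Lemma smooth_polG : exists2 WG : set 'rV[R]_n.+1, open WG & D `<=` WG /\
  forall j, smooth WG (fun v => polG I I' g h v ord0 j).
Proof.
have SN2 : smooth Wp N2.
  by apply: smooth_sum => // i _; apply: smoothM => //; exact: smooth_etaf.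
have oWG : open WG.
  rewrite openE => v [Wv Nv]; apply: (@near_and 'rV[R]_n.+1).
    exact: (@open_near 'rV[R]_n.+1).
  apply: (@open_ltf R 'rV[R]_n.+1 (fun=> 0) N2) => //; first exact: cont_cst.
  exact: smooth_cont SN2 Wv.
have sWG : WG `<=` Wp by move=> v [].
have SN : smooth WG (polN I I' h).
  by apply: smooth_sqrt => // [v []//|]; exact: smooth_sub SN2.
exists WG => //; split => [v Dv|j].
  by split; [have [q []] := D_Wp Dv|exact: N2_gt0].
have [_ Sg _ _ _] := H1.
rewrite (_ : (fun v => _) = fun v : 'rV[R]_n.+1 => if unlift ord0 j is Some i then
            (if i \in I' then etaf I h i v * (polN I I' h v)^-1 else g i (polar I v))
          else v ord0 ord0 * polN I I' h v); last by apply/funext => v; rewrite mxE.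
case: (unlift ord0 j) => [i|]; last by apply: smoothM => //; exact: smooth_coord.
case: (i \in I'); last by apply: smooth_sub sWG _; exact: smooth_polar_comp.
apply: smoothM => //; first by apply: smooth_sub sWG _; exact: smooth_etaf.
by apply: smoothV => // v [_]; rewrite /polN -sqrtr_gt0 => /gt_eqF ->.
Qed.

Lemma etaf_polG v k : D v -> k \in I ->
  etaf I' h' k (polG I I' g h v) = v ord0 (lift ord0 k) / polN I I' h v.
Proof.
move=> Dv kI; have [q [Uq Eq _]] := D_Wp Dv; rewrite -(etaf_inv Dv Uq Eq kI).
rewrite /etaf (polG_polar Dv Uq Eq) mulr_suml; apply: eq_bigr => i iI'.
by rewrite polGl iI' mulrAC.
Qed.

(** Applied to the normalized direction, the second change gives omega divided by [polN]. As omega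
    has length 1, this has length [(polN I I' h v)^-1], and normalizing it restores omega. *)
Lemma polG_inv v : D v -> polG I' I g' h' (polG I I' g h v) = v.
Proof.
move=> Dv; have [q [Uq Eq _]] := D_Wp Dv; have N0 := polN_gt0 Dv.
have NN : polN I' I h' (polG I I' g h v) = (polN I I' h v)^-1.
  rewrite {1}/polN; under eq_bigr => k kI do rewrite etaf_polG// expr_div_n.
  rewrite -mulr_suml; have [_ -> _ _] := Dv.
  by rewrite mul1r -exprVn sqrtr_sqr ger0_norm// invr_ge0 ltW.
apply/rowP => j; case: (unliftP ord0 j) => [k ->|->].
  rewrite polGl; case: ifP => kI.
    by rewrite etaf_polG// NN invrK divfK// gt_eqF.
  rewrite (polG_polar Dv Uq Eq); have [_ _ _ /(_ q Uq)[_ <-] _] := H2.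
  by rewrite Eq mxE kI.
by rewrite polG0 polG0 NN mulfK// gt_eqF.
Qed.

End PolarChange.

Lemma half_pair {R : realType} {n : nat} (M : premfd R n) (c c' : chart R n M)
    (I I' : {set 'I_n}) (O : set M) p : coordinates c -> coordinates c' ->
  dom c p -> dom c' p -> open O -> O p ->
  (forall i, i \in I -> c p ord0 i = 0) -> (forall i, i \in I' -> c' p ord0 i = 0) ->
  (\forall q \near p, (forall i, i \in I -> c q ord0 i = 0) <-> (forall i, i \in I' -> c' q ord0 i = 0)) ->
  exists U W W' g g' h h', [/\ open U, U p, U `<=` O,
    half c c' I I' U W g h & half c' c I' I U W' g' h'].
Proof.
move=> cc cc' cp cp' oO Op pI pI' HI.
have N1 : \forall q \near p, (forall i, i \in I -> c q ord0 i = 0) -> forall i, i \in I' -> c' q ord0 i = 0.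
  by apply: near_mono HI => q [].
have N2 : \forall q \near p, (forall i, i \in I' -> c' q ord0 i = 0) -> forall i, i \in I -> c q ord0 i = 0.
  by apply: near_mono HI => q [].
have [U1 [W1 [g [h [ oU1 U1p H1]]]]] := half_exists cc cc' cp cp' pI N1.
have [U2 [W2 [g' [h' [ oU2 U2p H2]]]]] := half_exists cc' cc cp' cp pI' N2.
exists ((U1 `&` U2) `&` O), W1, W2, g, g', h, h'; split=> //.
- by apply: openI => //; exact: openI.
- have [[ oW s] S1 S2 H3 H4] := H1; split => //.
  + by split => // q [[/s]].
  + by move=> q [[/H3]].
  + by move=> q [[/H4]].
- have [[ oW s] S1 S2 H3 H4] := H2; split => //.
  + by split => // q [[_ /s]].
  + by move=> q [[_ /H3]].
  + by move=> q [[_ /H4]].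
Qed.

Section MoreDiffeo.
Context {R : realType} {n : nat}.

Lemma g_ext (M : premfd R n) (O : set M) m (P P' : M -> 'rV[R]_m) :
  (forall q, O q -> P q = P' q) -> gcoord O P -> gcoord O P'.
Proof.
move=> E gO; apply: (g_change gO).
  by apply: so_ext (@so_id _ _ _ O P) => // q /E.
by apply: so_ext (@so_id _ _ _ O P) => // q /E.
Qed.

Lemma d_local (M N : mfd R n) (U : set M) (V : set N) (F : M -> N) :
  open U -> open V -> F @` U = V -> (forall x y, U x -> U y -> F x = F y -> x = y) ->
  (forall p, U p -> exists (O : set M) (f : M -> N) (V' : set N),
     [/\ open O, O p, O `<=` U, diffeo_on O f V' & forall q, O q -> F q = f q]) ->
  diffeo_on U F V.
Proof.
move=> oU oV FU FI H; apply: d_crit => // p Up.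
have [ O [f [V' [ oO Op sO df E]]]] := H p Up.
have oV' := d_openV df oO; have [fO _ _ _ _] := df.
have [d ad dp] := atlas_cover (F p).
have gd : gcoord (V' `&` dom d) d.
  apply: g_sub (g_atlas ad); last by move=> ? [].
  by apply: openI => //; exact: g_open (g_atlas ad).
have gf := g_pull df oO gd (@subIsetl _ _ _).
exists (V' `&` dom d), n, d; split => //.
  by split => //; rewrite E// -fO; exists p.
have -> : U `&` F @^-1` (V' `&` dom d) = O `&` f @^-1` (V' `&` dom d).
  apply/seteqP; split => q [Uq] /= [V'q dq].
    have [q' Oq' Eq'] : (f @` O) (F q) by rewrite fO.
    rewrite -E// in Eq'; move: (FI _ _ (sO _ Oq') Uq Eq') => E'; subst q'.
    by rewrite -E.
  by split; [exact: sO|rewrite /= E].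
by apply: g_ext gf => q [ Oq _]; rewrite /= E.
Qed.

Lemma smooth_on_cont (M N : mfd R n) (F : M -> N) p : smooth_on setT F -> {for p, continuous F}.
Proof. by move=> [+ _]; apply. Qed.

Lemma smooth_on_comp (M N K : mfd R n) (F : M -> N) (G : N -> K) :
  smooth_on setT F -> smooth_on setT G -> smooth_on setT (G \o F).
Proof.
move=> SF SG; have [cF HF] := SF; have [cG HG] := SG; split.
  by move=> p _; apply: continuous_comp; [exact: cF|exact: cG].
move=> c e ac ae; apply: so_local => p [[_ cp] ep].
have [d ad dp] := atlas_cover (F p).
have [ od _] := atlas_corner ad.
have oFd : open (setT `&` F @^-1` dom d) by apply: cont_open_pre => //; exact: openT.
have [W [ oW Wp H]] := homeo_nbhs (g_homeo (g_atlas ac)) cp (open_near oFd (conj I dp)).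
exists W; split => //; apply: (@so_comp _ _ _ _ _ _ _ (d \o F)).
  by apply: so_sub (HF c d ac ad) => q [[[_ cq] eq] Wq]; have [_ dq] := H q cq Wq.
apply: so_sub (so_pre F (HG d e ad ae)) => q [[[_ cq] eq] Wq].
by have [_ dq] := H q cq Wq.
Qed.

Lemma diffeo_on_smooth (M N : mfd R n) (F : M -> N) : diffeo F -> smooth_on setT F.
Proof. by case. Qed.

Lemma chart_pull (M N : mfd R n) (U : set M) (F : M -> N) V (c : chart R n N) :
  diffeo_on U F V -> open U -> coordinates c -> dom c `<=` V ->
  coordinates (Chart (U `&` F @^-1` dom c) (bnd c) (c \o F)).
Proof.
move=> dF oU cc sV; have [[ oc [W oW hc]] _] := cc.
apply: (g_chart (W := W)) => //; first exact: g_pull dF oU (g_coordinates cc) sV.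
rewrite -(homeo_image hc); have [FU _ _ _ _] := dF.
apply/seteqP; split => [_ [q [Uq cq] <-]|_ [y cy <-]]; first by exists (F q).
have : V y by exact: sV.
by rewrite -FU => -[x Ux Ex]; exists x; rewrite /= ?Ex//; split => //; rewrite /= Ex.
Qed.

Lemma chart_restrict (M : premfd R n) (c : chart R n M) O : coordinates c -> open O ->
  coordinates (Chart (dom c `&` O) (bnd c) c).
Proof.
move=> cc oO; have gc := g_coordinates cc; have oc := coord_open cc.
have [W oW HW] := homeo_push (g_homeo gc) oO.
have [[_ [W' oW' hc]] _] := cc.
apply: (g_chart (W := W `&` W')) => //.
- by apply: g_sub gc; [exact: openI|move=> ? []].
- exact: openI.
apply/seteqP; split => [_ [q [cq Oq] <-]|v [Jv [Wv W'v]]].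
  have : (orthant (bnd c) `&` W') (c q) by rewrite -(homeo_image hc); exists q.
  by move=> [? ?]; split => //; split => //; exact/(HW q cq).1.
have : (orthant (bnd c) `&` W') v by [].
by rewrite -(homeo_image hc) => -[q cq Eq]; exists q => //; split => //; apply/HW => //; rewrite Eq.
Qed.

End MoreDiffeo.

(** * Polar coordinates on a blow-up *)

Section PolarCharts.
Context {R : realType} {n : nat}.
Implicit Types (M B : mfd R n).

(** The local clause of [is_blowup] with a chart that need not be centred and over an open part [O]
    of its domain; in this form it restricts to smaller sets and passes to other charts. *)
Definition polchart M B (beta : B -> M) (c : chart R n M) (I : {set 'I_n}) (O : set M)
    (P : B -> 'rV[R]_n.+1) :=
  [/\ open O /\ O `<=` dom c, gcoord (beta @^-1` O) P,
      P @` (beta @^-1` O) = polar_dom (bnd c) I (c @` O) &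
      forall b, O (beta b) -> c (beta b) = polar I (P b)].

Definition locally_zero M (C : set M) (c : chart R n M) (I : {set 'I_n}) (p : M) :=
  \forall q \near p, C q <-> forall i, i \in I -> c q ord0 i = 0.

(** Unlike [psub], it prescribes neither the dimension nor the number of components, so that it
    covers a union of two disjoint centres. *)
Definition submfd M (C : set M) := closed C /\ forall p, C p ->
  exists c (I : {set 'I_n}), [/\ coordinates c, dom c p & locally_zero C c I p].

Lemma psub_submfd M d (C : set M) : psub d C -> submfd C.
Proof.
move=> [clC _ H]; split => // p /H[c [I [[cc cp _ _] _ E]]]; exists c, I; split => //.
by apply: near_mono (open_near (coord_open cc) cp) => q /E.
Qed.

Lemma polchart_sub M B (beta : B -> M) c I O O' P :
  (forall p, {for p, continuous beta}) -> coordinates c -> open O' -> O' `<=` O ->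
  polchart beta c I O P -> polchart beta c I O' P.
Proof.
move=> cb cc oO' sO [[ oO sc] gO imO E].
have oB : open (beta @^-1` O') by apply: open_comp => // p _; exact: cb.
split; [|by apply: g_sub gO => // b; exact: sO| |by move=> b /sO; exact: E].
  by split => // q /sO/sc.
apply/seteqP; split => [_ [b O'b <-]|v [v0 v1 vJ [q O'q Eq]]].
  have : (P @` (beta @^-1` O)) (P b) by exists b => //; exact: sO.
  rewrite imO => -[v0 v1 vJ _]; split => //; exists (beta b) => //.
  by apply: E; exact: sO.
have : polar_dom (bnd c) I [set c x | x in O] v by split => //; exists q => //; exact: sO.
rewrite -imO => -[b Ob Eb]; exists b => //.
have : c (beta b) = c q by rewrite E// Eb Eq.
move=> /(homeo_inj (g_homeo (g_coordinates cc)) (sc _ Ob) (sc _ (sO _ O'q))) H.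
by rewrite /= H.
Qed.

Lemma polchart_change M B (beta : B -> M) c c' (I I' : {set 'I_n}) O P (p : M) :
  (forall b, {for b, continuous beta}) -> coordinates c -> coordinates c' ->
  polchart beta c I O P -> O p -> dom c' p ->
  (forall i, i \in I -> c p ord0 i = 0) -> (forall i, i \in I' -> c' p ord0 i = 0) ->
  (\forall q \near p, (forall i, i \in I -> c q ord0 i = 0) <-> (forall i, i \in I' -> c' q ord0 i = 0)) ->
  exists U P', [/\ open U, U p, U `<=` O `&` dom c' & polchart beta c' I' U P'].
Proof.
move=> cb cc cc' pO Op cp' pI pI' HI; have [[ oO sc] _ _ _] := pO.
have cp := sc _ Op.
have [U [W1 [W2 [g [g' [h [h' [ oU Up sU H1 H2]]]]]]]] := half_pair cc cc' cp cp' oO Op pI pI' HI.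
have sU' : U `<=` dom c' by have [[_ s] _ _ _ _] := H1; move=> q /s[].
have [[_ _] gU imU EU] := polchart_sub cb cc oU sU pO.
pose G := polG I I' g h; pose G' := polG I' I g' h'.
have DP b : U (beta b) -> polar_dom (bnd c) I (c @` U) (P b).
  by move=> Ub; rewrite -imU; exists b.
have GG b : U (beta b) -> G' (G (P b)) = P b.
  by move=> Ub; apply: (polG_inv cc oU H1 H2); exact: DP.
exists U, (G \o P); split => //; first by move=> q Uq; split; [exact: sU|exact: sU'].
split => //.
- have [WG oWG [DW SG]] := smooth_polG cc oU H1 H2.
  have [WG' oWG' [DW' SG']] := smooth_polG cc' oU H2 H1.
  apply: (g_change gU).
    apply: (@so_smooth _ _ _ _ _ WG (fun j v => G v ord0 j)) => // b Ub.
    by apply: DW; exact: DP.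
  apply: (@so_smooth _ _ _ _ _ WG' (fun j v => G' v ord0 j)) => // b.
    by move=> Ub; apply: DW'; apply: (polG_dom cc cc' oU H1 H2); exact: DP.
  by move=> j Ub; rewrite -[in LHS](GG b Ub).
- apply/seteqP; split => [_ [b Ub <-]|v Dv].
    by apply: (polG_dom cc cc' oU H1 H2); exact: DP.
  have := polG_dom cc' cc oU H2 H1 Dv; rewrite -imU => -[b Ub Eb].
  by exists b => //=; rewrite Eb; exact: (polG_inv cc' oU H2 H1).
- move=> b Ub; rewrite /= (polG_polar cc oU H1 H2 (DP b Ub) Ub)//; exact: EU.
Qed.

Lemma blowup_cont M B (beta : B -> M) C : is_blowup C beta -> forall b, {for b, continuous beta}.
Proof. by move=> [[+ _] _ _] b; apply. Qed.

Lemma blowup_chart M B (beta : B -> M) C c I p : is_blowup C beta -> C p ->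
  coordinates c -> dom c p -> locally_zero C c I p ->
  exists U P, [/\ open U, U p, U `<=` dom c & polchart beta c I U P].
Proof.
move=> bC Cp cc cp zI; have cb := blowup_cont bC.
have [_ _ /(_ p Cp)[c0 [I0 [P0 [[cc0 c0p _ _] E hP EP SP]]]]] := bC.
have pc0 : polchart beta c0 I0 (dom c0) P0.
  have oc0 := coord_open cc0.
  split; [by split; [exact: oc0|exact: subset_refl]| |by rewrite (homeo_image hP)|exact: EP].
  split; [|by rewrite (homeo_image hP)|exact: SP].
  by apply: open_comp => // b _; exact: cb.
have [|||U [P [ oU Up sU pc]]] := polchart_change (I' := I) cb cc0 cc pc0 c0p cp.
- exact/E.
- by have := nbhs_singleton zI => -[+ _]; apply.
- have N0 : \forall q \near p, dom c0 q by apply: open_near => //; exact: coord_open.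
  apply: near_mono (near_and N0 zI) => q [c0q zq].
  by split => [/(E q c0q).2/zq.1|/zq.2/(E q c0q).1].
- by exists U, P; split => // q /sU[].
Qed.

(** Recentring by the identity matrix turns an arbitrary chart around [p] into the adapted one that
    [is_blowup] asks for. *)
Lemma blowup_intro M B (beta : B -> M) C : closed C -> smooth_on setT beta ->
  diffeo_on (beta @^-1` (~` C)) beta (~` C) ->
  (forall p, C p -> exists c (I : {set 'I_n}) U (P : B -> 'rV[R]_n.+1), [/\ coordinates c, U p,
     forall q, U q -> C q <-> forall i, i \in I -> c q ord0 i = 0 & polchart beta c I U P]) ->
  is_blowup C beta.
Proof.
move=> clC Sb db H; split => // p Cp; have cb b := smooth_on_cont (p := b) Sb.
have [c [I [U [P [cc Up E pc]]]]] := H p Cp.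
have [[ oU sU] _ _ _] := pc; have cp := sU _ Up.
have c0 := (E p Up).1 Cp.
have [|c' [[cc' c'p c'0 _] sc' Ec' c'E]] := adapted_reparam cc cp oU Up (unitmx1 _ _).
  by move=> v j _ _; rewrite mulmx1.
have zc' q : (forall i, i \in I -> c q ord0 i = 0) <-> (forall i, i \in I -> c' q ord0 i = 0).
  split => z i iI; first by rewrite c'E mulmx1 !mxE z// c0// subr0.
  by have := z i iI; rewrite c'E mulmx1 !mxE c0// subr0.
have [||U' [P' [ oU' U'p sU' pc']]] := polchart_change (I' := I) cb cc cc' pc Up c'p c0.
- by move=> i iI; rewrite c'0 mxE.
- by apply: filterE => q; exact: zc'.
(* The chart is already centred; this second use only shrinks it to an adapted chart inside [U']. *)
have [|c2 [ad2 sc2 Ec2 c2E]] := adapted_reparam cc' c'p oU' U'p (unitmx1 _ _).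
  by move=> v j _ _; rewrite mulmx1.
have c2c : c2 = c' :> (_ -> _) by apply/funext => q; rewrite c2E c'0 subr0 mulmx1.
have b2 : bnd c2 = bnd c'.
  by rewrite Ec2; apply/setP => j; rewrite inE c'0 mxE eqxx andbT.
have o2 : open (dom c2) by apply: coord_open; case: ad2.
have [|[_ _] g2 im2 E2] := polchart_sub cb cc' o2 _ pc'; first by move=> q /sc2[].
exists c2, I, P'; split => //.
- move=> q /sc2[_ /sU'[Uq _]]; rewrite c2c; apply: iff_trans (zc' q); exact: E.
- by rewrite b2 c2c -im2; have [] := g2.
- by rewrite c2c.
- by have [_ _] := g2.
Qed.

(** A slightly larger radius leaves the preimage of [C]: the radius is then positive, and a unit
    direction has a nonzero entry. *)
Lemma blowup_dense M B (beta : B -> M) C b O : is_blowup C beta -> open O -> O b ->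
  exists2 b1, O b1 & ~ C (beta b1).
Proof.
move=> bC oO Ob; have [Cb|] := pselect (C (beta b)); last by exists b.
have [_ _ /(_ _ Cb)[c [I [P [[cc cp _ _] E hP EP SP]]]]] := bC.
have [W [ oW Wb HW]] := homeo_nbhs hP cp (open_near oO Ob).
have Db : polar_dom (bnd c) I [set c x | x in dom c] (P b).
  by rewrite -(homeo_image hP); exists b.
have [d d0 Hd] := polar_dom_seg cc (coord_open cc) (@subset_refl _ _) Db.
have cl : {for (0:R), continuous (fun t : R => P b + t *: (delta_mx ord0 ord0 : 'rV[R]_n.+1))}.
  by apply: cont_addrow; [exact: cont_cst|exact: (@scalel_continuous _ _ _)].
have : \forall t \near (0 : R), W (P b + t *: (delta_mx ord0 ord0 : 'rV[R]_n.+1)).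
  by apply: cl; rewrite scale0r addr0; exact: (@open_near 'rV[R]_n.+1).
move=> /(@near_normP R R)[d1 d10 Hd1].
pose t := Num.min d d1 / 2; have m0 : 0 < Num.min d d1 by rewrite lt_min d0.
have t0 : 0 < t by rewrite divr_gt0.
have : t < Num.min d d1 by rewrite ltr_pdivrMr// ltr_pMr// ltr1n.
rewrite lt_min => /andP[td td1].
have := Hd t; rewrite (ltW t0) td => /(_ isT) Dt.
have := Dt; rewrite -(homeo_image hP) => -[b1 cb1 Eb1].
exists b1; first by apply: HW => //; rewrite Eb1; apply: Hd1; rewrite subr0 gtr0_norm.
move=> Cb1; have [b0 S1 _ _] := Db.
have [_ _ /(_ _ Cb)] := bC => _.
have z i : i \in I -> P b ord0 (lift ord0 i) = 0.
  move=> iI; have := (E _ cb1).1 Cb1 i iI; rewrite EP// Eb1 mxE iI addt0 addtl => /eqP.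
  by rewrite mulf_eq0 gt_eqF ?ltr_wpDl//= => /eqP.
by have := oner_neq0 R; rewrite -S1 big1 ?eqxx// => i /z ->; rewrite expr0n.
Qed.

Lemma blowup_inj M B (beta : B -> M) C b b' : is_blowup C beta -> ~ C (beta b) ->
  beta b = beta b' -> b = b'.
Proof.
by move=> [_ db _] Cb E; apply: (d_inj db) => //; rewrite /= -E.
Qed.

(** Off [C] the map [beta'] is injective, so [f] and [g] agree on a dense subset of [O], and the
    target is Hausdorff. *)
Lemma lift_agree M B B' (beta : B -> M) (beta' : B' -> M) C (f g : B -> B') (O : set B) b :
  is_blowup C beta -> is_blowup C beta' -> open O -> O b ->
  {for b, continuous f} -> {for b, continuous g} ->
  (forall x, O x -> beta' (f x) = beta x) -> (forall x, O x -> beta' (g x) = beta x) ->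
  f b = g b.
Proof.
move=> bC bC' oO Ob cf cg Ef Eg; apply: contrapT => fg.
have HB' : hausdorff_space B' by exact: carrier_hausdorff.
rewrite open_hausdorff in HB'.
have [[A A'] /= [/set_mem Af /set_mem A'g] [ oA oA' AA']] := HB' _ _ (introN eqP fg).
have N1 : \forall x \near b, A (f x) by apply: cf; exact: open_near.
have N2 : \forall x \near b, A' (g x) by apply: cg; exact: open_near.
have [ O' [ oO' O'b sO']] := near_open (near_and (open_near oO Ob) (near_and N1 N2)).
have [b1 /sO'[ Ob1 [Afb1 Agb1]] Cb1] := blowup_dense bC oO' O'b.
have E : f b1 = g b1 by apply: (blowup_inj bC'); rewrite Ef ?Eg.
have : (A `&` A') (f b1) by split => //; rewrite E.
by rewrite (eqP AA').
Qed.

End PolarCharts.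

(** * Uniqueness of blow-ups *)

Section Uniqueness.
Context {R : realType} {n : nat}.
Implicit Types (M B : mfd R n).

(** Over [C], points with equal polar coordinates are matched, one chart serving both blow-ups; off
    [C], the lift is the inverse of [beta'] after [beta]. *)
Lemma local_lift M B B' (beta : B -> M) (beta' : B' -> M) C b0 :
  closed C -> is_blowup C beta -> is_blowup C beta' -> submfd C ->
  exists (U : set M) (f : B -> B'), [/\ open U, U (beta b0),
    diffeo_on (beta @^-1` U) f (beta' @^-1` U) &
    forall b, U (beta b) -> beta' (f b) = beta b].
Proof.
move=> clC bC bC' [_ sC]; have cb := blowup_cont bC; have cb' := blowup_cont bC'.
have opre O : open O -> open (beta @^-1` O).
  by move=> oO; apply: open_comp => // b _; exact: cb.
have opre' O : open O -> open (beta' @^-1` O).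
  by move=> oO; apply: open_comp => // b _; exact: cb'.
have [Cb|Cb] := pselect (C (beta b0)).
  have [c [I [cc cp zI]]] := sC _ Cb.
  have [U1 [P1 [ oU1 U1p sU1 pc1]]] := blowup_chart bC Cb cc cp zI.
  have [U2 [P2 [ oU2 U2p sU2 pc2]]] := blowup_chart bC' Cb cc cp zI.
  pose U := U1 `&` U2; have oU : open U by exact: openI.
  have [_ g1 im1 E1] := polchart_sub cb cc oU (@subIsetl _ _ _) pc1.
  have [_ g2 im2 E2] := polchart_sub cb' cc oU (@subIsetr _ _ _) pc2.
  have ex b : U (beta b) -> exists b', U (beta' b') /\ P2 b' = P1 b.
    move=> Ub; have : (P1 @` (beta @^-1` U)) (P1 b) by exists b.
    by rewrite im1 -im2 => -[b' Ub' E]; exists b'.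
  have [b0' _] := ex b0 (conj U1p U2p).
  have Hex b : exists b', U (beta b) -> U (beta' b') /\ P2 b' = P1 b.
    have [/ex[b' H]|nU] := pselect (U (beta b)); first by exists b'.
    by exists b0'.
  have [f Hf] := choice Hex.
  have bf b : U (beta b) -> beta' (f b) = beta b.
    move=> Ub; have [Ufb Ef] := Hf _ Ub.
    apply: (homeo_inj (g_homeo (g_coordinates cc))).
    - by apply: sU1; case: Ufb.
    - by apply: sU1; case: Ub.
    - by rewrite E2// E1// Ef.
  exists U, f; split => //.
  apply: d_crit => //; first exact: opre; first exact: opre'.
  - apply/seteqP; split => [_ [b Ub <-]|b' Ub']; first by have [] := Hf _ Ub.
    have : (P2 @` (beta' @^-1` U)) (P2 b') by exists b'.
    rewrite im2 -im1 => -[b Ub E]; exists b => //.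
    have [Ufb Ef] := Hf _ Ub.
    by apply: (homeo_inj (g_homeo g2)) => //; rewrite Ef.
  - move=> x y Ux Uy E; apply: (homeo_inj (g_homeo g1)) => //.
    by have [_ <-] := Hf _ Ux; have [_ <-] := Hf _ Uy; rewrite E.
  - move=> b Ub; exists (beta' @^-1` U), n.+1, P2; split => //; first by have [] := Hf _ Ub.
    have -> : beta @^-1` U `&` f @^-1` (beta' @^-1` U) = beta @^-1` U.
      by apply/seteqP; split => x /=; [case|move=> Ux; split => //; have [] := Hf _ Ux].
    by apply: g_ext g1 => q Uq; have [_ /= ->] := Hf _ Uq.
have oC : open (~` C) by exact: closed_openC.
have [_ db _] := bC; have [_ db' _] := bC'.
have [im' _ _ _ _] := db'.
have ex p : ~ C p -> exists b', beta' b' = p.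
  by move=> Cp; have : (~` C) p by []; rewrite -im' => -[b' _ <-]; exists b'.
have [b0' _] := ex _ Cb.
have Hex p : exists b', ~ C p -> beta' b' = p.
  have [Cp|/ex[b' H]] := pselect (C p); first by exists b0'.
  by exists b'.
have [g Hg] := choice Hex.
have dg : diffeo_on (~` C) g (beta' @^-1` (~` C)).
  apply: (d_inv (opre' _ oC) db') => x Cx; apply: (blowup_inj bC'); last exact: Hg.
  by rewrite Hg.
exists (~` C), (g \o beta); split => //; first exact: (d_comp (opre _ oC) db dg).
by move=> b /= /Hg.
Qed.

Lemma blowup_unique M B B' (beta : B -> M) (beta' : B' -> M) C :
  submfd C -> is_blowup C beta -> is_blowup C beta' ->
  exists2 F : B -> B', diffeo F & forall b, beta' (F b) = beta b.
Proof.
move=> sC bC bC'; have [clC _] := sC; have cb := blowup_cont bC.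
have /choice[U /choice[f Hf]] := fun b0 : B => local_lift b0 clC bC bC' sC.
(* Gluing without a cover: at [b] the lift centred at [b] is used, and [lift_agree] identifies it
   with the neighbouring ones. *)
pose F b := f b b.
have oU b0 : open (beta @^-1` U b0).
  by apply: open_comp => [b _|]; [exact: cb|have [] := Hf b0].
have FE b0 b : U b0 (beta b) -> F b = f b0 b.
  move=> Ub; have [ oUb Ubb db Eb] := Hf b; have [ oU0 U0b d0 E0] := Hf b0.
  change (f b b = f b0 b); apply: (lift_agree bC bC' (openI (oU b) (oU b0)) (conj Ubb Ub)).
  - exact: d_cont db Ubb.
  - exact: d_cont d0 Ub.
  - by move=> x [/Eb].
  - by move=> x [_ /E0].
have FB b : beta' (F b) = beta b by have [_ Ub _ ->] := Hf b.
exists F => //; apply: d_local; try exact: openT.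
- apply/seteqP; split => // b' _.
  have [V [g [ oV Vb' dg Eg]]] := local_lift b' clC bC' bC sC.
  have [_ Ub _ _] := Hf (g b'); have [_ _ d0 _] := Hf (g b').
  have : (beta' @^-1` U (g b')) b' by move: Ub; rewrite /= Eg.
  have [<- _ _ _ _] := d0; move=> [b Ubb Eb]; exists b => //.
  by rewrite (FE _ _ Ubb).
- move=> x y _ _ Exy; have Ebxy : beta x = beta y by rewrite -FB Exy FB.
  have [_ Ux dx _] := Hf x; apply: (d_inj dx) => //; first by rewrite /= -Ebxy.
  by rewrite -FE// -FE// -Ebxy.
- move=> b _; have [_ Ub db _] := Hf b.
  exists (beta @^-1` U b), (f b), (beta' @^-1` U b); split => // q; exact: FE.
Qed.

(** Polar coordinates around [C1] survive because [b2] is a diffeomorphism away from the preimage of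
    [C2]; charts around [C2] can be lifted because [b1] is one away from [C1]. The case of empty
    [C1] serves to transport blow-ups along diffeomorphisms. *)
Lemma blowup_union M B1 B2 (b1 : B1 -> M) (b2 : B2 -> B1) C1 C2 :
  closed C1 -> submfd C2 -> C1 `&` C2 = set0 ->
  is_blowup C1 b1 -> is_blowup (b1 @^-1` C2) b2 -> is_blowup (C1 `|` C2) (b1 \o b2).
Proof.
move=> cl1 [cl2 s2] disj bl1 bl2.
have cb1 := blowup_cont bl1; have cb2 := blowup_cont bl2.
have [Sb1 d1 loc1] := bl1; have [Sb2 d2 loc2] := bl2.
have opre1 O : open O -> open (b1 @^-1` O).
  by move=> oO; apply: open_comp => // b _; exact: cb1.
have opre2 O : open O -> open (b2 @^-1` O).
  by move=> oO; apply: open_comp => // b _; exact: cb2.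
have o1 : open (~` C1) by exact: closed_openC.
have o2 : open (~` C2) by exact: closed_openC.
have [im1 _ _ _ _] := d1; have [im2 _ _ _ _] := d2.
have o12 : open (~` (C1 `|` C2)) by rewrite setCU; exact: openI.
apply: blowup_intro.
- by apply: closedU.
- exact: smooth_on_comp.
- have s12 : ~` (C1 `|` C2) `<=` ~` C1 by rewrite setCU => ? [].
  have e1 := d_sub (opre1 _ o1) (opre1 _ o12) (preimage_subset s12) d1.
  have s12' : ~` (C1 `|` C2) `<=` ~` C2 by rewrite setCU => ? [].
  have e2 := d_sub (opre2 _ (opre1 _ o2)) (opre2 _ (opre1 _ o12))
    (fun x => s12' _) d2.
  have im2' : b2 @` (b2 @^-1` (b1 @^-1` (~` (C1 `|` C2)))) = b1 @^-1` (~` (C1 `|` C2)).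
    apply/seteqP; split => [_ [x Hx <-]//|y Hy].
    have : (~` (b1 @^-1` C2)) y by exact: s12'.
    by rewrite -im2 => -[x Hx Ex]; exists x => //; rewrite /= Ex.
  have im1' : b1 @` (b1 @^-1` (~` (C1 `|` C2))) = ~` (C1 `|` C2).
    apply/seteqP; split => [_ [x Hx <-]//|y Hy].
    have : (~` C1) y by exact: s12.
    by rewrite -im1 => -[x Hx Ex]; exists x => //; rewrite /= Ex.
  rewrite im2' in e2; rewrite im1' in e1.
  exact: (d_comp (opre2 _ (opre1 _ o12)) e2 e1).
- move=> p [Cp|Cp].
    have [c [I [P [[cc cp _ _] E hP EP SP]]]] := loc1 p Cp.
    have [U [P' [ oU Up sU pc]]] : exists U P', [/\ open U, U p, U `<=` dom c & polchart b1 c I U P'].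
      apply: (blowup_chart bl1 Cp cc cp).
      by apply: near_mono (open_near (coord_open cc) cp) => q /E.
    have C2p : ~ C2 p by move=> C2p; have : (C1 `&` C2) p by []; rewrite disj.
    pose U' := U `&` ~` C2; have oU' : open U' by exact: openI.
    have [_ g1 i1 E1] := polchart_sub cb1 cc oU' (@subIsetl _ _ _) pc.
    exists c, I, U', (P' \o b2); split => //.
      move=> q [Uq C2q]; have := E q (sU _ Uq) => H.
      by split => [[/H//|//]|/H]; left.
    have gg := g_pull d2 (opre2 _ (opre1 _ o2)) g1 (_ : b1 @^-1` U' `<=` _).
    have eqpre : b2 @^-1` (~` (b1 @^-1` C2)) `&` b2 @^-1` (b1 @^-1` U') = (b1 \o b2) @^-1` U'.
      by apply/seteqP; split => x /=; [case|move=> [? ?]; split].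
    split.
    + by split => // q [/sU].
    + by rewrite -eqpre; apply: gg => x [].
    + rewrite -i1; apply/seteqP; split => [_ [x Ux <-]|_ [y Uy <-]]; first by exists (b2 x).
      have : (~` (b1 @^-1` C2)) y by case: Uy.
      by rewrite -im2 => -[x _ Ex]; exists x; rewrite /= ?Ex.
    + by move=> x Ux; rewrite /= E1.
  have C1p : ~ C1 p by move=> C1p; have : (C1 `&` C2) p by []; rewrite disj.
  have [c [I [cc cp zI]]] := s2 _ Cp.
  have [b Cb Eb] : exists2 b, ~ C1 (b1 b) & b1 b = p.
    by have : (~` C1) p by []; rewrite -im1 => -[b Hb Eb]; exists b.
  pose cr := Chart (dom c `&` ~` C1) (bnd c) c.
  have ccr : coordinates cr by exact: chart_restrict.
  have cc1 := chart_pull d1 (opre1 _ o1) ccr (_ : dom cr `<=` _).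
  have {}cc1 := cc1 (@subIsetr _ _ _).
  set c1 := Chart _ _ _ in cc1.
  have z1 : locally_zero (b1 @^-1` C2) c1 I b.
    rewrite -Eb in zI; exact: (cb1 b _ zI).
  have [||U1 [P [ oU1 U1b sU1 pc]]] := blowup_chart bl2 _ cc1 _ z1.
  + by rewrite /= Eb.
  + by split => //; split; rewrite /= ?Eb.
  have [_ g1 i1 E1] := pc.
  have [_ _ _ om1 _] := d1.
  pose U := b1 @` U1.
  have sU1' : U1 `<=` b1 @^-1` (~` C1) by move=> x /sU1[].
  have oU : open U by apply: om1.
  have preU x : U (b1 x) <-> U1 x.
    split => [[y U1y Exy]|U1x]; last by exists x.
    by rewrite -(blowup_inj bl1 _ Exy)//; exact: sU1'.
  have [N [ oN Np sN]] := near_open zI.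
  have Up : U p by exists b.
  pose U' := U `&` N; have oU' : open U' by exact: openI.
  have preU2 : (b1 \o b2) @^-1` U = b2 @^-1` U1.
    by apply/seteqP; split => x /= /preU.
  have pcU : polchart (b1 \o b2) c I U P.
    split.
    + by split => // _ [x /sU1[_ []] ? _ <-].
    + by rewrite preU2.
    + rewrite preU2 i1; congr polar_dom.
      by apply/seteqP; split => [_ [x Ux <-]|_ [_ [x Ux <-] <-]]; [exists (b1 x) => //; exists x|exists x].
    + by move=> x /preU/E1.
  exists c, I, U', P; split => //.
    move=> q [[x U1x <-] Nq]; have HN := sN _ Nq; have H1 := sU1' _ U1x.
    by split; [move=> [/H1//|/HN]|move=> /HN; right].
  apply: polchart_sub pcU => //; last exact: subIsetl.
  by move=> x; apply: continuous_comp; [exact: cb2|exact: cb1].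
Qed.

End Uniqueness.

(** * Faces *)

Section TopologyTools.
Context {R : realType}.

Lemma second_countable_initial (S T : topologicalType) (f : S -> T) :
  continuous f -> (forall x O, open O -> O x -> exists W : set T,
    [/\ open W, W (f x) & f @^-1` W `<=` O]) ->
  @second_countable T -> @second_countable S.
Proof.
move=> cf fO [B cB [ oB nB]]; exists [set f @^-1` X | X in B].
  exact: sub_countable (card_image_le _ _) cB.
split=> [_ [X BX <-]|x O].
  by apply: open_comp => [y _|]; [exact: cf|exact: oB].
rewrite nbhsE => -[ O' [ oO' O'x] O'O].
have [W [ oW Wx WO]] := fO _ _ oO' O'x.
have [X [BX Xx] XW] := nB (f x) W (open_nbhs_nbhs (conj oW Wx)).
exists (f @^-1` X); first by split=> //; exists X.
by move=> y Xy; apply/O'O/WO/XW.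
Qed.

Lemma second_countable_prod (S T : topologicalType) :
  @second_countable S -> @second_countable T -> @second_countable (S * T)%type.
Proof.
move=> [B cB [ oB nB]] [B' cB' [ oB' nB']].
exists [set X.1 `*` X.2 | X in B `*` B'].
  by apply: sub_countable (card_image_le _ _) _; exact: countableX.
split=> [_ [[X Y] [BX BY] <-]|[x y] O [[X Y]] /= [Xx Yy] XYO].
  rewrite openE => -[x y] [Xx Yy]; exists (X, Y) => //.
  by split; apply: open_nbhs_nbhs; split=> //; [exact: oB|exact: oB'].
have [X' [BX' X'x] X'X] := nB _ _ Xx; have [Y' [BY' Y'y] Y'Y] := nB' _ _ Yy.
exists (X' `*` Y'); first by split=> //; exists (X', Y').
by move=> [u v] [/= X'u Y'v]; apply: XYO; split; [exact: X'X|exact: Y'Y].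
Qed.

Lemma second_countable_rV n : @second_countable 'rV[R]_n.
Proof.
pose box (z : nat * {ffun 'I_n -> rat}) : set 'rV[R]_n :=
  [set v | forall i, `|v ord0 i - ratr (z.2 i)| < z.1.+1%:R^-1].
exists (range box); first exact: sub_countable (card_image_le _ _) (countableP _).
split=> [_ [z _ <-]|v O].
  rewrite (_ : box z = \bigcap_(i in [set: 'I_n])
     [set v : 'rV[R]_n | `|v ord0 i - ratr (z.2 i)| < z.1.+1%:R^-1]); last first.
    by apply/seteqP; split=> [v bv i _|v bv i]; apply: bv.
  have -> : forall F : 'I_n -> set 'rV[R]_n, (\bigcap_(i in [set: 'I_n]) F i) =
     [set v | forall i, F i v].
    by move=> F; apply/seteqP; split=> [w Fw i|w Fw i _]; apply: Fw.
  apply: bigcap_open => i.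
  rewrite openE => v vi; apply: (@open_ltf R _ (fun w : 'rV[R]_n => `|w ord0 i - ratr (z.2 i)|) (fun=> z.1.+1%:R^-1)) => //; last exact: cont_cst.
  have c : {for v, continuous (fun w : 'rV[R]_n => w ord0 i + - ratr (z.2 i))}.
    by apply: contD; [exact: cont_coord (@cont_id _ _)|exact: cont_cst].
  exact: cvg_norm c.
move=> /near_normP[d d0 dO].
have [k kd] : exists k : nat, k.+1%:R^-1 < d / 2.
  have d20 : 0 < d / 2 by rewrite divr_gt0.
  have [k _ kd] := near_infty_natSinv_lt (PosNum d20).
  by exists k; apply: kd => /=.
have H i : exists r : rat, `|v ord0 i - ratr r| < k.+1%:R^-1.
  have k0 : 0 < k.+1%:R^-1 :> R by rewrite invr_gt0.
  have [r] : exists r, ratr r \in `](v ord0 i - k.+1%:R^-1), (v ord0 i + k.+1%:R^-1)[.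
    apply: rat_in_itvoo; move: k0; set z := _^-1 => z0.
    by apply: (lt_trans (y := v ord0 i)); rewrite ?ltrDl // ltrBlDr ltrDl.
  by rewrite in_itv /= => /andP[r1 r2]; exists r; rewrite distrC ltr_distl r1 r2.
have [f Hf] := choice H.
exists (box (k, [ffun i => f i])).
  split; first by exists (k, [ffun i => f i]).
  by move=> i /=; rewrite ffunE; apply: Hf.
move=> w wb; apply: dO; apply: norm_row_lt => // i; rewrite !mxE.
move: (wb i) (Hf i); rewrite /= ffunE => w1 w2.
have -> : w ord0 i - v ord0 i = (w ord0 i - ratr (f i)) - (v ord0 i - ratr (f i)) by ring.
apply: le_lt_trans (ler_normB _ _) _; apply: (lt_trans (ltrD w1 w2)).
by rewrite [ltRHS]splitr; apply: ltrD.
Qed.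

(** Urysohn's lemma. Continuity of the cut-off is enough: the polar coordinates of the blow-up
    divide it out again. *)
Lemma bump (T : topologicalType) (p : T) (O : set T) :
  hausdorff_space T -> compact [set: T] -> open O -> O p ->
  exists chi : T -> R, [/\ forall q, {for q, continuous chi}, forall q, 0 <= chi q <= 1,
    chi p = 1 & forall q, ~ O q -> chi q = 0].
Proof.
move=> hT cT oO Op.
have := (@normal_separatorP R T).1 (compact_normal hT cT) (~` O) [set p].
have c1 : closed [set p] by apply: accessible_closed_set1; exact: hausdorff_accessible.
have c2 : closed (~` O) by rewrite closedC.
move=> /(_ c2 c1); case.
  by apply/disjoints_subset => q nO qp; apply: nO; rewrite qp.
move=> uT sep; have /(@uniform_separatorP _ R)[chi [cchi r0 a b]] :
  uniform_separator (~` O) [set p] by exists uT.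
exists chi; split=> [q|q||q nO].
- exact: cchi.
- by have := r0 (chi q) (ex_intro2 _ _ q I erefl); rewrite /= in_itv.
- by apply: b; exists p.
- by apply: a; exists q.
Qed.

Lemma compact_cover_seq (T : topologicalType) (K : set T) (U : T -> set T) :
  compact K -> (forall p, K p -> open (U p) /\ U p p) ->
  exists s : seq T, (forall p, p \in s -> K p) /\
    forall q, K q -> exists2 p, p \in s & U p q.
Proof.
move=> /compact_near_coveringP cK HU.
(* Sequences in [K], eventually containing any given one: the near-covering form of compactness
   turns local coverage into a single sequence for all of [K]. *)
pose F := filter_from [set s : seq T | forall p, p \in s -> K p]
  (fun s0 => [set s : seq T | (forall p, p \in s -> K p) /\ {subset s0 <= s}]).
have FF : Filter F.
  apply: filter_from_filter; first by exists [::].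
  move=> s s' Ks Ks'; exists (s ++ s') => [p|t [Kt st]].
    by rewrite mem_cat => /orP[/Ks|/Ks'].
  by split; split=> // p ps; apply: st; rewrite mem_cat ps ?orbT.
have [|s0 Ks0 /(_ s0)] := cK _ F (fun s q => exists2 p, p \in s & U p q) FF.
  move=> p Kp; have [ oU Up] := HU _ Kp.
  exists (U p, [set s : seq T | p \in s]).
    split; first exact: open_nbhs_nbhs.
    exists [:: p]; first by move=> q; rewrite inE => /eqP->.
    by move=> s [_ ss]; apply: ss; rewrite inE.
  by move=> [q s] [/= Uq ps]; exists p.
by move=> H; exists s0; split=> // q; apply: H; split.
Qed.

Lemma homeo_connected (T U : topologicalType) (A V : set T) (f : T -> U) (S : set U) :
  homeo_onto A f S -> V `<=` A -> connected (f @` V) -> connected V.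
Proof.
move=> hf VA cV B B0 [ O oO BO] [Z cZ BZ].
have BV : B `<=` V by rewrite BO => q [].
have [W oW HW] := homeo_push hf oO.
have [W' oW' HW'] := homeo_push hf (closed_openC cZ).
suff E : f @` B = f @` V.
  apply/seteqP; split=> // q Vq.
  have [q' Bq' fq] : (f @` B) (f q) by rewrite E; exists q.
  by rewrite -(homeo_inj hf (VA _ (BV _ Bq')) (VA _ Vq) fq).
apply: cV.
- by have [q Bq] := B0; exists (f q), q.
- exists W => //; apply/seteqP; split=> [_ [q Bq <-]|_ [[q Vq <-] Wq]].
    split; first by exists q => //; exact: BV.
    by apply/HW; [exact/VA/BV|move: Bq; rewrite BO => -[]].
  by exists q => //; rewrite BO; split=> //; apply/HW => //; exact: VA.
- exists (~` W'); first by rewrite closedC.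
  apply/seteqP; split=> [_ [q Bq <-]|_ [[q Vq <-] Wq]].
    split; first by exists q => //; exact: BV.
    move=> /(HW' _ (VA _ (BV _ Bq))) nZ; apply: nZ.
    by move: Bq; rewrite BZ => -[].
  exists q => //; rewrite BZ; split=> //; apply: contrapT => nZ.
  by apply: Wq; apply/HW' => //; exact: VA.
Qed.

Lemma connected_segment n (v w : 'rV[R]_n) :
  connected [set v + t *: w | t in [set t : R | 0 <= t <= 1]].
Proof.
apply: connected_continuous_connected.
  have -> : [set t : R | 0 <= t <= 1] = `[0, 1]%classic.
    by apply/seteqP; split=> t; rewrite /= in_itv.
  exact: segment_connected.
apply: continuous_subspaceT => t.
have cv : {for t, continuous (fun _ : R => v)} by exact: cont_cst.
apply: (cont_addrow cv).
have -> : *:%R^~ w = fun x : R => \row_i (x * w ord0 i).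
  by apply/funext => x; apply/rowP => i; rewrite !mxE.
have cw i : {for t, continuous (fun x : R => x * w ord0 i)}.
  by apply: contM; [exact: cont_id|exact: cont_cst].
exact: cont_row cw.
Qed.

End TopologyTools.

Section Faces.
Context {R : realType} {n : nat}.
Implicit Types (M : premfd R n).

Lemma codim1P M (c : chart R n M) p : coordinates c -> dom c p ->
  codim1_boundary p <-> #|[set j in bnd c | c p ord0 j == 0]%SET| = 1%N.
Proof.
move=> cc cp; split=> [[c0 [cc0 c0p c00 _] n1]|n1].
  apply: etrans (corner_codim cc0 cc c0p cp) _; apply: etrans n1; apply: eq_card => j.
  by rewrite !inE c00 mxE eqxx andbT.
have [||c' [ac' _ b' _]] := @adapted_reparam _ _ _ c p setT 1%:M cc cp openT I.
- exact: unitmx1.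
- by move=> v j _ _; rewrite mulmx1.
by exists c' => //; rewrite b'.
Qed.

Lemma codim1_face M (c : chart R n M) p j : coordinates c -> dom c p ->
  j \in bnd c -> c p ord0 j = 0 ->
  codim1_boundary p <-> forall l, l \in bnd c -> l != j -> 0 < c p ord0 l.
Proof.
move=> cc cp jb cj; rewrite (codim1P cc cp); split=> [/eqP/cards1P[k E] l lb lj|H].
  rewrite lt_neqAle eq_sym coord_orthant // andbT; apply/eqP => cl.
  have : l \in [set k]%SET by rewrite -E inE lb cl eqxx.
  have : j \in [set k]%SET by rewrite -E inE jb cj eqxx.
  by rewrite !inE => /eqP <-; apply/negP.
apply/eqP/cards1P; exists j; apply/setP => l; rewrite !inE.
have [->|lj] := eqVneq l j; first by rewrite jb cj eqxx.
by apply/negbTE/negP => /andP[lb]; rewrite gt_eqF ?H.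
Qed.

(** In adapted coordinates the face is convex, and a segment between two of its codimension one
    points keeps the other boundary coordinates positive. *)
Lemma face_connected M (c : chart R n M) q j x z : adapted q c -> j \in bnd c ->
  dom c x -> dom c z -> codim1_boundary x -> codim1_boundary z ->
  c x ord0 j = 0 -> c z ord0 j = 0 -> connected_component (@codim1_boundary R n M) x z.
Proof.
move=> [cc _ _ [e e0 E]] jb cx cz dx dz xj zj.
pose S := [set u | dom c u /\ exists2 t : R, 0 <= t <= 1 & c u = c x + t *: (c z - c x)].
have conv t i : 0 <= t <= 1 -> (c x + t *: (c z - c x)) ord0 i =
    (1 - t) * c x ord0 i + t * c z ord0 i by move=> _; rewrite !mxE; ring.
have bx u : dom c u -> forall i, `|c u ord0 i| < e.
  by move=> cu; have : (c @` dom c) (c u) by [exists u]; rewrite E => -[].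
have cS : connected S.
  apply: (homeo_connected (g_homeo (g_coordinates cc))); first by move=> u [].
  rewrite (_ : c @` S = [set c x + t *: (c z - c x) | t in [set t : R | 0 <= t <= 1]]).
    exact: connected_segment.
  apply/seteqP; split=> [_ [u [cu [t t01 tE]] <-]|_ [t t01 <-]]; first by exists t.
  have : (c @` dom c) (c x + t *: (c z - c x)).
    rewrite E; split=> [i ib|i]; rewrite conv //.
      have /(_ i ib) := coord_orthant cc cx; have /(_ i ib) := coord_orthant cc cz.
      by move=> z0 x0; move: t01 => /= t01; rewrite addr_ge0 ?mulr_ge0 //; lra.
    move: (bx _ cx i) (bx _ cz i); rewrite !ltr_norml => xb zb; move: t01 => /= /andP[t0 t1].
    have [->|tn0] := eqVneq t 0; first by rewrite subr0 mul1r mul0r addr0.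
    have tp : 0 < t by rewrite lt_neqAle eq_sym tn0.
    by nra.
  by move=> [u cu uE]; exists u => //; split=> //; exists t.
have xS : S x by split=> //; exists 0; rewrite ?lexx ?ler01 // scale0r addr0.
have zS : S z by split=> //; exists 1; rewrite ?lexx ?ler01 // scale1r addrC subrK.
apply: (connected_component_max xS _ cS) zS => u [cu [t t01 uE]].
have uj : c u ord0 j = 0 by rewrite uE conv // xj zj !mulr0 addr0.
apply/(codim1_face cc cu jb uj) => l lb lj; rewrite uE conv //.
have x0 := (codim1_face cc cx jb xj).1 dx l lb lj.
have z0 := (codim1_face cc cz jb zj).1 dz l lb lj.
have [->|tn0] := eqVneq t 0; first by rewrite subr0 mul1r mul0r addr0.
have tp : 0 < t by rewrite lt_neqAle eq_sym tn0; case/andP: t01.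
by apply: ltr_wpDl; [apply: mulr_ge0; [case/andP: t01; lra|exact: ltW]|exact: mulr_gt0].
Qed.

(** A slight increase of the other boundary coordinates turns a point of the face into a codimension
    one point of it. *)
Lemma face_closure M (c : chart R n M) q j x z : adapted q c -> j \in bnd c ->
  dom c x -> dom c z -> codim1_boundary x -> c x ord0 j = 0 -> c z ord0 j = 0 ->
  closure (connected_component (@codim1_boundary R n M) x) z.
Proof.
move=> ac jb cx cz dx xj zj; have [cc _ _ _] := ac.
move=> B /near_open[ O [ oO Oz OB]].
have [e e0 He] := coord_near_image cc cz oO Oz.
pose v := c z + \row_l (if (l \in bnd c) && (l != j) then e / 2 else 0).
have [l lb||q' [cq' Oq' q'E]] := He v.
- rewrite /v !mxE; have z0 := coord_orthant cc cz lb.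
  by case: ifP; rewrite ?addr0 // addr_ge0 // divr_ge0 // ltW.
- rewrite /v addrC addKr; apply: norm_row_lt => // i; rewrite mxE.
  by case: ifP => _; rewrite ?normr0 // gtr0_norm; lra.
have q'j : c q' ord0 j = 0 by rewrite q'E /v !mxE eqxx andbF addr0.
have dq' : codim1_boundary q'.
  apply/(codim1_face cc cq' jb q'j) => l lb lj; rewrite q'E /v !mxE lb lj /=.
  have z0 := coord_orthant cc cz lb; lra.
by exists q'; split; [exact: (face_connected ac jb)|exact: OB].
Qed.

(** Embeddedness seen inside one chart: different faces belong to different hypersurfaces. The
    formulation with connected sets in place of components is easy to carry along the blow-down
    map. *)
Definition splits_faces M (c : chart R n M) :=
  forall (A : set M) j l x y, connected A -> A `<=` @codim1_boundary R n M ->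
  j \in bnd c -> l \in bnd c -> j != l -> A x -> A y -> dom c x -> dom c y ->
  c x ord0 j = 0 -> c y ord0 l = 0 -> False.

Lemma psub_hypersurface M (H : set M) :
  (forall q : M, exists2 c, adapted q c & splits_faces c) ->
  boundary_hypersurface H -> psub n.-1 H.
Proof.
move=> sp [p dp HE]; set Z := connected_component _ p in HE.
have cZ : connected Z by exact: component_connected.
have cH : connected H by rewrite HE; apply: connected_closure.
have Zd : Z `<=` @codim1_boundary R n M by exact: connected_component_sub.
split.
- by rewrite HE; exact: closed_closure.
- apply: (@sub_finite_set _ _ [set H]); last exact: finite_set1.
  by move=> _ [q Hq <-]; apply/seteqP; split; [exact: connected_component_sub|
    exact: connected_component_max].
move=> q Hq; have [c ac sc] := sp q; have [cc cq cq0 _] := ac.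
have [x [Zx cx]] : exists x, Z x /\ dom c x.
  have := Hq; rewrite HE => /(_ (dom c)); apply.
  by apply: open_nbhs_nbhs; split=> //; exact: coord_open.
have [j E] : exists j, [set j in bnd c | c x ord0 j == 0]%SET = [set j]%SET.
  by apply/cards1P/eqP/(codim1P cc cx)/Zd.
have : j \in [set j]%SET by rewrite inE.
rewrite -{1}E inE => /andP[jb /eqP xj].
exists c, [set j]%SET; split=> //.
  by rewrite cardsC1 card_ord.
move=> z cz; split=> [Hz i|zj].
  rewrite inE => /eqP ->; apply/eqP/negPn/negP => zj.
  have zp : 0 < c z ord0 j by rewrite lt_neqAle eq_sym zj coord_orthant.
  have c0 : {for z, continuous (fun _ : M => 0 : R)} by exact: cont_cst.
  have cj : {for z, continuous (fun y => c y ord0 j)}.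
    exact: cont_coord (g_cont (g_coordinates cc) cz).
  have near_z : \forall y \near z, 0 < c y ord0 j /\ dom c y.
    apply: (near_and (open_ltf c0 cj zp)).
    by apply: open_nbhs_nbhs; split=> //; exact: coord_open.
  have [y [Zy [yj cy]]] : exists y, Z y /\ (0 < c y ord0 j /\ dom c y).
    by move: Hz; rewrite HE => /(_ _ near_z).
  have [l El] : exists l, [set j in bnd c | c y ord0 j == 0]%SET = [set l]%SET.
    by apply/cards1P/eqP/(codim1P cc cy)/Zd.
  have : l \in [set l]%SET by rewrite inE.
  rewrite -{1}El inE => /andP[lb /eqP yl].
  apply: (sc Z j l x y) => //; apply/eqP => jl.
  by move: yj; rewrite jl yl ltxx.
rewrite HE; have -> : Z = connected_component (@codim1_boundary R n M) x.
  exact/same_connected_component.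
by apply: (face_closure ac jb) => //; [exact: Zd|apply: zj; rewrite inE].
Qed.

(** Otherwise one boundary hypersurface would contain both faces near [q], and its tangent space,
    which lies in a hyperplane, would contain two cones that together contain every basis vector. *)
Lemma mfd_splits_faces (M : mfd R n) q (c : chart R n M) : adapted q c -> splits_faces c.
Proof.
move=> ac A j l x y cA Ad jb lb jl Ax Ay cx cy xj yl.
have [cc cq cq0 _] := ac.
set Z := connected_component (@codim1_boundary R n M) x.
have ZE : Z = connected_component (@codim1_boundary R n M) y.
  by apply: same_connected_component; apply: (connected_component_max Ax).
have Hj z : dom c z -> c z ord0 j = 0 -> closure Z z.
  by move=> cz zj; apply: (face_closure ac jb) => //; exact: Ad.
have Hl z : dom c z -> c z ord0 l = 0 -> closure Z z.
  by move=> cz zj; rewrite ZE; apply: (face_closure ac lb) => //; exact: Ad.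
have Hq : closure Z q by apply: Hj; rewrite // cq0 mxE.
have [|_ _ /(_ _ Hq)[c' [I [[cc' c'q c'q0 _] nI IE]]]] := @mfd_embedded _ _ M (closure Z).
  by exists x => //; exact: Ad.
have n0 : (0 < n)%N by rewrite (leq_ltn_trans _ (ltn_ord j)).
have [i iI] : exists i, i \in I.
  apply/set0Pn/negP => /eqP I0; move: nI; rewrite I0 finset.setC0 cardsT card_ord.
  by move=> nE; move: n0; rewrite -ltn_predL -nE ltnn.
have [J [J' [JJ' HJ _]]] := jacobian_inv cc cc' cq c'q.
have J'J : J' *m J = 1%:M by exact: mulmx1C.
(* J maps every vector into the hyperplane w_i = 0, which contains the tangent
   cones of both faces. *)
have tangent k (w : 'rV[R]_n) : k = j \/ k = l -> (forall a, 0 <= w ord0 a) -> w ord0 k = 0 ->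
    (w *m J) ord0 i = 0.
  move=> kjl w0 wk; apply/eqP; rewrite -normr_le0; apply/ler_addgt0Pl => e e0.
  have iw : inward c q w by move=> a _ _; exact: w0.
  have [q' [s [c'q' cq' q'E s0 le]]] := velocity cc cq iw HJ e0
    (open_nbhs_nbhs (conj (coord_open cc') c'q)).
  have zk : c q' ord0 k = 0 by rewrite q'E cq0 add0r mxE wk mulr0.
  have Hq' : closure Z q' by case: kjl zk => ->; [exact: Hj|exact: Hl].
  have c'i := (IE _ c'q').1 Hq' _ iI.
  have := le_trans (norm_coord_le _ i) le.
  rewrite c'q0 subr0 addr0; suff -> : (s^-1 *: c' q' - w *m J) ord0 i = - (w *m J) ord0 i.
    by rewrite normrN.
  by rewrite !mxE c'i mulr0 sub0r.
have col k : J k i = 0.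
  have de a b : 0 <= (delta_mx ord0 a : 'rV[R]_n) ord0 b by rewrite mxE ler0n.
  have dk (b : 'I_n) : b != k -> (delta_mx ord0 k : 'rV[R]_n) ord0 b = 0.
    by move=> bk; rewrite mxE eqxx (negbTE bk).
  have <- : ((delta_mx ord0 k : 'rV[R]_n) *m J) ord0 i = J k i.
    by rewrite -rowE mxE.
  have [kj|jk] := eqVneq j k.
    by apply: (tangent l) => //; [right|apply: dk; rewrite -kj eq_sym].
  by apply: (tangent j) => //; [left|exact: dk].
have := congr1 (fun A : 'M[R]_n => A i i) J'J; rewrite !mxE eqxx big1 => [/esym/eqP|k _].
  by rewrite oner_eq0.
by rewrite col mulr0.
Qed.

End Faces.

(** * Existence of blow-ups *)

Section GeneratedManifold.
Context {R : realType} {n : nat} (T : topologicalType).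
Variable gen : set T -> forall m, (T -> 'rV[R]_m) -> Prop.
Hypothesis gen_open : forall O m (P : T -> 'rV[R]_m), gen O P -> open O.
Hypothesis gen_homeo : forall O m (P : T -> 'rV[R]_m), gen O P -> homeo_onto O P (P @` O).
Hypothesis gen_compat : forall O O' m m' (P : T -> 'rV[R]_m) (P' : T -> 'rV[R]_m'),
  gen O P -> gen O' P' -> smooth_of (O `&` O') P P'.
Hypothesis gen_chart : forall b, exists O m (P : T -> 'rV[R]_m) (e : chart R n T),
  [/\ gen O P, corner_chart e /\ dom e b, dom e `<=` O, smooth_of (dom e) e P &
      smooth_of (dom e) P e].
Hypothesis hausT : hausdorff_space T.
Hypothesis scT : @second_countable T.

(** All corner charts compatible with every generator. Generators need not be charts, so that polar
    coordinate maps into dimension n + 1 can be among them and become generalized coordinates of the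
    resulting manifold. *)
Definition gen_atlas : set (chart R n T) := [set e | corner_chart e /\
  forall O m (P : T -> 'rV[R]_m), gen O P ->
    smooth_of (O `&` dom e) e P /\ smooth_of (O `&` dom e) P e].

Lemma gen_atlas_corner e : gen_atlas e -> corner_chart e.
Proof. by case. Qed.

Lemma gen_atlas_intro O m (P : T -> 'rV[R]_m) (e : chart R n T) : gen O P ->
  corner_chart e -> dom e `<=` O -> smooth_of (dom e) e P -> smooth_of (dom e) P e ->
  gen_atlas e.
Proof.
move=> gP ce eO sP sP'; split=> // O' m' P' gP'; split.
  apply: (@so_comp _ _ _ _ _ _ _ P); first by apply: so_sub sP => q [].
  by apply: so_sub (gen_compat gP gP') => q [ O'q eq]; split=> //; exact: eO.
apply: (@so_comp _ _ _ _ _ _ _ P); last by apply: so_sub sP' => q [].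
by apply: so_sub (gen_compat gP' gP) => q [ O'q eq]; split=> //; exact: eO.
Qed.

Lemma gen_atlas_cover b : exists2 e, gen_atlas e & dom e b.
Proof.
have [ O [m [P [e [gP [ce eb] eO s s']]]]] := gen_chart b.
by exists e => //; exact: gen_atlas_intro gP ce eO s s'.
Qed.

Lemma gen_atlas_smooth e e' : gen_atlas e -> gen_atlas e' ->
  smooth_of (dom e `&` dom e') e e'.
Proof.
move=> [[ oe [V oV he]] ge] [_ ge']; apply: so_local => b [eb e'b].
have [ O [m [P [f [gP [_ fb] fO _ _]]]]] := gen_chart b.
have [W oW HW] := homeo_push he (gen_open gP).
exists W; split=> //; first by apply/(HW _ eb); exact: fO.
apply: (@so_comp _ _ _ _ _ _ _ P).
  apply: so_sub (ge _ _ _ gP).1 => q [[eq e'q] Wq].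
  by split=> //; apply/(HW _ eq).
apply: so_sub (ge' _ _ _ gP).2 => q [[eq e'q] Wq].
by split=> //; apply/(HW _ eq).
Qed.

Lemma gen_atlas_compatible e e' : gen_atlas e -> gen_atlas e' -> compatible e e'.
Proof.
move=> ae ae'; split; first exact: gen_atlas_smooth.
by rewrite setIC; exact: gen_atlas_smooth.
Qed.

Definition gen_premfd : premfd R n := @PreMfd R n T gen_atlas
  gen_atlas_corner gen_atlas_cover gen_atlas_compatible hausT scT.

Lemma gen_gcoord O m (P : T -> 'rV[R]_m) : gen O P -> @gcoord R n gen_premfd O m P.
Proof.
move=> gP; split; [exact: gen_open gP|exact: gen_homeo|].
by move=> d [_ /(_ _ _ _ gP)[s s']]; split.
Qed.

End GeneratedManifold.

Lemma near_all (T : topologicalType) (P : T -> Prop) (x : T) :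
  (forall y, P y) -> \forall y \near x, P y.
Proof. by move=> H; exact: nearW. Qed.

Lemma hausdorff_separate (T : topologicalType) (x y : T) : hausdorff_space T -> x <> y ->
  exists X Y : set T, [/\ nbhs x X, nbhs y Y & forall z, X z -> Y z -> False].
Proof.
move=> hT xy; apply: contrapT => H; apply: xy; apply: hT => A B nA nB.
by apply: contrapT => AB; apply: H; exists A, B; split=> // z Az Bz; apply: AB; exists z.
Qed.

Lemma smooth_if {R : realType} m (W : set 'rV[R]_m) (b : bool) (f g : 'rV[R]_m -> R) :
  smooth W f -> smooth W g -> smooth W (fun v => if b then f v else g v).
Proof. by case: b. Qed.

Lemma smooth_sq {R : realType} m (W : set 'rV[R]_m) i :
  open W -> smooth W (fun v => v ord0 i ^+ 2).
Proof.
move=> oW; rewrite (_ : (fun v => _) = fun v : 'rV[R]_m => v ord0 i * v ord0 i) //.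
by apply: smoothM => //; exact: smooth_coord.
Qed.

Lemma polarE {R : realType} n (I : {set 'I_n}) (v : 'rV[R]_n.+1) i : polar I v ord0 i =
  if i \in I then v ord0 ord0 * v ord0 (lift ord0 i) else v ord0 (lift ord0 i).
Proof. by rewrite mxE. Qed.

Lemma subrowE {R : realType} n (u v : 'rV[R]_n) i : (u - v) ord0 i = u ord0 i - v ord0 i.
Proof. by rewrite !mxE. Qed.

Lemma connected_clopen (T : topologicalType) (A F : set T) x : connected A -> closed F ->
  (forall y, A y -> F y -> \forall z \near y, A z -> F z) -> A x -> F x -> A `<=` F.
Proof.
move=> cA cF HF Ax Fx; pose G := [set y : T | \forall z \near y, A z -> F z].
suff <- : A `&` F = A by move=> y [].
apply: cA; [by exists x| |by exists F].
exists G^°%classic; first exact: open_interior.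
apply/seteqP; split=> y [Ay H]; split=> //; first by apply: nbhs_interior; exact: HF.
by have /interior_subset/nbhs_singleton := H; apply.
Qed.

Lemma polar_uniq {R : realType} n (I : {set 'I_n}) (v w : 'rV[R]_n.+1) :
  0 <= v ord0 ord0 -> 0 <= w ord0 ord0 ->
  \sum_(i in I) v ord0 (lift ord0 i) ^+ 2 = 1 ->
  \sum_(i in I) w ord0 (lift ord0 i) ^+ 2 = 1 ->
  polar I v = polar I w -> ~ (forall i, i \in I -> polar I v ord0 i = 0) -> v = w.
Proof.
move=> v0 w0 v1 w1 E nz.
have sq (u : 'rV[R]_n.+1) : \sum_(i in I) u ord0 (lift ord0 i) ^+ 2 = 1 ->
    \sum_(i in I) polar I u ord0 i ^+ 2 = u ord0 ord0 ^+ 2.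
  move=> u1; rewrite -[RHS]mulr1 -u1 mulr_sumr; apply: eq_bigr => i iI.
  by rewrite mxE iI exprMn.
have e0 : v ord0 ord0 = w ord0 ord0.
  by apply/eqP; rewrite -(eqrXn2 (n := 2)) // -!sq // E.
have vn0 : v ord0 ord0 != 0.
  by apply/eqP => v00; apply: nz => i iI; rewrite mxE iI v00 mul0r.
apply/rowP => j; case: (unliftP ord0 j) => [i|] -> //.
move/rowP: E => /(_ i); rewrite !mxE -e0; case: ifP => // _.
exact: mulfI.
Qed.

(* On the part of the front face where s * omega_k > 0 (s a sign) the coordinates are
   rho * |omega_k| and the quotients omega_i / |omega_k|. *)
Section DirectionCoordinates.
Context {R : realType} {n : nat} (J : {set 'I_n}) (k : 'I_n) (s : R).
Hypothesis kJ : k \in J.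
Hypothesis ss : s * s = 1.
Implicit Types (u : 'rV[R]_n) (w : 'rV[R]_n.+1).

Definition dirmap w : 'rV[R]_n := \row_i
  if i == k then w ord0 ord0 * (s * w ord0 (lift ord0 k))
  else if i \in J then w ord0 (lift ord0 i) / (s * w ord0 (lift ord0 k))
  else w ord0 (lift ord0 i).

Lemma dirmapE w i : dirmap w ord0 i =
  if i == k then w ord0 ord0 * (s * w ord0 (lift ord0 k))
  else if i \in J then w ord0 (lift ord0 i) / (s * w ord0 (lift ord0 k))
  else w ord0 (lift ord0 i).
Proof. by rewrite mxE. Qed.

(** The inverse of [|omega_k|]: since omega has length 1, the squares of the quotients
    [omega_i / |omega_k|] with [i] other than [k], together with 1, add up to its square. *)
Definition dirnorm u : R := Num.sqrt (1 + \sum_(i in J :\ k) u ord0 i ^+ 2).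

Definition dirinv u : 'rV[R]_n.+1 := \row_j
  if unlift ord0 j is Some i then
    (if i == k then s / dirnorm u else if i \in J then u ord0 i / dirnorm u else u ord0 i)
  else u ord0 k * dirnorm u.

Lemma dirsum_gt0 u : 0 < 1 + \sum_(i in J :\ k) u ord0 i ^+ 2.
Proof. by rewrite ltr_pwDl // sumr_ge0 // => i _; rewrite sqr_ge0. Qed.

Lemma dirnorm_gt0 u : 0 < dirnorm u.
Proof. by rewrite sqrtr_gt0 dirsum_gt0. Qed.

Lemma dirnorm_sq u : dirnorm u ^+ 2 = 1 + \sum_(i in J :\ k) u ord0 i ^+ 2.
Proof. by rewrite sqr_sqrtr // ltW // dirsum_gt0. Qed.

Lemma dirinv0 u : dirinv u ord0 ord0 = u ord0 k * dirnorm u.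
Proof. by rewrite mxE unlift_none. Qed.

Lemma dirinvl u i : dirinv u ord0 (lift ord0 i) =
  if i == k then s / dirnorm u else if i \in J then u ord0 i / dirnorm u else u ord0 i.
Proof. by rewrite mxE liftK. Qed.

Lemma dirinv_k u : s * dirinv u ord0 (lift ord0 k) = (dirnorm u)^-1.
Proof. by rewrite dirinvl eqxx mulrA ss mul1r. Qed.

Lemma dirinv_unit u : \sum_(i in J) dirinv u ord0 (lift ord0 i) ^+ 2 = 1.
Proof.
have q0 := dirnorm_gt0 u; rewrite (big_setD1 k) //= dirinvl eqxx.
rewrite (eq_bigr (fun i => u ord0 i ^+ 2 / dirnorm u ^+ 2)) => [|i]; last first.
  by rewrite !inE dirinvl => /andP[/negbTE -> ->]; rewrite expr_div_n.
rewrite -mulr_suml expr_div_n -mulrDl [s ^+ 2]expr2 ss -dirnorm_sq mulfV //.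
by rewrite expf_neq0 // gt_eqF.
Qed.

Lemma dirmapK u : dirmap (dirinv u) = u.
Proof.
have q0 : dirnorm u != 0 by rewrite gt_eqF // dirnorm_gt0.
apply/rowP => i; rewrite mxE dirinv_k; have [->|ik] := eqVneq i k.
  by rewrite dirinv0 mulfK.
by case: ifP => iJ; rewrite dirinvl (negbTE ik) iJ // invrK divfK.
Qed.

Lemma dirnorm_map w : \sum_(i in J) w ord0 (lift ord0 i) ^+ 2 = 1 ->
  0 < s * w ord0 (lift ord0 k) -> dirnorm (dirmap w) = (s * w ord0 (lift ord0 k))^-1.
Proof.
move=> w1 wk; set z := s * _ in wk *.
have z2 : z ^+ 2 = w ord0 (lift ord0 k) ^+ 2 by rewrite exprMn [s ^+ 2]expr2 ss mul1r.
apply/eqP; rewrite -(eqrXn2 (n := 2)) ?invr_ge0 ?(ltW wk) ?(ltW (dirnorm_gt0 _)) //.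
rewrite dirnorm_sq (eq_bigr (fun i => w ord0 (lift ord0 i) ^+ 2 / z ^+ 2)) => [|i]; last first.
  by rewrite !inE mxE => /andP[/negbTE -> ->]; rewrite expr_div_n.
have zn : z ^+ 2 != 0 by rewrite expf_neq0 // gt_eqF.
rewrite -mulr_suml -{1}(mulfV zn) -mulrDl {1}z2.
by move: w1; rewrite (big_setD1 k) //= => ->; rewrite mul1r exprVn.
Qed.

Lemma dirinvK w : \sum_(i in J) w ord0 (lift ord0 i) ^+ 2 = 1 ->
  0 < s * w ord0 (lift ord0 k) -> dirinv (dirmap w) = w.
Proof.
move=> w1 wk; have zn : s * w ord0 (lift ord0 k) != 0 by rewrite gt_eqF.
apply/rowP => j; case: (unliftP ord0 j) => [i|] ->.
  rewrite dirinvl dirnorm_map // !mxE invrK; have [->|ik] := eqVneq i k.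
    by rewrite mulrA ss mul1r.
  by case iJ : (i \in J); rewrite // divfK.
by rewrite dirinv0 dirnorm_map // mxE eqxx mulfK.
Qed.

(** The blow-down map followed by the chart, as a function of the direction coordinates; it is
    polynomial, although [dirinv] involves a square root. *)
Definition dirpolar u : 'rV[R]_n := \row_i
  if i == k then s * u ord0 k else if i \in J then u ord0 k * u ord0 i else u ord0 i.

Lemma polar_dirinv u : polar J (dirinv u) = dirpolar u.
Proof.
have q0 : dirnorm u != 0 by rewrite gt_eqF // dirnorm_gt0.
apply/rowP => i; rewrite !mxE unlift_none liftK; have [->|ik] := eqVneq i k.
  by rewrite kJ mulrACA mulfV // mulr1 mulrC.
by case iJ : (i \in J); rewrite // mulrACA mulfV // mulr1.
Qed.

Lemma smooth_dirmap : exists2 W, open W & (forall w, W w <-> 0 < s * w ord0 (lift ord0 k)) /\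
  forall i, smooth W (fun w => dirmap w ord0 i).
Proof.
pose W := [set w : 'rV[R]_n.+1 | 0 < s * w ord0 (lift ord0 k)].
have oT := @openT 'rV[R]_n.+1.
have sk : smooth setT (fun w : 'rV[R]_n.+1 => s * w ord0 (lift ord0 k)).
  by apply: smoothM => //; [exact: smooth_cst|exact: smooth_coord].
have oW : open W.
  rewrite openE => v Wv; have c0 : {for v, continuous (fun _ : 'rV[R]_n.+1 => 0 : R)} by exact: cont_cst.
  exact: open_ltf c0 (smooth_cont sk I) Wv.
exists W => //; split=> // i.
have skW := smooth_sub (@subsetT _ W) sk.
apply: (@smooth_ext _ _ _ (fun w : 'rV[R]_n.+1 => if i == k then w ord0 ord0 * (s * w ord0 (lift ord0 k))
  else if i \in J then w ord0 (lift ord0 i) / (s * w ord0 (lift ord0 k)) else w ord0 (lift ord0 i))) => //.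
  by move=> v _; rewrite mxE.
apply: smooth_if; first by apply: smoothM => //; exact: smooth_coord.
apply: smooth_if; last exact: smooth_coord.
apply: smoothM => //; first exact: smooth_coord.
by apply: smoothV => // v Wv; rewrite gt_eqF.
Qed.

Lemma smooth_dirinv j : smooth setT (fun u => dirinv u ord0 j).
Proof.
have oT := @openT 'rV[R]_n.
have sN : smooth setT dirnorm.
  apply: smooth_sqrt => // [v _|]; first exact: dirsum_gt0.
  apply: smoothD => //; first exact: smooth_cst.
  by apply: smooth_sum => // i _; exact: smooth_sq.
have sV : smooth setT (fun u => (dirnorm u)^-1).
  by apply: smoothV => // v _; rewrite gt_eqF // dirnorm_gt0.
apply: (@smooth_ext _ _ _ (fun u : 'rV[R]_n => if unlift ord0 j is Some i then
    (if i == k then s / dirnorm u else if i \in J then u ord0 i / dirnorm u else u ord0 i)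
  else u ord0 k * dirnorm u)) => //.
  by move=> v _; rewrite mxE.
case: (unliftP ord0 j) => [i _|_]; last by apply: smoothM => //; exact: smooth_coord.
apply: smooth_if; first by apply: smoothM => //; exact: smooth_cst.
apply: smooth_if; last exact: smooth_coord.
by apply: smoothM => //; exact: smooth_coord.
Qed.

Lemma smooth_dirpolar i : smooth setT (fun u => dirpolar u ord0 i).
Proof.
have oT := @openT 'rV[R]_n.
apply: (@smooth_ext _ _ _ (fun u : 'rV[R]_n => if i == k then s * u ord0 k else
  if i \in J then u ord0 k * u ord0 i else u ord0 i)) => //.
  by move=> v _; rewrite mxE.
apply: smooth_if; first by apply: smoothM => //; [exact: smooth_cst|exact: smooth_coord].
by apply: smooth_if; [apply: smoothM => //|]; exact: smooth_coord.
Qed.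

(** The coordinate [k] becomes the defining function of the front face. If [k] is already a boundary
    coordinate, omega_k is nonnegative and only the sign [s = 1] occurs. *)
Lemma dirmap_image (T : Type) (over : set T) (P : T -> 'rV[R]_n.+1) (J0 : {set 'I_n})
    (X W0 : set 'rV[R]_n) : (k \in J0 -> s = 1) -> P @` over = polar_dom J0 J X ->
  open W0 -> X = orthant J0 `&` W0 ->
  exists2 W, open W & (dirmap \o P) @` [set b | over b /\ 0 < s * P b ord0 (lift ord0 k)] =
    orthant (k |: J0)%SET `&` W.
Proof.
move=> sk im oW0 XE.
pose W := [set u : 'rV[R]_n | [set: 'rV[R]_n] u /\ W0 (\row_i dirpolar u ord0 i)].
have rowE (u : 'rV[R]_n) : \row_i u ord0 i = u by apply/rowP => i; rewrite mxE.
exists W.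
  apply: open_pre; [exact: openT|exact: oW0|].
  by move=> i v _; apply: (smooth_cont (smooth_dirpolar i)).
apply/seteqP; split=> [_ [b [ ob pb] <-]|u [uo [_ uW]]].
  have [p0 p1 pJ pX] : polar_dom J0 J X (P b) by rewrite -im; exists b.
  have Xo : orthant J0 (polar J (P b)) by move: pX; rewrite XE => -[].
  split.
    move=> i; rewrite !inE mxE => /orP[/eqP ->|ib].
      by rewrite eqxx mulr_ge0 // ltW.
    case: eqP => _; first by rewrite mulr_ge0 // ltW.
    case: ifP => iJ; first by rewrite divr_ge0 ?pJ // ltW.
    by have := Xo i ib; rewrite mxE iJ.
  split=> //; rewrite rowE -polar_dirinv /= dirinvK //.
  by move: pX; rewrite XE => -[].
rewrite rowE in uW.
have q0 := dirnorm_gt0 u.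
have Dv : polar_dom J0 J X (dirinv u).
  have ok i : i \in J0 -> 0 <= u ord0 i by move=> ib; apply: uo; rewrite !inE ib orbT.
  have ukk : 0 <= u ord0 k by apply: uo; rewrite !inE eqxx.
  split.
  - by rewrite dirinv0 mulr_ge0 // ltW.
  - exact: dirinv_unit.
  - move=> i iJ ib; rewrite dirinvl iJ; case: eqP => ik.
      have s1 : s = 1 by apply: sk; rewrite -ik.
      by rewrite s1 divr_ge0 ?ler01 // ltW.
    by rewrite divr_ge0 ?ok // ltW.
  - rewrite polar_dirinv // XE; split=> // i ib; rewrite mxE.
    case: eqP => ik; first by rewrite sk -?ik // mul1r ik.
    by case: ifP => iJ; [apply: mulr_ge0 => //; exact: ok|exact: ok].
have : (P @` over) (dirinv u) by rewrite im.
move=> [b ob bE]; exists b; last by rewrite /= bE dirmapK.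
by split=> //; rewrite bE dirinv_k // invr_gt0.
Qed.

End DirectionCoordinates.

Lemma dirmap_cover {R : realType} n (J J0 : {set 'I_n}) X (v : 'rV[R]_n.+1) :
  polar_dom J0 J X v -> exists k s, [/\ k \in J, s * s = 1, k \in J0 -> s = 1 &
    0 < s * v ord0 (lift ord0 k)].
Proof.
move=> [_ p1 pJ _].
have [k kJ kn0] : exists2 k, k \in J & v ord0 (lift ord0 k) != 0.
  apply: contrapT => H; move/esym/eqP: p1; rewrite big1 ?oner_eq0 // => i iJ.
  apply/eqP; rewrite sqrf_eq0; apply/negPn/negP => n0; apply: H; exists i => //.
exists k, (Num.sg (v ord0 (lift ord0 k))); split=> //.
- by rewrite -expr2 sqr_sg kn0.
- by move=> kb; rewrite gtr0_sg // lt_neqAle eq_sym kn0 pJ.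
- by rewrite -normrEsg normr_gt0.
Qed.

Lemma coord_image_open {R : realType} n (M : premfd R n) (c : chart R n M) (O : set M) :
  coordinates c -> open O -> O `<=` dom c ->
  exists2 W, open W & c @` O = orthant (bnd c) `&` W.
Proof.
move=> [[ oc [Wc oWc hc]] _] oO sO; have [X oX XE] := homeo_push hc oO.
exists (Wc `&` X); first exact: openI.
have [im _ _] := hc; apply/seteqP; split=> [_ [q sq <-]|v [vo [vW vX]]].
  have cq := sO _ sq; have : (c @` dom c) (c q) by exists q.
  by rewrite im => -[qo qW]; do 2?split=> //; exact/XE.
have : (c @` dom c) v by rewrite im.
by move=> [q cq qE]; exists q => //; apply/XE => //; rewrite qE.
Qed.

(** * The blow-up as the closure of a graph *)

Section Construction.
Context {R : realType} {n : nat} (M : mfd R n) (C : set M).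
Variables (K : finType) (c : K -> chart R n M) (J : K -> {set 'I_n}) (chi : K -> M -> R).
Hypothesis clC : closed C.
Hypothesis cc : forall a, coordinates (c a).
Hypothesis cC : forall a q, dom (c a) q -> (C q <-> forall i, i \in J a -> c a q ord0 i = 0).
Hypothesis chi_cont : forall a q, {for q, continuous (chi a)}.
Hypothesis chi01 : forall a q, 0 <= chi a q <= 1.
Hypothesis chi_dom : forall a q, ~ dom (c a) q -> chi a q = 0.
Hypothesis cov : forall q, C q -> exists a, 0 < chi a q.
Hypothesis cM : compact [set: M].

(* The blow-up of C is realized as the closure, in M x R^N, of the graph over M \ C
   of the normalized normal coordinates in finitely many charts c a, each damped by
   a bump function chi a. *)
Definition supp a : set M := [set q | 0 < chi a q].
Definition nr a q : R := Num.sqrt (\sum_(i in J a) c a q ord0 i ^+ 2).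
Definition dirf a i q : R := if i \in J a then chi a q * (c a q ord0 i / nr a q) else 0.
Let N := #|{: K * 'I_n}|.
Definition dirs q : 'rV[R]_N := \row_z dirf (enum_val z).1 (enum_val z).2 q.
Definition bspace : set (M * 'rV[R]_N) := closure [set z | exists2 q, ~ C q & z = (q, dirs q)].
Definition pt (b : bspace) : M := (val b).1.
Definition vec a i (b : bspace) : R := (val b).2 ord0 (enum_rank (a, i)).

Lemma supp_dom a q : supp a q -> dom (c a) q.
Proof. by move=> sq; apply: contrapT => /chi_dom E; move: sq; rewrite /supp /= E ltxx. Qed.

Lemma supp_open a : open (supp a).
Proof.
rewrite openE => q sq; have c0 : {for q, continuous (fun _ : M => 0 : R)} by exact: cont_cst.
exact: (open_ltf c0 (@chi_cont a q) sq).
Qed.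

Lemma c_cont a q i : dom (c a) q -> {for q, continuous (fun y => c a y ord0 i)}.
Proof. by move=> cq; exact: cont_coord (g_cont (g_coordinates (cc a)) cq). Qed.

Lemma nr_cont a q : dom (c a) q -> {for q, continuous (nr a)}.
Proof.
move=> cq; apply: contsqrt; apply: cont_sum => i _.
have h := c_cont (i := i) cq.
rewrite (_ : (fun y => _) = fun y => c a y ord0 i * c a y ord0 i) //; exact: contM.
Qed.

Lemma nr_ge0 a q : 0 <= nr a q. Proof. exact: sqrtr_ge0. Qed.

Lemma nr_sq a q : nr a q ^+ 2 = \sum_(i in J a) c a q ord0 i ^+ 2.
Proof. by rewrite sqr_sqrtr // sumr_ge0 // => i _; rewrite sqr_ge0. Qed.

Lemma nr_gt0 a q : dom (c a) q -> ~ C q -> 0 < nr a q.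
Proof.
move=> cq nC; rewrite lt_neqAle eq_sym nr_ge0 andbT; apply/eqP => n0; apply: nC.
apply/(cC cq) => i iJ; apply/eqP; rewrite -sqrf_eq0.
have /eqP := nr_sq a q; rewrite n0 expr0n /= eq_sym psumr_eq0 => [/allP/(_ i)|j _].
  by rewrite mem_index_enum iJ; apply.
by rewrite sqr_ge0.
Qed.

Lemma dirf_le a i q : `|dirf a i q| <= chi a q.
Proof.
have /andP[x0 _] := chi01 a q.
rewrite /dirf; case: ifP => iJ; last by rewrite normr0.
rewrite normrM ger0_norm // ler_piMr // normrM normfV (ger0_norm (nr_ge0 _ _)).
have [->|n0] := eqVneq (nr a q) 0; first by rewrite invr0 mulr0.
have np : 0 < nr a q by rewrite lt_neqAle eq_sym n0 nr_ge0.
rewrite ler_pdivrMr // mul1r -sqrtr_sqr ler_wsqrtr // (bigD1 i) //= lerDl.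
by rewrite sumr_ge0 // => j _; rewrite sqr_ge0.
Qed.

(** Where [chi a] vanishes, the bound by [chi a] gives continuity, although nothing is known about
    [c a] there. *)
Lemma dirf_cont a i q : ~ C q -> {for q, continuous (dirf a i)}.
Proof.
move=> nC; have [x0|/negP x0] := boolP (0 < chi a q).
  case iJ : (i \in J a); last by rewrite (_ : dirf a i = fun=> 0) ?funeqE /dirf ?iJ; [exact: cont_cst|].
  rewrite (_ : dirf a i = fun y => chi a y * (c a y ord0 i / nr a y)); last first.
    by apply/funext => y; rewrite /dirf iJ.
  have cq := supp_dom x0; apply: contM; first exact: chi_cont.
  apply: contM; first exact: c_cont.
  by apply: contV; [rewrite gt_eqF // nr_gt0|exact: nr_cont].
have {}x0 : chi a q = 0.
  by apply/eqP; rewrite eq_le leNgt; case/andP: (chi01 a q) => -> _; rewrite andbT; apply/negP.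
have d0 : dirf a i q = 0 by apply/eqP; rewrite -normr_le0 -x0 dirf_le.
apply/cont_epsP => e e0; have := (cont_epsP _ _).1 (@chi_cont a q) e e0.
apply: near_mono => y; rewrite x0 d0 !subr0; apply: le_trans.
by apply: le_trans (dirf_le _ _ _) _; exact: ler_norm.
Qed.

Lemma dirs_cont q : ~ C q -> {for q, continuous dirs}.
Proof. by move=> nC; apply: cont_row => z; exact: dirf_cont. Qed.

Lemma val_cont (b : bspace) : {for b, continuous (val : bspace -> _)}.
Proof. exact: initial_continuous. Qed.

Lemma pt_cont (b : bspace) : {for b, continuous pt}.
Proof. by apply: (cvg_comp _ _ (@val_cont b)); exact: cvg_fst. Qed.

Lemma vec_cont a i (b : bspace) : {for b, continuous (vec a i)}.
Proof.
have h : {for b, continuous (fun b : bspace => (val b).2)}.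
  by apply: (cvg_comp _ _ (@val_cont b)); exact: cvg_snd.
exact: cont_coord h.
Qed.

Lemma b_near (b : bspace) (O : set bspace) : (\forall b' \near b, O b') ->
  exists X Y, [/\ open X, open Y, X (pt b), Y (val b).2 &
    forall b' : bspace, X (pt b') -> Y (val b').2 -> O b'].
Proof.
move=> /near_open[ O' [ [Z oZ ZE] O'b O'O]].
have : nbhs (val b) Z.
  by apply: open_nbhs_nbhs; split=> //; move: O'b; rewrite -ZE.
move=> [[X Y] /= [/near_open[X' [ oX' X'b X'X]] /near_open[Y' [ oY' Y'b Y'Y]]] XYZ].
exists X', Y'; split=> // b' X'b' Y'b'; apply: O'O; rewrite -ZE.
by apply: XYZ; split; [exact: X'X|exact: Y'Y].
Qed.

Lemma graph_mem q : ~ C q -> bspace (q, dirs q).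
Proof. by move=> nC; apply: subset_closure; exists q. Qed.

Definition graph q (nC : ~ C q) : bspace := exist _ (q, dirs q) (mem_set (graph_mem nC)).

Lemma b_dense (b : bspace) (O : set bspace) : (\forall b' \near b, O b') ->
  exists b' : bspace, [/\ O b', ~ C (pt b') & (val b').2 = dirs (pt b')].
Proof.
move=> /b_near[X [Y [ oX oY Xb Yb XYO]]].
have : closure [set z | exists2 q, ~ C q & z = (q, dirs q)] (val b) by exact/set_mem/(valP b).
have nb : nbhs (val b) (X `*` Y).
  by exists (X, Y) => //; split; apply: open_nbhs_nbhs.
move=> /(_ _ nb)[_ [[q nC ->] [/= Xq Yq]]].
by exists (graph nC); split=> //; exact: XYO.
Qed.

(** The graph is dense in its closure, so a relation between continuous functions need only be
    checked on it, where all entries are given by explicit formulas. *)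
Lemma b_le (Phi Psi : bspace -> R) b : {for b, continuous Phi} -> {for b, continuous Psi} ->
  (\forall b' \near b, ~ C (pt b') -> (val b').2 = dirs (pt b') -> Phi b' <= Psi b') ->
  Phi b <= Psi b.
Proof.
move=> c1 c2 nP; rewrite leNgt; apply/negP => lt0.
have [b' [[p0 H] nC E]] := b_dense (near_and (open_ltf c2 c1 lt0) nP).
by have := H nC E; rewrite leNgt p0.
Qed.

Lemma b_eq (Phi Psi : bspace -> R) b : {for b, continuous Phi} -> {for b, continuous Psi} ->
  (\forall b' \near b, ~ C (pt b') -> (val b').2 = dirs (pt b') -> Phi b' = Psi b') ->
  Phi b = Psi b.
Proof.
move=> c1 c2 nP; apply/eqP; rewrite eq_le; apply/andP.
by split; apply: b_le => //; apply: near_mono nP => b' E nC E'; rewrite E.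
Qed.

Lemma val2E (b : bspace) z : (val b).2 ord0 z = vec (enum_val z).1 (enum_val z).2 b.
Proof. by rewrite /vec -surjective_pairing enum_valK. Qed.

Lemma vec_graph a i (b : bspace) : (val b).2 = dirs (pt b) -> vec a i b = dirf a i (pt b).
Proof. by rewrite /vec => ->; rewrite mxE enum_rankK. Qed.

(** Over the complement of [C] the closure adds nothing, because [dirs] is continuous there. *)
Lemma vec_off a i b : ~ C (pt b) -> vec a i b = dirf a i (pt b).
Proof.
move=> nC; apply: (b_eq (Psi := fun b' => dirf a i (pt b'))); first exact: vec_cont.
  exact: (continuous_comp (@pt_cont b) (dirf_cont (a := a) (i := i) nC)).
by apply: near_all => b' _ /vec_graph.
Qed.

Lemma vec_le a i b : `|vec a i b| <= chi a (pt b).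
Proof.
apply: (b_le (Phi := fun b' => `|vec a i b'|) (Psi := fun b' => chi a (pt b'))).
- by have h := @vec_cont a i b; exact: cvg_norm h.
- exact: (continuous_comp (@pt_cont b) (@chi_cont a (pt b))).
- by apply: near_all => b' nC E; rewrite vec_graph // dirf_le.
Qed.

Lemma b_hausdorff : hausdorff_space bspace.
Proof.
move=> b b' clb; apply: val_inj; rewrite (surjective_pairing (val b)).
rewrite (surjective_pairing (val b')); congr pair.
  apply: (@carrier_hausdorff _ _ M) => A B nA nB.
  have [x [Ax Bx]] := clb _ _ (@pt_cont b _ nA) (@pt_cont b' _ nB).
  by exists (pt x).
apply: (@norm_hausdorff R 'rV[R]_N) => A B nA nB.
have c2 (x : bspace) : {for x, continuous (fun b : bspace => (val b).2)}.
  by apply: (cvg_comp _ _ (@val_cont x)); exact: cvg_snd.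
have [x [Ax Bx]] := clb _ _ (c2 b _ nA) (c2 b' _ nB).
by exists (val x).2.
Qed.

Lemma b_second_countable : @second_countable bspace.
Proof.
apply: (@second_countable_initial _ _ (val : bspace -> M * 'rV[R]_N)).
- by move=> b; exact: val_cont.
- move=> b O oO Ob.
  have [|X [Y [ oX oY Xb Yb XYO]]] := @b_near b O; first exact: open_nbhs_nbhs.
  exists (X `*` Y); split=> // [|b' [/= Xb' Yb']]; last exact: XYO.
  by rewrite openE => -[x y] [/= Xx Yy]; exists (X, Y) => //; split; apply: open_nbhs_nbhs.
apply: second_countable_prod; first exact: carrier_second_countable.
exact: second_countable_rV.
Qed.

Lemma b_compact : compact [set: bspace].
Proof.
have cb : compact bspace.
  apply: (@subclosed_compact _ _ ([set: M] `*` [set v : 'rV[R]_N | forall z, `[(-1 : R), 1]%classic (v ord0 z)])).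
  - exact: closed_closure.
  - apply: compact_setX => //; apply: (@rV_compact R N (fun=> `[(-1 : R), 1]%classic)).
    by move=> _; exact: segment_compact.
  - move=> z bz; split=> // k; have /= := val2E (exist _ z (mem_set bz)) k => ->.
    rewrite in_itv /= -ler_norml; apply: le_trans (vec_le _ _ _) _.
    by case/andP: (chi01 (enum_val k).1 (pt (exist _ z (mem_set bz)))).
(* Compactness of the subset of the product is passed on to the subtype [bspace]. *)
apply/compact_near_coveringP => I F P FF HP.
have /compact_near_coveringP/(_ I F (fun i z => forall b : bspace, val b = z -> P i b) FF) := cb.
set H := (H in (H -> _) -> _); suff h : H.
  by move/(_ h); apply: filterS => i Pi b _; apply: (Pi (val b)) => //; exact/set_mem/(valP b).
rewrite /H => {H} z bz.
have [[A B] /= [nA FB] AB] := HP (exist _ z (mem_set bz)) Logic.I.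
have [X [Y [ oX oY Xb Yb XYA]]] := b_near nA.
exists (X `*` Y, B); first by split=> //; exists (X, Y) => //; split; apply: open_nbhs_nbhs.
move=> [w i] [[/= Xw Yw] Bi] b bw; apply: (AB (b, i)); split=> //=.
by apply: XYA; rewrite /pt (_ : val b = w).
Qed.

(** Division by [chi a] undoes the damping: over the support of [chi a] these are the polar
    coordinates of the chart [c a]. *)
Definition pol a (b : bspace) : 'rV[R]_n.+1 := \row_(j < n.+1)
  if unlift ord0 j is Some i then
    (if i \in J a then vec a i b / chi a (pt b) else c a (pt b) ord0 i)
  else nr a (pt b).

Lemma pol0 a b : pol a b ord0 ord0 = nr a (pt b).
Proof. by rewrite mxE unlift_none. Qed.

Lemma poll a b i : pol a b ord0 (lift ord0 i) =
  if i \in J a then vec a i b / chi a (pt b) else c a (pt b) ord0 i.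
Proof. by rewrite mxE liftK. Qed.

Lemma chi_pt_cont a b : {for b, continuous (fun b' : bspace => chi a (pt b'))}.
Proof. exact: (continuous_comp (@pt_cont b) (@chi_cont a (pt b))). Qed.

Lemma pol_cont a b j : supp a (pt b) -> {for b, continuous (fun b' => pol a b' ord0 j)}.
Proof.
move=> sb; have cb := supp_dom sb; case: (unliftP ord0 j) => [i|] ->.
  case iJ : (i \in J a).
    rewrite (_ : (fun b' => _) = fun b' => vec a i b' / chi a (pt b')); last first.
      by apply/funext => b'; rewrite poll iJ.
    apply: contM; first exact: vec_cont.
    by apply: contV; [rewrite gt_eqF|exact: chi_pt_cont].
  rewrite (_ : (fun b' => _) = fun b' => c a (pt b') ord0 i); last first.
    by apply/funext => b'; rewrite poll iJ.
  exact: (continuous_comp (@pt_cont b) (c_cont (i := i) cb)).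
rewrite (_ : (fun b' => _) = fun b' => nr a (pt b')); last first.
  by apply/funext => b'; rewrite pol0.
exact: (continuous_comp (@pt_cont b) (nr_cont cb)).
Qed.

Lemma pol_row_cont a b : supp a (pt b) -> {for b, continuous (pol a)}.
Proof.
move=> sb; rewrite (_ : pol a = fun b' => \row_j pol a b' ord0 j); last first.
  by apply/funext => b'; apply/rowP => j; rewrite [RHS]mxE.
by apply: cont_row => j; exact: pol_cont.
Qed.

Lemma supp_pt_near a b : supp a (pt b) -> \forall b' \near b, supp a (pt b').
Proof. by move=> sb; apply: (@pt_cont b); apply: open_nbhs_nbhs; split=> //; exact: supp_open. Qed.

Lemma pol_off a b i : supp a (pt b) -> ~ C (pt b) -> i \in J a ->
  pol a b ord0 (lift ord0 i) = c a (pt b) ord0 i / nr a (pt b).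
Proof.
move=> sb nC iJ; rewrite poll iJ vec_off // /dirf iJ mulrAC mulfV ?mul1r //.
by rewrite gt_eqF.
Qed.

Lemma pol_unit a b : supp a (pt b) -> \sum_(i in J a) pol a b ord0 (lift ord0 i) ^+ 2 = 1.
Proof.
move=> sb.
apply: (b_eq (Phi := fun b' => \sum_(i in J a) pol a b' ord0 (lift ord0 i) ^+ 2) (Psi := fun=> 1)).
- apply: cont_sum => i _; have h := pol_cont (j := lift ord0 i) sb.
  rewrite (_ : (fun y => _) = fun y => pol a y ord0 (lift ord0 i) * pol a y ord0 (lift ord0 i)) //.
  exact: contM.
- exact: cont_cst.
apply: near_mono (supp_pt_near sb) => b' sb' nC _.
have n0 := nr_gt0 (supp_dom sb') nC.
rewrite (eq_bigr (fun i => c a (pt b') ord0 i ^+ 2 / nr a (pt b') ^+ 2)); last first.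
  by move=> i iJ; rewrite pol_off // expr_div_n.
by rewrite -mulr_suml -nr_sq mulfV // expf_neq0 // gt_eqF.
Qed.

Lemma pol_polar a b : supp a (pt b) -> polar (J a) (pol a b) = c a (pt b).
Proof.
move=> sb; apply/rowP => i; rewrite mxE; case: ifP => iJ; last by rewrite poll iJ.
apply: (b_eq (Phi := fun b' => pol a b' ord0 ord0 * pol a b' ord0 (lift ord0 i))
  (Psi := fun b' => c a (pt b') ord0 i)).
- by apply: contM; exact: pol_cont.
- exact: (continuous_comp (@pt_cont b) (c_cont (i := i) (supp_dom sb))).
apply: near_mono (supp_pt_near sb) => b' sb' nC _.
rewrite pol_off // pol0 mulrCA mulfV ?mulr1 // gt_eqF // nr_gt0 //; exact: supp_dom.
Qed.

Lemma pol_dom a (U : set M) b : supp a (pt b) -> U (pt b) ->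
  polar_dom (bnd (c a)) (J a) (c a @` U) (pol a b).
Proof.
move=> sb Ub; split; first by rewrite pol0 nr_ge0.
- exact: pol_unit.
- move=> i iJ ib; apply: (b_le (Phi := fun=> 0) (Psi := fun b' => pol a b' ord0 (lift ord0 i))).
  + exact: cont_cst.
  + exact: pol_cont.
  apply: near_mono (supp_pt_near sb) => b' sb' nC _.
  by rewrite pol_off // divr_ge0 ?nr_ge0 // (coord_orthant (cc a)) //; exact: supp_dom.
- by rewrite pol_polar //; exists (pt b).
Qed.

Lemma vec_chi0 a i b : ~ supp a (pt b) -> vec a i b = 0.
Proof.
move=> ns; apply/eqP; rewrite -normr_le0; apply: le_trans (vec_le _ _ _) _.
by rewrite leNgt; apply/negP.
Qed.

Lemma vec_notin a i b : i \notin J a -> vec a i b = 0.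
Proof.
move=> iJ; apply: (b_eq (Psi := fun=> 0)); first exact: vec_cont.
  exact: cont_cst.
by apply: near_all => b' _ E; rewrite vec_graph // /dirf (negbTE iJ).
Qed.

(* Off C both sides are polar coordinates of the same point, and the points off C
   are dense. *)
Lemma pol_change a a' q : supp a q -> supp a' q -> C q ->
  exists U W W' g g' h h', [/\ open U /\ U q, U `<=` supp a `&` supp a',
    half (c a) (c a') (J a) (J a') U W g h, half (c a') (c a) (J a') (J a) U W' g' h' &
    forall b, U (pt b) -> pol a' b = polG (J a) (J a') g h (pol a b)].
Proof.
move=> sq sq' Cq; have cq := supp_dom sq; have cq' := supp_dom sq'.
have [|||||U [W [W' [g [g' [h [h' [ oU Uq sU H1 H2]]]]]]]] :=
    half_pair (I := J a) (I' := J a') (O := supp a `&` supp a') (cc a) (cc a') cq cq'.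
- by apply: openI; exact: supp_open.
- by split.
- exact: (cC cq).1.
- exact: (cC cq').1.
- have o1 := open_nbhs_nbhs (conj (coord_open (cc a)) cq).
  have o2 := open_nbhs_nbhs (conj (coord_open (cc a')) cq').
  by apply: near_mono (near_and o1 o2) => y [y1 y2]; rewrite -(cC y1) -(cC y2).
exists U, W, W', g, g', h, h'; split=> // b Ub.
have [WG oWG [DW SG]] := smooth_polG (cc a) oU H1 H2.
have D b' : U (pt b') -> polar_dom (bnd (c a)) (J a) (c a @` U) (pol a b').
  by move=> Ub'; apply: pol_dom => //; have [] := sU _ Ub'.
apply/rowP => j; have [sb sb'] := sU _ Ub.
apply: (b_eq (Phi := fun b => pol a' b ord0 j)
   (Psi := fun b => polG (J a) (J a') g h (pol a b) ord0 j)).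
- exact: pol_cont.
- apply: (@continuous_comp _ _ _ (pol a)
    (fun v : 'rV[R]_n.+1 => polG (J a) (J a') g h v ord0 j) b (pol_row_cont sb)).
  by apply: (smooth_cont (SG j)); apply: DW; exact: D.
have : \forall b' \near b, U (pt b') by apply: (@pt_cont b); apply: open_nbhs_nbhs.
apply: near_mono => b' Ub' nC _; have [s s'] := sU _ Ub'.
congr (fun v : 'rV_n.+1 => v ord0 j); apply: (@polar_uniq _ _ (J a')).
- by rewrite pol0 nr_ge0.
- by case: (polG_dom (cc a) (cc a') oU H1 H2 (D _ Ub')).
- exact: pol_unit.
- by case: (polG_dom (cc a) (cc a') oU H1 H2 (D _ Ub')).
- by rewrite pol_polar // (polG_polar (cc a) oU H1 H2 (D _ Ub') Ub') // pol_polar.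
- by rewrite pol_polar // => z; apply: nC; apply/(cC (supp_dom s')).
Qed.

(** A point of the closure carries entries for all charts. Over [C], those of another chart [a'] are
    functions of [pol a] by [pol_change] if [a'] is supported there, and vanish otherwise. *)
Lemma pol_inj a b b' : supp a (pt b) -> supp a (pt b') -> pol a b = pol a b' -> b = b'.
Proof.
move=> sb sb' E.
have ptE : pt b = pt b'.
  apply: (homeo_inj (g_homeo (g_coordinates (cc a)))); [exact: supp_dom..|].
  by rewrite -!pol_polar // E.
apply: val_inj; rewrite (surjective_pairing (val b)) (surjective_pairing (val b')).
congr pair => //; apply/rowP => z; rewrite !val2E.
set a' := (enum_val z).1; set i := (enum_val z).2.
have [nC|Cb] := pselect (~ C (pt b)); first by rewrite !vec_off -?ptE.
have {}Cb := contrapT Cb.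
case iJ : (i \in J a'); last by rewrite !vec_notin // iJ.
have [s'|ns] := pselect (supp a' (pt b)); last by rewrite !vec_chi0 // -ptE.
have [U [W [W' [g [g' [h [h' [[ oU Uq] sU H1 H2 HE]]]]]]]] := pol_change sb s' Cb.
have : pol a' b ord0 (lift ord0 i) = pol a' b' ord0 (lift ord0 i).
  by rewrite (HE b Uq) (HE b') ?E // -ptE.
rewrite !poll iJ -ptE => /(congr1 (fun x => x * chi a' (pt b))).
by rewrite !divfK ?gt_eqF.
Qed.

(** Properness: as [A] is compact, the values of [pol a] on [A] cannot accumulate at a value [v]
    over [q] that they miss. At points over [q] this is continuity of [pol a]; the other points are
    kept away by their images in [M]. *)
Lemma pol_avoid a v q (A : set bspace) : closed A -> supp a q -> c a q = polar (J a) v ->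
  (forall b, A b -> supp a (pt b) -> pol a b <> v) ->
  \forall w \near v, forall b, A b -> supp a (pt b) -> pol a b <> w.
Proof.
move=> clA sq qE Av.
have cA : compact A by apply: (subclosed_compact clA b_compact).
have /compact_near_coveringP/(_ 'rV[R]_n.+1 (nbhs v) (fun w b => supp a (pt b) -> pol a b <> w) _) := cA.
set H := (H in (H -> _) -> _); suff h : H by move/(_ h).
rewrite /H => {H} b Ab.
have [E|ptn] := pselect (pt b = q).
  have sb : supp a (pt b) by rewrite E.
  have [X [Y [nX nY XY]]] := hausdorff_separate (@norm_hausdorff R 'rV[R]_n.+1) (Av b Ab sb).
  exists (pol a @^-1` X, Y); first by split=> //; exact: (pol_row_cont sb).
  by move=> [b' w] [/= Xb' Yw] _ E'; apply: (XY w) => //; rewrite -E'.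
have [X [Y [nX nY XY]]] := hausdorff_separate (@carrier_hausdorff _ _ M) ptn.
have [W [ oW Wq HW]] := homeo_nbhs (g_homeo (g_coordinates (cc a))) (supp_dom sq)
  nY.
exists (pt @^-1` X, polar (J a) @^-1` W); first split.
- exact: (@pt_cont b).
- have cv : {for v, continuous (fun w : 'rV[R]_n.+1 => polar (J a) w)}.
    by apply: cont_polar; exact: cont_id.
  by apply: cv; apply: open_nbhs_nbhs; split; rewrite -?qE.
- move=> [b' w] [/= Xb' Ww] sb' E'; apply: (XY (pt b')) => //; apply: HW; [exact: supp_dom|].
  by rewrite -pol_polar // E'.
Qed.

(** If [v] were missed, all values near it would be missed by [pol_avoid]; but a slight increase of
    the radius gives a value over the complement of [C], which is attained on the graph. *)
Lemma pol_surj a v : polar_dom (bnd (c a)) (J a) (c a @` supp a) v ->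
  exists b, supp a (pt b) /\ pol a b = v.
Proof.
have off w q : polar_dom (bnd (c a)) (J a) (c a @` supp a) w -> supp a q ->
    c a q = polar (J a) w -> ~ C q -> exists b, supp a (pt b) /\ pol a b = w.
  move=> [w0 w1 _ _] sq qE nC; exists (graph nC); split=> //.
  apply: (@polar_uniq _ _ (J a)) => //; first by rewrite pol0 nr_ge0.
  - exact: pol_unit.
  - by rewrite pol_polar.
  - by rewrite pol_polar // => z; have := nC; apply; apply/(cC (supp_dom sq)).
move=> Dv; have [v0 v1 _ [q sq qE]] := Dv.
apply: contrapT => nb.
have [d d0 Hd] := polar_dom_seg (cc a) (@supp_open a) (@supp_dom a) Dv.
have /near_normP[e e0 He] : \forall w \near v, forall b, setT b -> supp a (pt b) -> pol a b <> w.
  by apply: (pol_avoid closedT sq qE) => b _ sb E; apply: nb; exists b.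
pose t := Num.min d e / 2.
have m0 : 0 < Num.min d e by rewrite lt_min d0 e0.
have t0 : 0 < t by rewrite /t divr_gt0.
have tm : t < Num.min d e by rewrite /t ltr_pdivrMr // mulr_natr mulr2n ltrDl.
have /andP[td te] : (t < d) && (t < e) by rewrite -lt_min.
have Dt : polar_dom (bnd (c a)) (J a) (c a @` supp a) (v + t *: delta_mx ord0 ord0).
  by apply: Hd; rewrite ltW.
have [_ _ _ [q' sq' q'E]] := Dt.
have nC : ~ C q'.
  move=> /(cC (supp_dom sq')) z; have /esym/eqP := v1; rewrite big1 ?oner_eq0 // => i iJ.
  have /eqP := z i iJ; rewrite q'E mxE iJ addt0 addtl mulf_eq0 => /orP[/eqP E|/eqP ->].
    by move: v0 t0; lra.
  by rewrite expr0n.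
have [b [sb bE]] := off _ _ Dt sq' q'E nC.
apply: (He _ _ b I sb bE).
rewrite addrC addKr; apply: norm_row_lt => // i; rewrite !mxE eqxx /=.
by case: eqP => _; rewrite ?mulr1 ?mulr0 ?normr0 // gtr0_norm.
Qed.

Definition over a : set bspace := pt @^-1` supp a.

Lemma over_open a : open (over a).
Proof. by apply: open_comp; [move=> b _; exact: pt_cont|exact: supp_open]. Qed.

Lemma pol_image a : pol a @` over a = polar_dom (bnd (c a)) (J a) (c a @` supp a).
Proof.
apply/seteqP; split=> [_ [b sb <-]|v /pol_surj[b [sb <-]]]; first exact: pol_dom.
by exists b.
Qed.

(** Continuity of the inverse is [pol_avoid] for the complement of [O]. *)
Lemma pol_homeo a : homeo_onto (over a) (pol a) (pol a @` over a).
Proof.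
apply: homeo_intro; [exact: over_open|by move=> b sb; exact: pol_row_cont| |].
  by move=> b b' sb sb' E; exact: (pol_inj sb).
move=> b O sb oO Ob.
have /near_open[W [ oW Wb WH]] : \forall w \near pol a b, forall b', (~` O) b' ->
    supp a (pt b') -> pol a b' <> w.
  apply: (pol_avoid (q := pt b)) => //; first by rewrite closedC.
    by rewrite pol_polar.
  by move=> b' nO sb' E; apply: nO; rewrite (pol_inj sb' sb E).
exists W; split=> // b' sb' Wb'; apply: contrapT => nO.
exact: (WH _ Wb' b' nO sb').
Qed.

Inductive bgen : set bspace -> forall m, (bspace -> 'rV[R]_m) -> Prop :=
| bgen_off d : coordinates d -> bgen (pt @^-1` (dom d `&` ~` C)) (d \o pt)
| bgen_pol a : bgen (over a) (pol a).

Lemma off_open (d : chart R n M) : coordinates d -> open (dom d `&` ~` C).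
Proof. by move=> cd; apply: openI; [exact: coord_open|rewrite openC]. Qed.

Lemma pre_open (O : set M) : open O -> open (pt @^-1` O).
Proof. by move=> oO; apply: open_comp => // b _; exact: pt_cont. Qed.

Lemma bgen_open O m (P : bspace -> 'rV[R]_m) : bgen O P -> open O.
Proof. by case=> [d ad|a]; [apply: pre_open; exact: off_open|exact: over_open]. Qed.

Lemma pt_inj b b' : ~ C (pt b) -> pt b = pt b' -> b = b'.
Proof.
move=> nC E; apply: val_inj; rewrite (surjective_pairing (val b)) (surjective_pairing (val b')).
by congr pair => //; apply/rowP => z; rewrite !val2E !vec_off -?E.
Qed.

Lemma off_homeo (d : chart R n M) : coordinates d -> let O := pt @^-1` (dom d `&` ~` C) in
  homeo_onto O (d \o pt) ((d \o pt) @` O).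
Proof.
move=> ad O; have gd := g_coordinates ad.
apply: homeo_intro.
- exact: bgen_open (bgen_off ad).
- by move=> b [db _]; apply: (continuous_comp (@pt_cont b)); exact: g_cont gd db.
- move=> b b' [db nC] [db' _] E; apply: pt_inj => //.
  exact: homeo_inj (g_homeo gd) db db' E.
move=> b O' [db nC] oO' O'b; have [X [Y [ oX oY Xb Yb XYO]]] := b_near (open_nbhs_nbhs (conj oO' O'b)).
have E (b' : bspace) : ~ C (pt b') -> (val b').2 = dirs (pt b').
  by move=> nC'; apply/rowP => z; rewrite val2E vec_off // !mxE.
have nY : \forall q \near pt b, X q /\ Y (dirs q).
  apply: near_and; first exact: open_nbhs_nbhs.
  by apply: (dirs_cont nC); apply: open_nbhs_nbhs; split; rewrite -?E.
have [W [ oW Wb HW]] := homeo_nbhs (g_homeo gd) db nY.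
exists W; split=> // b' [db' nC'] Wb'; have [X' Y'] := HW _ db' Wb'.
by apply: XYO; rewrite ?E.
Qed.

Lemma bgen_homeo O m (P : bspace -> 'rV[R]_m) : bgen O P -> homeo_onto O P (P @` O).
Proof. by case=> [d ad|a]; [exact: off_homeo|exact: pol_homeo]. Qed.

Lemma smooth_pol_c a (A : set bspace) : A `<=` over a -> smooth_of A (pol a) (c a \o pt).
Proof.
move=> sA; apply: (@so_smooth _ _ _ _ _ setT (fun i v => polar (J a) v ord0 i)) => //.
- exact: openT.
- move=> i; rewrite (_ : (fun v => _) = fun v : 'rV[R]_n.+1 =>
      if i \in J a then v ord0 ord0 * v ord0 (lift ord0 i) else v ord0 (lift ord0 i)).
    apply: smooth_if; last by apply: smooth_coord; exact: openT.
    by apply: smoothM; [exact: openT|apply: smooth_coord; exact: openT..].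
  by apply/funext => v; rewrite mxE.
- by move=> b i Ab; rewrite pol_polar //; exact: sA.
Qed.

Lemma smooth_c_pol a (A : set bspace) : A `<=` over a -> (forall b, A b -> ~ C (pt b)) ->
  smooth_of A (c a \o pt) (pol a).
Proof.
move=> sA nC; pose S (v : 'rV[R]_n) := \sum_(i in J a) v ord0 i ^+ 2.
have sS : smooth setT S.
  apply: smooth_sum => [|i _]; first exact: openT.
  by apply: smooth_sq; exact: openT.
pose W := [set v | 0 < S v].
have oW : open W.
  rewrite openE => v Wv; have c0 : {for v, continuous (fun _ : 'rV[R]_n => 0 : R)} by exact: cont_cst.
  exact: open_ltf c0 (smooth_cont sS I) Wv.
have sW : smooth W (fun v => Num.sqrt (S v)).
  by apply: smooth_sqrt => //; apply: smooth_sub sS.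
apply: (@so_smooth _ _ _ _ _ W (fun j v => if unlift ord0 j is Some i then
   (if i \in J a then v ord0 i / Num.sqrt (S v) else v ord0 i) else Num.sqrt (S v))) => //.
- move=> j; case: (unliftP ord0 j) => [i _|_] //.
  apply: smooth_if; last exact: smooth_coord.
  apply: smoothM => //; first exact: smooth_coord.
  by apply: smoothV => // v Wv; rewrite gt_eqF // sqrtr_gt0.
- by move=> b Ab; rewrite /W /= -sqrtr_gt0; apply: nr_gt0; [exact/supp_dom/sA|exact: nC].
- move=> b j Ab; have sb := sA _ Ab; case: (unliftP ord0 j) => [i|] ->.
    by case: ifP => iJ; [rewrite pol_off //; exact: nC|rewrite poll iJ].
  by rewrite pol0.
Qed.

Lemma coord_pt_smooth (d e : chart R n M) A : coordinates d -> coordinates e ->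
  A `<=` pt @^-1` (dom d `&` dom e) -> smooth_of A (d \o pt) (e \o pt).
Proof.
move=> cd ce sA; apply: so_sub sA _; apply: so_pre.
exact: g_compat (g_coordinates cd) (g_coordinates ce).
Qed.

(** Two polar maps are compared through the charts of [M] off [C], where the radius is smooth and
    positive, and through [polG] near [C]. *)
Lemma bgen_compat O O' m m' (P : bspace -> 'rV[R]_m) (P' : bspace -> 'rV[R]_m') :
  bgen O P -> bgen O' P' -> smooth_of (O `&` O') P P'.
Proof.
case=> [d ad|a]; case=> [d' ad'|a'].
- by apply: coord_pt_smooth => // b [[? _] [? _]].
- apply: (@so_comp _ _ _ _ _ _ _ (c a' \o pt)).
    apply: coord_pt_smooth => //.
    by move=> b [[? _] /supp_dom].
  by apply: smooth_c_pol => [b []|b [[]]].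
- apply: (@so_comp _ _ _ _ _ _ _ (c a \o pt)); first by apply: smooth_pol_c => b [].
  apply: coord_pt_smooth => //.
  by move=> b [/supp_dom ? []].
apply: so_local => b [ ob ob'].
have [nC|/contrapT Cb] := pselect (~ C (pt b)).
  have [W oW HW] := homeo_push (pol_homeo a) (pre_open (closed_openC clC)).
  exists W; split=> //; first exact/(HW _ ob).
  have nC' b' : (over a `&` over a' `&` pol a @^-1` W) b' -> ~ C (pt b').
    by move=> [[ ob1 _] Wb']; apply/(HW _ ob1).
  apply: (@so_comp _ _ _ _ _ _ _ (c a \o pt)); first by apply: smooth_pol_c => b' [[]].
  apply: (@so_comp _ _ _ _ _ _ _ (c a' \o pt)).
    by apply: coord_pt_smooth => // b' [[/supp_dom ? /supp_dom]].
  by apply: smooth_c_pol => // b' [[]].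
have [U [W [W' [g [g' [h [h' [[ oU Uq] sU H1 H2 HE]]]]]]]] := pol_change ob ob' Cb.
have [WG oWG [DW SG]] := smooth_polG (cc a) oU H1 H2.
have [V oV HV] := homeo_push (pol_homeo a) (pre_open oU).
exists V; split=> //; first exact/(HV _ ob).
apply: (@so_smooth _ _ _ _ _ WG (fun j v => polG (J a) (J a') g h v ord0 j)) => //.
- by move=> b' [[ ob1 _] Vb']; apply: DW; apply: pol_dom => //; exact/(HV _ ob1).
- by move=> b' j [[ ob1 _] Vb']; rewrite HE //; exact/(HV _ ob1).
Qed.

Definition dirchart a k s : chart R n bspace :=
  Chart [set b | over a b /\ 0 < s * pol a b ord0 (lift ord0 k)] (k |: bnd (c a))%SET
    (dirmap (J a) k s \o pol a).

Section DirectionChart.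
Variables (a : K) (k : 'I_n) (s : R).
Hypothesis kJ : k \in J a.
Hypothesis ss : s * s = 1.
Hypothesis sk : k \in bnd (c a) -> s = 1.

Lemma dirchart_open : open (dom (dirchart a k s)).
Proof.
rewrite openE => b [ ob pb].
have h1 : \forall b' \near b, over a b' by apply: open_nbhs_nbhs; split=> //; exact: over_open.
have c0 : {for b, continuous (fun _ : bspace => 0 : R)} by exact: cont_cst.
have h2 : {for b, continuous (fun b' => s * pol a b' ord0 (lift ord0 k))}.
  by apply: contM; [exact: cont_cst|exact: pol_cont].
exact: (near_and h1 (open_ltf c0 h2 pb)).
Qed.

Lemma dirchart_from : smooth_of (dom (dirchart a k s)) (pol a) (dirchart a k s).
Proof.
have [W oW [WE sW]] := smooth_dirmap (J a) k s.
apply: (@so_smooth _ _ _ _ _ W (fun i w => dirmap (J a) k s w ord0 i)) => // b [ ob pb].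
exact/WE.
Qed.

Lemma dirchart_to : smooth_of (dom (dirchart a k s)) (dirchart a k s) (pol a).
Proof.
apply: (@so_smooth _ _ _ _ _ setT (fun j u => dirinv (J a) k s u ord0 j)) => //.
- exact: openT.
- by move=> j; exact: smooth_dirinv.
- by move=> b j [ ob pb]; rewrite /= dirinvK //; exact: pol_unit.
Qed.

Lemma dirchart_corner : corner_chart (dirchart a k s).
Proof.
split; first exact: dirchart_open.
have [W0 oW0 sE] := coord_image_open (cc a) (@supp_open a) (@supp_dom a).
have [W oW WE] := dirmap_image kJ ss sk (pol_image a) oW0 sE.
exists W => //; have <- : dirchart a k s @` dom (dirchart a k s) = orthant (k |: bnd (c a))%SET `&` W.
  exact: WE.
apply: (homeo_change dirchart_open _ dirchart_from dirchart_to).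
have := homeo_restrict (pol_homeo a) (@over_open a) dirchart_open.
by rewrite setIidr // => b [].
Qed.

End DirectionChart.

Lemma dirchart_cover a b : over a b -> exists k s, [/\ k \in J a, s * s = 1,
  k \in bnd (c a) -> s = 1 & dom (dirchart a k s) b].
Proof. by move=> ob; have [k [s [? ? ? ?]]] := dirmap_cover (pol_dom ob ob); exists k, s. Qed.

Definition offchart (d : chart R n M) : chart R n bspace :=
  Chart (pt @^-1` (dom d `&` ~` C)) (bnd d) (d \o pt).

Lemma offchart_image d : d @` (dom d `&` ~` C) = offchart d @` dom (offchart d).
Proof.
apply/seteqP; split=> [_ [q [dq nCq] <-]|_ [b' [db' nC'] <-]]; first by exists (graph nCq).
by exists (pt b').
Qed.

Lemma offchart_corner d : coordinates d -> corner_chart (offchart d).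
Proof.
move=> cd; split; first exact: bgen_open (bgen_off cd).
have := chart_restrict cd (closed_openC clC).
move=> [[_ [W oW [im _ _]]] _]; exists W => //.
have <- : offchart d @` dom (offchart d) = orthant (bnd d) `&` W.
  by rewrite -offchart_image -im.
exact: off_homeo.
Qed.

Lemma bgen_chart b : exists O m (P : bspace -> 'rV[R]_m) (e : chart R n bspace),
  [/\ bgen O P, corner_chart e /\ dom e b, dom e `<=` O, smooth_of (dom e) e P &
      smooth_of (dom e) P e].
Proof.
have [nC|/contrapT Cb] := pselect (~ C (pt b)).
  have [d /atlas_coordinates cd db] := atlas_cover (pt b).
  exists (pt @^-1` (dom d `&` ~` C)), n, (d \o pt), (offchart d); split=> //.
  - exact: bgen_off.
  - by split=> //; exact: offchart_corner.
  - exact: so_id.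
  - exact: so_id.
have [a sa] := cov Cb.
have [k [s [kJ ss sk eb]]] := dirchart_cover (a := a) sa.
exists (over a), n.+1, (pol a), (dirchart a k s); split.
- exact: bgen_pol.
- by split=> //; exact: dirchart_corner.
- by move=> b' [].
- exact: dirchart_to.
- exact: dirchart_from.
Qed.

Definition bpre : premfd R n := gen_premfd bgen_open bgen_compat bgen_chart
  b_hausdorff b_second_countable.

Lemma bgen_gcoord O m (P : bspace -> 'rV[R]_m) : bgen O P -> gcoord (M := bpre) O P.
Proof. by move=> gP; apply: gen_gcoord => // O' m' P'; exact: bgen_homeo. Qed.

Lemma offchart_coordinates d : coordinates d -> @coordinates R n bpre (offchart d).
Proof.
move=> cd; apply: (@atlas_coordinates R n bpre).
by apply: (gen_atlas_intro bgen_compat (bgen_off cd) (offchart_corner cd)) => //; exact: so_id.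
Qed.

Lemma dirchart_coordinates a k s : k \in J a -> s * s = 1 -> (k \in bnd (c a) -> s = 1) ->
  @coordinates R n bpre (dirchart a k s).
Proof.
move=> kJ ss sk; apply: (@atlas_coordinates R n bpre).
apply: (gen_atlas_intro bgen_compat (bgen_pol a) (dirchart_corner kJ ss sk)).
- by move=> b [].
- exact: dirchart_to.
- exact: dirchart_from.
Qed.

Lemma dirchart_front a k s (b : bspace) : dom (dirchart a k s) b ->
  dirchart a k s b ord0 k = 0 <-> C (pt b).
Proof.
move=> [ ob pb]; rewrite mxE eqxx pol0; split=> [/eqP|Cb].
  rewrite mulf_eq0 [X in _ || X]gt_eqF // orbF => /eqP n0.
  by apply: contrapT => /(nr_gt0 (supp_dom ob)); rewrite n0 ltxx.
have -> : nr a (pt b) = 0; last by rewrite mul0r.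
apply/eqP; rewrite sqrtr_eq0 big1 // => i iJ.
by rewrite ((cC (supp_dom ob)).1 Cb) // expr0n.
Qed.

Lemma dirchart_coord a k s (b : bspace) j : dom (dirchart a k s) b -> j != k ->
  dirchart a k s b ord0 j = 0 -> c a (pt b) ord0 j = 0.
Proof.
move=> [ ob pb] jk; rewrite -pol_polar // polarE.
rewrite (_ : dirchart a k s b = dirmap (J a) k s (pol a b)) // dirmapE (negbTE jk).
case: ifP => // jJ /eqP; rewrite mulf_eq0 invr_eq0 [X in _ || X]gt_eqF // orbF.
by move=> /eqP ->; rewrite mulr0.
Qed.

(** At a codimension one point over [C] only the front coordinate [k] vanishes; the other boundary
    coordinates stay positive nearby. *)
Lemma front_near (b : bpre) : codim1_boundary b -> C (pt b) ->
  \forall b' \near b, @codim1_boundary R n bpre b' -> C (pt b').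
Proof.
move=> db Cb; have [a sa] := cov Cb.
have [k [s [kJ ss sk eb]]] := dirchart_cover (a := a) (b := b) sa.
set e := dirchart a k s in eb.
have ce : @coordinates R n bpre e := dirchart_coordinates kJ ss sk.
have kb : k \in bnd e by rewrite !inE eqxx.
have ek : e b ord0 k = 0 by apply/(dirchart_front eb).
have pos := (codim1_face ce eb kb ek).1 db.
have H l : \forall b' \near b, l \in bnd e -> l != k -> 0 < e b' ord0 l.
  have [/andP[lb lk]|nlb] := boolP ((l \in bnd e) && (l != k)); last first.
    by apply: near_all => b' lb lk; move: nlb; rewrite lb lk.
  have c0 : {for b, continuous (fun _ : bpre => 0 : R)} by exact: cont_cst.
  have cl : {for b, continuous (fun b' : bpre => e b' ord0 l)}.
    exact: cont_coord (g_cont (g_coordinates ce) eb).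
  by apply: near_mono (open_ltf c0 cl (pos l lb lk)) => b' ? _ _.
have de := open_nbhs_nbhs (conj (coord_open ce) eb).
apply: near_mono (near_and de (near_forall H)) => b' [eb' Hb'] /(codim1P ce eb').1 n1.
have [l] : exists l, l \in [set j in bnd e | e b' ord0 j == 0]%SET.
  by apply/card_gt0P; rewrite n1.
rewrite inE => /andP[lb /eqP el]; have [lk|lk] := eqVneq l k.
  by apply/(dirchart_front eb'); rewrite -/e -lk.
by have := Hb' l lb lk; rewrite el ltxx.
Qed.

(** Within the codimension one points the front face is closed, and open by [front_near]. *)
Lemma front_connected (A : set bpre) b : connected A -> A `<=` @codim1_boundary R n bpre ->
  A b -> C (pt b) -> A `<=` pt @^-1` C.
Proof.
move=> cA Ad Ab Cb; apply: (connected_clopen cA) Ab Cb.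
  by apply: closed_comp => // b' _; exact: pt_cont.
by move=> y Ay Cy; apply: near_mono (front_near (Ad _ Ay) Cy) => z H /Ad.
Qed.

Lemma off_codim1 (b : bpre) : ~ C (pt b) -> codim1_boundary b -> @codim1_boundary R n M (pt b).
Proof.
move=> nC; have [d /atlas_coordinates cd db] := atlas_cover (pt b).
have eb : dom (offchart d) b by [].
by move=> /(codim1P (offchart_coordinates cd) eb) H; apply/(codim1P cd db).
Qed.

Lemma off_connected (A : set bpre) x : connected A -> A `<=` @codim1_boundary R n bpre ->
  A x -> ~ C (pt x) -> connected (pt @` A) /\ pt @` A `<=` @codim1_boundary R n M.
Proof.
move=> cA Ad Ax nCx; split.
  apply: connected_continuous_connected => //; apply: continuous_subspaceT => b.
  exact: pt_cont.
move=> _ [b Ab <-]; apply: off_codim1; last exact: Ad.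
by move=> Cb; apply: nCx; exact: (front_connected cA Ad Ab Cb).
Qed.

(** A connected set of codimension one points lies in the front face or avoids it. In the former
    case it meets no other face of the chart; in the latter the blow-down map carries it to [M],
    where faces are already separated. *)
Lemma bfaces (b : bpre) : exists2 e, adapted b e & splits_faces e.
Proof.
have [nC|/contrapT Cb] := pselect (~ C (pt b)).
  have [d /atlas_coordinates cd db] := atlas_cover (pt b).
  have [||c' [ac' sc' _ _]] := @adapted_reparam _ _ _ d (pt b) (~` C) 1%:M cd db (closed_openC clC) nC.
  - exact: unitmx1.
  - by move=> v j _ _; rewrite mulmx1.
  have [cc' c'b c'0 [e e0 im]] := ac'.
  exists (offchart c').
    split; [exact: offchart_coordinates|by []|by []|].
    exists e => //; rewrite -offchart_image -im; congr image.
    by apply/seteqP; split=> [q []|q c'q] //; split=> //; have [] := sc' _ c'q.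
  move=> A j l x y cA Ad jb lb jl Ax Ay [cx nCx] [cy nCy] xj yl.
  have [cA' Ad'] := off_connected cA Ad Ax nCx.
  by apply: (mfd_splits_faces ac' cA' Ad' jb lb jl (x := pt x) (y := pt y)).
have [a sa] := cov Cb; set q := pt b.
have [k [s [kJ ss sk eb]]] := dirchart_cover (a := a) (b := b) sa.
set e := dirchart a k s in eb.
have ce : @coordinates R n bpre e := dirchart_coordinates kJ ss sk.
have [||c' [ac' _ bc' c'E]] := @adapted_reparam _ _ _ (c a) q setT 1%:M (cc a) (supp_dom sa) openT I.
- exact: unitmx1.
- by move=> v j _ _; rewrite mulmx1.
have [cc' c'q _ _] := ac'.
have [||e' [ae' se' be' e'E]] := @adapted_reparam _ _ bpre e b (pt @^-1` dom c') 1%:M ce eb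
  (pre_open (coord_open cc')) c'q.
- exact: unitmx1.
- by move=> v j _ _; rewrite mulmx1.
exists e' => // A j l x y cA Ad; rewrite be' !inE.
move=> /andP[jb /eqP ej] /andP[lb /eqP el] jl Ax Ay /se'[ex c'x] /se'[ey c'y].
have e'c u i : e b ord0 i = 0 -> e' u ord0 i = e u ord0 i.
  by rewrite e'E mulmx1 subrowE => ->; rewrite subr0.
rewrite !e'c // => xj yl; have kb : k \in bnd e by rewrite !inE eqxx.
have front i i' u w : A u -> A w -> dom e u -> dom e w -> e u ord0 i = 0 -> e w ord0 i' = 0 ->
    i' \in bnd e -> i != i' -> i != k.
  move=> Au Aw eu ew ui wi' i'b ii'; apply/eqP => ik; rewrite ik in ui ii'.
  have Cu : C (pt u) by apply/(dirchart_front eu).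
  have := front_connected cA Ad Au Cu Aw => /(dirchart_front ew).
  by apply/eqP; rewrite gt_eqF // ((codim1_face ce ew i'b wi').1 (Ad _ Aw)).
have jb' : j \in bnd e by rewrite !inE.
have lb' : l \in bnd e by rewrite !inE.
have jk : j != k := front j l x y Ax Ay ex ey xj yl lb' jl.
have lk : l != k by apply: (front l j y x) => //; rewrite eq_sym.
have nCx : ~ C (pt x).
  move=> /(dirchart_front ex); apply/eqP; rewrite gt_eqF //.
  by rewrite ((codim1_face ce ex jb' xj).1 (Ad _ Ax)) // eq_sym.
have [cA' Ad'] := off_connected cA Ad Ax nCx.
have face i u : i \in bnd e -> i != k -> e b ord0 i = 0 -> dom e u -> e u ord0 i = 0 ->
    i \in bnd c' /\ c' (pt u) ord0 i = 0.
  move=> ib ik bi eu ui; have ci := dirchart_coord eb ik bi.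
  split; first by move: ib; rewrite bc' !inE (negbTE ik) /= => ->; rewrite ci eqxx.
  rewrite c'E mulmx1 subrowE [X in _ - X]ci subr0.
  exact: dirchart_coord eu ik ui.
have [jc' xj'] := face j x jb' jk ej ex xj; have [lc' yl'] := face l y lb' lk el ey yl.
by apply: (mfd_splits_faces ac' cA' Ad' jc' lc' jl (x := pt x) (y := pt y)).
Qed.

Definition bmfd : mfd R n := @Mfd R n bpre (fun H => psub_hypersurface bfaces (H := H)).

Lemma pt_smooth : @smooth_on R n n bmfd M setT pt.
Proof.
split=> [b _|e d ae ad]; first exact: pt_cont.
have ge : @gcoord R n bpre (dom e) n e := g_atlas ae.
apply: so_local => b [[_ eb] db].
have cd := atlas_coordinates ad.
have [nC|/contrapT Cb] := pselect (~ C (pt b)).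
  have [W oW HW] := homeo_push (g_homeo ge) (pre_open (closed_openC clC)).
  exists W; split=> //; first exact/(HW _ eb).
  have [_ _ /(_ e ae)[s _]] := bgen_gcoord (bgen_off cd).
  by apply: so_sub s => b' [[[_ eb'] db'] Wb']; do 2?split=> //; apply/HW.
have [a sa] := cov Cb.
have [W oW HW] := homeo_push (g_homeo ge) (@over_open a).
exists W; split=> //; first exact/(HW _ eb).
apply: (@so_comp _ _ _ _ _ _ _ (pol a)).
  have [_ _ /(_ e ae)[s _]] := bgen_gcoord (bgen_pol a).
  by apply: so_sub s => b' [[[_ eb'] db'] Wb']; split=> //; apply/HW.
apply: (@so_comp _ _ _ _ _ _ _ (c a \o pt)).
  by apply: smooth_pol_c => b' [[[_ eb'] db'] Wb']; apply/HW.
apply: coord_pt_smooth => // b' [[[_ eb'] db'] Wb']; split=> //.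
by apply: supp_dom; apply/HW.
Qed.

Lemma pt_diffeo : @diffeo_on R n bmfd M (pt @^-1` (~` C)) pt (~` C).
Proof.
have oC : open (~` C) := closed_openC clC.
apply: d_crit => //.
- exact: pre_open.
- apply/seteqP; split=> [_ [b nC <-] //|q nC].
  by exists (graph nC).
- by move=> b b' nC _; exact: pt_inj.
move=> b nC; have [d /atlas_coordinates cd db] := atlas_cover (pt b).
exists (dom d `&` ~` C), n, d; split=> //.
  by apply: g_sub (off_open cd) _ (g_coordinates cd) => q [].
rewrite setIidr => [|b' []] //; exact: bgen_gcoord (bgen_off cd).
Qed.

Lemma pt_blowup : is_blowup C (pt : bmfd -> M).
Proof.
apply: blowup_intro => //; [exact: pt_smooth|exact: pt_diffeo|].
move=> p Cp; have [a sa] := cov Cp.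
exists (c a), (J a), (supp a), (pol a); split=> //.
  by move=> q sq; apply: cC; exact: supp_dom.
split.
- by split; [exact: supp_open|exact: supp_dom].
- exact: bgen_gcoord (bgen_pol a).
- exact: pol_image.
- by move=> b sb; rewrite pol_polar.
Qed.

End Construction.

Theorem blowup_exists {R : realType} {n : nat} (M : mfd R n) (C : set M) :
  compact [set: M] -> submfd C ->
  exists (B : mfd R n) (beta : B -> M), is_blowup C beta /\ compact [set: B].
Proof.
move=> cM [clC HC].
have H p : exists z : chart R n M * {set 'I_n} * (M -> R), C p ->
    [/\ coordinates z.1.1, forall q, dom z.1.1 q -> (C q <-> forall i, i \in z.1.2 -> z.1.1 q ord0 i = 0),
        (forall q, {for q, continuous z.2}) /\ (forall q, 0 <= z.2 q <= 1), z.2 p = 1 &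
        forall q, ~ dom z.1.1 q -> z.2 q = 0].
  have [Cp|nC] := pselect (C p); last first.
    have [d _ _] := atlas_cover p.
    by exists (d, finset.set0, fun=> 0) => Cp; case: nC.
  have [c [I [cc cp /near_open[ O [ oO Op OC]]]]] := HC p Cp.
  have [chi [chi1 chi2 chi3 chi4]] := bump (R := R) (@carrier_hausdorff _ _ M) cM
    (openI (coord_open cc) oO) (conj cp Op).
  (* The domain is shrunk so that the equations describe [C] on all of it, not only near [p]. *)
  exists (Chart (dom c `&` O) (bnd c) c, I, chi) => _; split=> //.
    exact: chart_restrict.
  by move=> q [_ /OC].
have {H}[z Hz] := choice H.
have cC : compact C by exact: (subclosed_compact clC cM (@subsetT _ C)).
have [|s [sC sU]] := compact_cover_seq (U := fun p => [set q | 0 < (z p).2 q]) cC.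
  move=> p Cp; have [_ _ [chi1 _] chi2 _] := Hz p Cp; split; last by rewrite /= chi2.
  rewrite openE => q sq; have c0 : {for q, continuous (fun _ : M => 0 : R)} by exact: cont_cst.
  exact: open_ltf c0 (chi1 q) sq.
pose x (a : 'I_(size s)) := tnth (in_tuple s) a.
have Cx a : C (x a) by apply: sC; exact: mem_tnth.
pose c a := (z (x a)).1.1; pose J a := (z (x a)).1.2; pose chi a := (z (x a)).2.
have h1 a : coordinates (c a) by case: (Hz _ (Cx a)).
have h2 a q : dom (c a) q -> (C q <-> forall i, i \in J a -> c a q ord0 i = 0).
  by have [_ H _ _ _] := Hz _ (Cx a); exact: H.
have h3 a q : {for q, continuous (chi a)} by have [_ _ [H _] _ _] := Hz _ (Cx a); exact: H.
have h4 a q : 0 <= chi a q <= 1 by have [_ _ [_ H] _ _] := Hz _ (Cx a); exact: H.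
have h5 a q : ~ dom (c a) q -> chi a q = 0 by have [_ _ _ _ H] := Hz _ (Cx a); exact: H.
have h6 q : C q -> exists a, 0 < chi a q.
  move=> /sU[p ps /= pq]; have /tnthP[a pa] : p \in in_tuple s by [].
   exists a; rewrite /chi /x -pa; exact: pq.
exists (bmfd clC h1 h2 h3 h4 h5 h6 cM), (@pt R n M C _ c J chi); split.
  exact: pt_blowup.
exact: b_compact.
Qed.

(** * Lifting a pic to the blow-up of a minimal element *)

(** Direction coordinates on any blow-up in the sense of [is_blowup]: the induction lifts elements
    to blow-ups that are given, not constructed. *)
Lemma polchart_dir {R : realType} {n : nat} (M B : mfd R n) (beta : B -> M) (c : chart R n M)
    (I : {set 'I_n}) (O : set M) (P : B -> 'rV[R]_n.+1) k s : coordinates c ->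
  polchart beta c I O P -> k \in I -> s * s = 1 -> (k \in bnd c -> s = 1) ->
  coordinates (Chart [set b | O (beta b) /\ 0 < s * P b ord0 (lift ord0 k)]
    (k |: bnd c)%SET (dirmap I k s \o P)).
Proof.
move=> cc [[ oO sO] gP im _] kI ss sk; set D := [set b | _].
have oD : open D.
  rewrite openE => b [ Ob pb].
  have h1 : \forall b' \near b, (beta @^-1` O) b' by exact: open_nbhs_nbhs (conj (g_open gP) Ob).
  have c0 : {for b, continuous (fun _ : B => 0 : R)} by exact: cont_cst.
  have h2 : {for b, continuous (fun b' => s * P b' ord0 (lift ord0 k))}.
    by apply: contM; [exact: cont_cst|exact: cont_coord (g_cont gP Ob)].
  exact: (near_and h1 (open_ltf c0 h2 pb)).
have gD : gcoord D P by apply: (g_sub oD _ gP) => b [].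
have [W0 oW0 sE] := coord_image_open cc oO sO.
have [W oW WE] := dirmap_image kI ss sk im oW0 sE.
apply: (@g_chart _ _ _ _ _ _ W) => //; apply: (g_change gD).
  have [W' oW' [W'E sW]] := smooth_dirmap I k s.
  apply: (@so_smooth _ _ _ _ _ W' (fun i w => dirmap I k s w ord0 i)) => // b [ Ob pb].
  exact/W'E.
apply: (@so_smooth _ _ _ _ _ setT (fun j u => dirinv I k s u ord0 j)) => //.
- exact: openT.
- by move=> j; exact: smooth_dirinv.
- move=> b j [ Ob pb]; rewrite /= dirinvK //.
  have : (P @` (beta @^-1` O)) (P b) by exists b.
  by rewrite im => -[].
Qed.

Section MatrixTools.
Context {F : fieldType} {n : nat}.
Implicit Types (A B D Q : 'M[F]_n).

Lemma sub_mul_unit Q (v : 'rV[F]_n) A : Q \in unitmx -> (v *m Q <= A *m Q)%MS = (v <= A)%MS.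
Proof. by move=> uQ; rewrite submxMfree // row_free_unit. Qed.

Lemma rank_mul_unit Q A : Q \in unitmx -> \rank (A *m Q) = \rank A.
Proof. by move=> uQ; rewrite mxrankMfree // row_free_unit. Qed.

Lemma eq_mul_unit Q A B : Q \in unitmx -> (A *m Q == B *m Q)%MS = (A == B)%MS.
Proof. by move=> uQ; rewrite !submxMfree // row_free_unit. Qed.

Lemma cap_mul_unit Q A B D : Q \in unitmx -> (A == B :&: D)%MS ->
  (A *m Q == B *m Q :&: D *m Q)%MS.
Proof.
move=> uQ /andP[]; rewrite sub_capmx => /andP[AB AD] BDA; apply/andP; split.
  by rewrite sub_capmx !submxMr.
rewrite -[X in (X <= _)%MS](mulmxKV uQ) submxMr //; apply: submx_trans BDA.
rewrite sub_capmx; apply/andP; split.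
  by rewrite -[X in (_ <= X)%MS](mulmxK uQ) submxMr // capmxSl.
by rewrite -[X in (_ <= X)%MS](mulmxK uQ) submxMr // capmxSr.
Qed.

Lemma addmx_subP A (u v : 'rV[F]_n) : (u <= A)%MS -> ((u + v)%R <= A)%MS = (v <= A)%MS.
Proof.
move=> uA; apply/idP/idP => h; last by rewrite addmx_sub.
by rewrite -[v](addKr u) addmx_sub // eqmx_opp.
Qed.

Lemma scalemx_subP A (a : F) (v : 'rV[F]_n) : a != 0 -> (a *: v <= A)%MS = (v <= A)%MS.
Proof. by move=> a0; rewrite eqmx_scale. Qed.

End MatrixTools.

(** * The local form of a pic *)

Section LocalPic.
Context {R : realType} {n : nat} {T : eqType} (d : T -> nat).
Implicit Types (M : mfd R n) (s : seq T).

(* A pointwise form of the definition of a pic, stable under blow-up: near p every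
   element through p is a linear subspace in one chart, the subspaces are pairwise
   distinct and closed under intersection. *)
Definition lclean M (C : T -> set M) s (p : M) (c : chart R n M) (V : T -> 'M[R]_n) :=
  [/\ coordinates c /\ dom c p, c p = 0,
      forall i, i \in s -> C i p -> [/\ stab (V i) (bnd c), \rank (V i) = d i &
        forall q, dom c q -> C i q <-> (c q <= V i)%MS],
      forall i j, i \in s -> j \in s -> C i p -> C j p ->
        exists k, [/\ k \in s, C k p & (V k == V i :&: V j)%MS] &
      forall i j, i \in s -> j \in s -> C i p -> C j p -> (V i == V j)%MS -> i = j].

Definition lpic M (C : T -> set M) s := (forall i, i \in s -> closed (C i)) /\
  forall p, exists c V, lclean C s p c V.

Lemma lclean_head M (C : T -> set M) s p c V i j : lclean C s p c V -> i \in s -> j \in s ->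
  C i p -> C j p -> (forall k, k \in s -> C k p -> (d i <= d k)%N) -> (V i <= V j)%MS.
Proof.
move=> [_ _ H1 H2 H3] si sj Ci Cj le; have [k [sk Ck VE]] := H2 _ _ si sj Ci Cj.
have [_ rk _] := H1 _ sk Ck; have [_ ri _] := H1 _ si Ci.
have VkVi : (V k <= V i)%MS by case/andP: VE => h _; apply: submx_trans h (capmxSl _ _).
have kE : k = i.
  apply: H3 => //; rewrite VkVi /= -(geq_leqif (mxrank_leqif_sup VkVi)) rk ri; exact: le.
by case/andP: VE => h _; rewrite kE in h; apply: submx_trans h (capmxSr _ _).
Qed.

Lemma lclean_reparam M (C : T -> set M) s p c V (Q : 'M[R]_n) (O : set M) :
  lclean C s p c V -> Q \in unitmx ->
  (forall (v : 'rV[R]_n) j, j \in bnd c -> (v *m Q) ord0 j = v ord0 j) ->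
  (forall j, j \in bnd c -> (delta_mx ord0 j : 'rV_n) *m Q = delta_mx ord0 j) ->
  open O -> O p ->
  exists c', [/\ adapted p c', lclean C s p c' (fun j => V j *m Q),
    forall q, dom c' q -> dom c q /\ O q & forall q, c' q = c q *m Q].
Proof.
move=> [[cc cp] cp0 H1 H2 H3] uQ fQ eQ oO Op.
have [v j jb _|c' [ac' sc' bc' c'E]] := adapted_reparam cc cp oO Op uQ; first exact: fQ.
have E q : c' q = c q *m Q by rewrite c'E cp0 subr0.
have bE : bnd c' = bnd c by rewrite bc'; apply/setP => j; rewrite inE cp0 mxE eqxx andbT.
have [cc' c'p c'p0 _] := ac'.
exists c'; split=> //; split=> //.
- move=> i si Ci; have [st rk HC] := H1 _ si Ci; split.
  + apply/stabP => v j; rewrite bE => jb vV.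
    have := (stabP _ _).1 st (v *m invmx Q) j jb.
    rewrite -(sub_mul_unit _ _ uQ) mulmxKV // => /(_ vV).
    rewrite -(sub_mul_unit _ _ uQ) -scalemxAl eQ //.
    by rewrite -[in X in (X *: _ <= _)%MS -> _](fQ _ _ jb) mulmxKV.
  + by rewrite rank_mul_unit.
  + by move=> q /sc'[cq _]; rewrite E sub_mul_unit //; exact: HC.
- move=> i j si sj Ci Cj; have [k [sk Ck VE]] := H2 _ _ si sj Ci Cj.
  by exists k; split=> //; exact: cap_mul_unit.
- by move=> i j si sj Ci Cj; rewrite eq_mul_unit //; exact: H3.
Qed.

(** Straightening one element keeps the others linear, as the change of coordinates is linear and
    fixes the boundary coordinates. *)
Lemma lclean_straight M (C : T -> set M) s p c V i (O : set M) : lclean C s p c V ->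
  i \in s -> C i p -> open O -> O p ->
  exists c' V' (I : {set 'I_n}), [/\ adapted p c', lclean C s p c' V',
    forall q, dom c' q -> dom c q /\ O q, #|~: I| = d i &
    forall v : 'rV_n, (v <= V' i)%MS <-> forall l, l \in I -> v ord0 l = 0].
Proof.
move=> lc si Ci oO Op; have [_ _ H1 _ _] := lc.
have [st rk HC] := H1 _ si Ci.
have [Q [I [uQ fQ eQ VQ nI]]] := straighten st.
have [c' [ac' lc' sc' c'E]] := lclean_reparam lc uQ fQ eQ oO Op.
exists c', (fun j => V j *m Q), I; split=> //; first by rewrite nI.
by move=> v; rewrite -[v](mulmxKV uQ) sub_mul_unit // VQ.
Qed.

Lemma lpic_submfd M (C : T -> set M) s i : lpic C s -> i \in s -> submfd (C i).
Proof.
move=> [clC lC] si; split; first exact: clC.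
move=> p Cp; have [c [V lc]] := lC p.
have [c' [V' [I [ac' [[cc' c'p] _ H1 _ _] _ _ VI]]]] := lclean_straight lc si Cp openT Logic.I.
exists c', I; split=> //; have [_ _ HC] := H1 _ si Cp.
apply: near_mono (open_nbhs_nbhs (conj (coord_open cc') c'p)) => q c'q.
by rewrite HC // VI.
Qed.

Section Lift.
Variables (M B : mfd R n) (beta : B -> M) (C : T -> set M) (i : T) (s : seq T).
Hypothesis lC : lpic C (i :: s).
Hypothesis nis : i \notin s.
Hypothesis ord : forall j, j \in s -> C i !=set0 -> C j !=set0 -> (d i <= d j)%N.
Hypothesis bl : is_blowup (C i) beta.

Let L j := blift beta (C i) (C j).

Let si : i \in i :: s. Proof. by rewrite inE eqxx. Qed.
Let sj j : j \in s -> j \in i :: s. Proof. by rewrite inE orbC => ->. Qed.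
Let cbeta : forall b, {for b, continuous beta}. Proof. exact: blowup_cont bl. Qed.

(** The inclusion is strict because distinct elements have distinct subspaces and [i] is not in
    [s]. *)
Lemma head_sub p c V j : lclean C (i :: s) p c V -> j \in s -> C i p -> C j p ->
  (V i <= V j)%MS /\ ~ (V j <= V i)%MS.
Proof.
move=> lc js Ci Cj; have VV : (V i <= V j)%MS.
  apply: (lclean_head lc) => // [|k]; first exact: sj.
  by rewrite inE => /orP[/eqP -> //|ks] Ck; apply: ord => //; exists p.
split=> // VjVi; have [_ _ _ _ H3] := lc; move: nis.
by rewrite (H3 i j) ?VV ?js //; exact: sj.
Qed.

Lemma head_dense j : j \in s -> C j `<=` closure (C j `\` C i).
Proof.
move=> js q Cj; have [Ci|nCi] := pselect (C i q); last exact: subset_closure.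
have [c [V lc]] := lC.2 q; have [_ nVV] := head_sub lc js Ci Cj.
have [[cc cq] cq0 H1 _ _] := lc.
have [st _ HC] := H1 _ (sj js) Cj; have [_ _ HCi] := H1 _ si Ci.
move=> O nO.
(* A row of [V j] outside [V i] is a difference of two inward vectors of [V j], one of which is then
   outside [V i]. *)
have [w [wj wi w0]] : exists w : 'rV[R]_n, [/\ (w <= V j)%MS, ~ (w <= V i)%MS & inward c q w].
  have /row_subPn[l nl] : ~~ (V j <= V i)%MS by exact/negP.
  have [w1 [w2 [wE w1p w2p wV]]] := inward_split (row l (V j)) (bnd c).
  have [w1j w2j] := wV _ st (row_sub _ _).
  have iw (w : 'rV[R]_n) : (forall j0, j0 \in bnd c -> 0 <= w ord0 j0) -> inward c q w.
    by move=> wp l' l'b _; exact: wp.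
  have [w1i|/negP w1i] := boolP (w1 <= V i)%MS; last by exists w1; split=> //; exact: iw.
  exists w2; split=> //; last exact: iw.
  by move=> w2i; move/negP: nl; apply; rewrite wE addmx_sub // eqmx_opp.
have [e e0 He] := inward_point cc cq w0 nO.
have [|q' [cq' Oq' q'E]] := He (e / 2).
  by rewrite divr_ge0 ?ltW //= ltr_pdivrMr // mulr_natr mulr2n ltrDl.
have e20 : e / 2 != 0 by rewrite gt_eqF // divr_gt0.
exists q'; split=> //; split.
  by rewrite HC // q'E cq0 add0r scalemx_subP.
by rewrite HCi // q'E cq0 add0r scalemx_subP.
Qed.

Lemma head_liftable j : j \in s -> liftable (C i) (C j).
Proof. by move=> js; split; [exact/lC.1/sj|right; exact: head_dense]. Qed.

(** If [C j] lies in [C i], density makes it empty, so the first case of [blift] contributes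
    nothing. *)
Lemma bliftE j : j \in s -> L j = closure (beta @^-1` (C j `\` C i)).
Proof.
move=> js; apply/seteqP; split=> b; last first.
  have [CC|nCC] := pselect (C j `<=` C i); last by right.
  by rewrite (_ : _ `\` _ = set0) ?preimage_set0 ?closure0 // -subset0 => q [/CC].
case=> [[CC Cj]|[]//]; have := head_dense js Cj.
by rewrite (_ : _ `\` _ = set0) ?closure0 // -subset0 => q [/CC].
Qed.

Lemma blift_sub j b : j \in s -> L j b -> C j (beta b).
Proof.
move=> js; rewrite bliftE // => clb; apply: (lC.1 j (sj js)) => O nO.
by have [b' [[Cj _] Ob']] := clb _ (cbeta nO); exists (beta b').
Qed.

Lemma blift_off j b : j \in s -> ~ C i (beta b) -> L j b <-> C j (beta b).
Proof.
move=> js nC; split=> [|Cj]; first exact: blift_sub.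
by rewrite bliftE //; apply: subset_closure.
Qed.

Lemma blift_lclean_off b : ~ C i (beta b) -> exists c V, lclean L s b c V.
Proof.
move=> nC; have [c [V [[cc cp] cp0 H1 H2 H3]]] := lC.2 (beta b).
have [_ df _] := bl; have clC := lC.1 i si.
have cr := chart_restrict cc (closed_openC clC).
have oU : open (beta @^-1` (~` C i)) by apply: open_comp => [x _|]; [exact: cbeta|rewrite openC].
have sr : dom (Chart (dom c `&` ~` C i) (bnd c) c) `<=` ~` C i by move=> q [].
have ce := chart_pull df oU cr sr.
exists (Chart (beta @^-1` (~` C i) `&` beta @^-1` (dom c `&` ~` C i)) (bnd c) (c \o beta)), V.
split=> //.
- move=> j js Lj; have Cj := blift_sub js Lj; have [st rk HC] := H1 _ (sj js) Cj.
  by split=> // b' [nC' [cb' _]]; rewrite blift_off //; exact: HC.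
- move=> j l js ls Lj Ll; have [k [ks Ck VE]] := H2 _ _ (sj js) (sj ls) (blift_sub js Lj) (blift_sub ls Ll).
  have ks' : k \in s by move: ks; rewrite inE => /orP[/eqP ki|//]; rewrite ki in Ck.
  by exists k; split=> //; apply/blift_off.
- by move=> j l js ls Lj Ll; apply: H3; rewrite ?sj //; exact: blift_sub.
Qed.

(** A chart that straightens [C i] is followed by a direction chart around [b]. Since [V i] lies in
    [V j], membership in [C j] off the front face is a linear condition on [theta u], which is
    insensitive to the radius and therefore extends to the front face. *)
Lemma blift_lclean_on b : C i (beta b) -> exists c V, lclean L s b c V.
Proof.
move=> Cb; have [c0 [V0 lc0]] := lC.2 (beta b).
have [c [V [I0 [ac lc _ _ VI]]]] := lclean_straight lc0 si Cb openT Logic.I.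
have [[cc cp] cp0 H1 H2 H3] := lc; have [_ _ HCi] := H1 _ si Cb.
have lz : locally_zero (C i) c I0 (beta b).
  apply: near_mono (open_nbhs_nbhs (conj (coord_open cc) cp)) => q cq.
  by rewrite HCi // VI.
have [U [P [ oU Up sU pc]]] := blowup_chart bl Cb cc cp lz.
have [_ gP imP cP] := pc.
have [k [t [kI tt tk pk]]] : exists k t, [/\ k \in I0, t * t = 1, k \in bnd c -> t = 1 &
    0 < t * P b ord0 (lift ord0 k)].
  apply: (@dirmap_cover R n I0 (bnd c) (c @` U)).
  by rewrite -imP; exists b.
have ce := polchart_dir cc pc kI tt tk.
set e := Chart _ _ _ in ce.
have tn : t != 0 by apply/eqP => t0; move/eqP: tt; rewrite t0 mul0r eq_sym oner_eq0.
have eb : dom e b by [].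
have kb : k \in bnd e by rewrite !inE eqxx.
have ek b' : dom e b' -> c (beta b') = dirpolar I0 k t (e b').
  move=> [Ub' pb']; rewrite cP // -polar_dirinv //= dirinvK //.
  have : (P @` (beta @^-1` U)) (P b') by exists b'.
  by rewrite imP => -[].
have dE u l : dirpolar I0 k t u ord0 l = if l == k then t * u ord0 k else
    if l \in I0 then u ord0 k * u ord0 l else u ord0 l by rewrite mxE.
have domc b' : dom e b' -> dom c (beta b') by move=> [/sU].
have front b' : dom e b' -> C i (beta b') <-> e b' ord0 k = 0.
  move=> eb'; rewrite HCi; last exact: domc.
  rewrite VI ek //; split=> [/(_ k kI)/eqP|uk l lI].
    by rewrite dE eqxx mulf_eq0 (negbTE tn) => /eqP.
  by rewrite dE lI uk !(mulr0, mul0r); case: ifP.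
pose dk : 'rV[R]_n := delta_mx ord0 k.
(* Near b the lift of C j is {theta u in V j} in the chart e: theta puts the sign t
   in place of the k-th coordinate, so that theta u is a positive multiple of the
   direction omega modulo the centre. Recentred at b, this is the linear space V j T2. *)
pose theta (u : 'rV[R]_n) : 'rV[R]_n := u + (t - u ord0 k) *: dk.
have thE u l : theta u ord0 l = if l == k then t else u ord0 l.
  rewrite !mxE eqxx /=; have [->|_] := eqVneq l k; first by rewrite mulr1 addrC subrK.
  by rewrite mulr0 addr0.
have dkE (u : 'rV[R]_n) (a : R) l : (u + a *: dk) ord0 l = u ord0 l + a * (l == k)%:R.
  by rewrite !mxE eqxx.
have CjE j b' : j \in s -> C j (beta b) -> dom e b' -> e b' ord0 k != 0 ->
    C j (beta b') <-> (theta (e b') <= V j)%MS.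
  move=> js Cj eb' uk; have [VV _] := head_sub lc js Cb Cj.
  have [_ _ HC] := H1 _ (sj js) Cj; rewrite HC; last exact: domc.
  set u := e b' in uk *; rewrite ek //.
  have rE : (dirpolar I0 k t u - u ord0 k *: theta u <= V i)%MS.
    apply/VI => l lI; rewrite subrowE dE [X in _ - X]mxE thE lI.
    by case: eqP => _; rewrite ?(mulrC t) subrr.
  rewrite -[dirpolar _ _ _ _](subrK (u ord0 k *: theta u)).
  by rewrite addmx_subP ?scalemx_subP //; exact: submx_trans rE VV.
have LjE j b' : j \in s -> C j (beta b) -> dom e b' -> L j b' <-> (theta (e b') <= V j)%MS.
  move=> js Cj eb'; rewrite bliftE //; split=> [cl|th].
    apply/negPn/negP; rewrite submxE => /eqP/rowP nz; apply: nz => l; rewrite [RHS]mxE.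
    apply/eqP/negPn/negP => nz.
    pose F x := `|(theta (e x) *m cokermx (V j)) ord0 l|.
    have cF : {for b', continuous F}.
      have h : {for b', continuous (fun x => (theta (e x) *m cokermx (V j)) ord0 l)}.
        apply: cont_coord; apply: cont_mulmx.
        have ce' : {for b', continuous e} := g_cont (g_coordinates ce) eb'.
        rewrite (_ : (fun x => theta (e x)) = fun x => \row_m (if m == k then t else e x ord0 m)); last first.
          by apply/funext => x; apply/rowP => m; rewrite thE [RHS]mxE.
        by apply: cont_row => m; case: (m == k); [exact: cont_cst|exact: cont_coord ce'].
      exact: cvg_norm h.
    have c0' : {for b', continuous (fun _ : B => 0 : R)} by exact: cont_cst.
    have Fp : 0 < F b' by rewrite normr_gt0.
    have [x [[Cjx nCx] [Fx ex]]] := cl _ (near_and (open_ltf c0' cF Fp)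
      (open_nbhs_nbhs (conj (coord_open ce) eb'))).
    have uk : e x ord0 k != 0 by apply/eqP => uk; apply: nCx; exact/front.
    have := (CjE j x js Cj ex uk).1 Cjx; rewrite submxE => /eqP z.
    by move: Fx; rewrite /F z mxE normr0 ltxx.
  (* Increasing the [k]-th coordinate leaves the front face without changing [theta]. *)
  move=> O /near_open[ O' [ oO' O'b O'O]].
  have [a a0 Ha] := coord_near_image ce eb' oO' O'b.
  have [l lb||x [ex O'x xE]] := Ha (e b' + (a / 2) *: dk).
  - rewrite dkE addr_ge0 //; first exact: coord_orthant lb.
    by rewrite mulr_ge0 ?ler0n // divr_ge0 // ltW.
  - rewrite addrC addKr; apply: norm_row_lt => // m; rewrite !mxE eqxx /=.
    by case: eqP => _; rewrite ?mulr1 ?mulr0 ?normr0 // gtr0_norm; lra.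
  have uk : e x ord0 k != 0.
    rewrite xE dkE eqxx mulr1 gt_eqF //.
    by have := coord_orthant ce eb' kb; lra.
  exists x; split; last exact: O'O; split; last by move=> /(front _ ex)/eqP; apply/negP.
  apply/(CjE j x js Cj ex uk); rewrite (_ : theta (e x) = theta (e b')) //.
  apply/rowP => l; rewrite !thE; case: eqP => // /eqP lk.
  by rewrite xE dkE (negbTE lk) mulr0 addr0.
pose w0 := e b; have w0k : w0 ord0 k = 0 by apply/(front _ eb).
pose z := theta w0.
have zE : z = w0 + t *: dk by rewrite /z /theta w0k subr0.
(* [T1] is the shear that takes [t *: dk] to [z] and fixes the other basis vectors, and [T2] is its
   inverse, as [D] squares to zero because [w0] has [k]-th entry 0. Thus [V j *m T2] is the preimage
   of [V j] under [T1]. *)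
pose D : 'M[R]_n := delta_mx k (ord0 : 'I_1) *m (t *: w0).
have vD (v : 'rV[R]_n) : v *m D = (v ord0 k * t) *: w0.
  rewrite mulmxA; have -> : v *m delta_mx k (ord0 : 'I_1) = (v ord0 k)%:M.
    by rewrite -colE; apply/matrixP => x y; rewrite !ord1 !mxE eqxx.
  by rewrite mul_scalar_mx scalerA.
have DD : D *m D = 0.
  apply/row_matrixP => l; rewrite row_mul vD row0.
  by rewrite rowE vD mxE w0k mulr0 mul0r scale0r.
pose T1 : 'M[R]_n := 1%:M + D; pose T2 : 'M[R]_n := 1%:M - D.
have vA (v : 'rV[R]_n) : v *m T1 = v + (v ord0 k * t) *: w0.
  by rewrite /T1 mulmxDr mulmx1 vD.
have inv1 : T2 *m T1 = 1%:M.
  by rewrite /T1 /T2 mulmxDr mulmx1 mulmxBl mul1mx DD subr0 subrK.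
have uA : T1 \in unitmx by case: (mulmx1_unit inv1).
have uA' : T2 \in unitmx by case: (mulmx1_unit inv1).
have VA (v : 'rV[R]_n) j : (v <= V j *m T2)%MS = (v *m T1 <= V j)%MS.
  by rewrite -[RHS](sub_mul_unit _ _ uA') -mulmxA (mulmx1C inv1) mulmx1.
have [||c2 [ac2 s2 b2 c2E]] := @adapted_reparam _ _ B e b setT 1%:M ce eb openT Logic.I.
- exact: unitmx1.
- by move=> v j _ _; rewrite mulmx1.
have [cc2 c2b c20 _] := ac2.
have delE (a : R) l m : (a *: delta_mx ord0 l : 'rV[R]_n) ord0 m = a * (m == l)%:R.
  by rewrite !mxE eqxx.
have addE (u v : 'rV[R]_n) (a : R) m : (u + a *: v) ord0 m = u ord0 m + a * v ord0 m.
  by rewrite !mxE.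
have alg1 (v w f : 'rV[R]_n) (a : R) : v + (t - a) *: f = w + t *: f + (v - w - a *: f).
  by apply/rowP => m; rewrite !mxE; ring.
have alg2 (v w f : 'rV[R]_n) (a : R) :
    v - w + (a * t) *: w = (a * t) *: (w + t *: f) + (v - w - a *: f).
  by rewrite scalerDr scalerA -mulrA tt mulr1; apply/rowP => m; rewrite !mxE; ring.
have zL j : j \in s -> L j b -> (z <= V j)%MS.
  by move=> js Lj; apply/(LjE j b js (blift_sub js Lj) eb).
exists c2, (fun j => V j *m T2); split=> //.
- move=> j js Lj; have Cj := blift_sub js Lj; have zj := zL j js Lj.
  have [st rk _] := H1 _ (sj js) Cj; split.
  + apply/stabP => v l; rewrite b2 inE => /andP[lb /eqP wl]; rewrite !VA !vA => h.
    (* The axis [k] itself lies in the lifted subspace, as [z] lies in [V j]; along the other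
       boundary coordinates that vanish at [b], stability is inherited from [V j]. *)
    have [lk|lk] := eqVneq l k.
      rewrite lk delE eqxx mulr1 (_ : _ + _ = (v ord0 k * t) *: z) ?scalemx_sub //.
      by rewrite zE scalerDr scalerA -mulrA tt mulr1 addrC.
    have := (stabP _ _).1 st _ l _ h; rewrite addE delE [w0 ord0 l]wl (eq_sym k) (negbTE lk).
    rewrite !(mulr0, mul0r) scale0r !addr0; apply.
    by move: lb; rewrite !inE (negbTE lk).
  + by rewrite rank_mul_unit.
  + move=> x /s2[ex _]; rewrite (LjE j x js Cj ex) VA vA.
    have -> : c2 x = e x - w0 by rewrite c2E mulmx1.
    rewrite subrowE w0k subr0; set v := e x.
    pose y := v - w0 - v ord0 k *: dk.
    have -> : theta v = z + y.
      by rewrite zE; exact: alg1.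
    have -> : v - w0 + (v ord0 k * t) *: w0 = (v ord0 k * t) *: z + y.
      by rewrite zE; exact: alg2.
    by rewrite (addmx_subP _ zj) (addmx_subP _ (scalemx_sub _ zj)).
- move=> j l js ls Lj Ll; have Cj := blift_sub js Lj; have Cl := blift_sub ls Ll.
  have [m [ms Cm VE]] := H2 _ _ (sj js) (sj ls) Cj Cl.
  have zm : (z <= V m)%MS.
    by case/andP: VE => _; apply: submx_trans; rewrite sub_capmx !zL.
  (* The intersection is not the centre: vectors of [V i] have [k]-th entry 0, whereas that of [z]
     is [t]. *)
  have ms' : m \in s.
    move: ms; rewrite inE => /orP[/eqP mi|//]; rewrite mi in zm.
    by move/VI: zm => /(_ k kI)/eqP; rewrite thE eqxx (negbTE tn).
  exists m; split=> //; last exact: cap_mul_unit.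
  exact/(LjE m b ms' Cm eb).
- by move=> j l js ls Lj Ll; rewrite eq_mul_unit //; apply: H3; rewrite ?sj //; exact: blift_sub.
Qed.

Lemma blift_lpic : lpic L s.
Proof.
split=> [j js|b]; first by rewrite bliftE //; exact: closed_closure.
by have [/blift_lclean_on|/blift_lclean_off] := pselect (C i (beta b)).
Qed.

End Lift.

End LocalPic.

(** * Independence of the order *)

(** The image of an adapted chart is a box in an orthant, so a linear subspace meets it in a set
    that is star-shaped about the centre. *)
Lemma segment_component {R : realType} {n : nat} (M : premfd R n) p (c : chart R n M)
    (Q : set M) (V : 'M[R]_n) q : adapted p c ->
  (forall x, dom c x -> Q x <-> (c x <= V)%MS) -> dom c q -> Q q -> connected_component Q p q.
Proof.
move=> [cc cp cp0 [e e0 im]] HQ cq Qq.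
pose S := [set x | dom c x /\ exists2 t : R, 0 <= t <= 1 & c x = c p + t *: c q].
have cS : connected S.
  apply: (homeo_connected (g_homeo (g_coordinates cc))); first by move=> x [].
  rewrite (_ : c @` S = [set c p + t *: c q | t in [set t : R | 0 <= t <= 1]]).
    exact: connected_segment.
  apply/seteqP; split=> [_ [x [cx [t t01 tE]] <-]|_ [t /= t01 <-]]; first by exists t.
  have /andP[t0 t1] := t01; have : (c @` dom c) (c p + t *: c q).
    have : (c @` dom c) (c q) by exists q.
    rewrite im => -[qo qe]; split=> [l lb|l]; rewrite cp0 add0r mxE.
      by rewrite mulr_ge0 //; exact: qo.
    rewrite normrM (ger0_norm t0); apply: le_lt_trans (qe l).
    by rewrite ler_piMl.
  by move=> [x cx xE]; exists x => //; split=> //; exists t.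
apply: (@connected_component_max _ _ S p) => //.
- by split=> //; exists 0; rewrite ?lexx ?ler01 // scale0r addr0.
- move=> x [cx [t _ xE]]; apply/(HQ _ cx); rewrite xE cp0 add0r scalemx_sub //.
  exact/(HQ _ cq).
- by split=> //; exists 1; rewrite ?lexx ?ler01 // cp0 add0r scale1r.
Qed.

Section Resolution.
Context {R : realType} {n : nat} {I : finType} (d : I -> nat).
Implicit Types (M N B : mfd R n) (s t u : seq I).

(** Finiteness of the number of components comes from compactness: finitely many charts cover the
    element, and each of them meets only one component. *)
Lemma lpic_psub M (C : I -> set M) s i : compact [set: M] -> lpic d C s -> i \in s ->
  psub (d i) (C i).
Proof.
move=> cM lC si; have H p : exists z : chart R n M * {set 'I_n}, C i p ->
    [/\ adapted p z.1, #|~: z.2| = d i,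
      (forall q, dom z.1 q -> C i q <-> forall l, l \in z.2 -> z.1 q ord0 l = 0) &
      forall q, dom z.1 q -> C i q -> connected_component (C i) p q].
  have [Cp|nC] := pselect (C i p); last first.
    by have [c _ _] := atlas_cover p; exists (c, finset.set0) => Cp; case: nC.
  have [c [V lc]] := lC.2 p.
  have [c' [V' [J [ac' [_ _ H1 _ _] _ nJ VJ]]]] := lclean_straight lc si Cp openT Logic.I.
  have [_ _ HC] := H1 _ si Cp.
  exists (c', J) => _; split=> //=; first by move=> q cq; rewrite HC // VJ.
  by move=> q; exact: (segment_component ac' HC).
have [z Hz] := choice H.
have clC := lC.1 i si.
split=> //; last first.
  by move=> p Cp; have [ac nJ HC _] := Hz p Cp; exists (z p).1, (z p).2.
have cC : compact (C i) by exact: (subclosed_compact clC cM (@subsetT _ _)).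
have [|r [rC rU]] := compact_cover_seq (U := fun p => dom (z p).1) cC.
  by move=> p Cp; have [[cc cp _ _] _ _ _] := Hz p Cp; split=> //; exact: coord_open.
apply: (@sub_finite_set _ _ [set connected_component (C i) p | p in [set` r]]).
  move=> _ [q Cq <-]; have [p pr pq] := rU q Cq; exists p => //.
  have [_ _ _ H'] := Hz p (rC _ pr).
  exact: same_connected_component (H' q pq Cq).
exact/finite_image/finite_seq.
Qed.

(** Pairwise rather than between neighbours, and for nonempty elements only: the empty set is a
    p-submanifold of every dimension, so the place of an empty element in a size order carries no
    information. *)
Fixpoint ordered M (C : I -> set M) s : Prop :=
  if s is i :: s' then [/\ i \notin s',
    forall j, j \in s' -> C i !=set0 -> C j !=set0 -> (d i <= d j)%N & ordered C s']
  else True.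

Lemma lpic_perm M (C : I -> set M) s t : s =i t -> lpic d C s -> lpic d C t.
Proof.
move=> st [clC lC]; split=> [i|p]; first by rewrite -st; exact: clC.
have [c [V [H H0 H1 H2 H3]]] := lC p; exists c, V; split=> //.
- by move=> i; rewrite -st; exact: H1.
- move=> i j; rewrite -!st => si sj Ci Cj; have [k [sk Ck E]] := H2 i j si sj Ci Cj.
  by exists k; rewrite -st.
- by move=> i j; rewrite -!st; exact: H3.
Qed.

Lemma ordered_sub M M' (C : I -> set M) (C' : I -> set M') s :
  (forall i, i \in s -> C' i !=set0 -> C i !=set0) -> ordered C s -> ordered C' s.
Proof.
elim: s => // i s IH CC [nis H os]; split=> //.
  by move=> j js Ci Cj; apply: H => //; apply: CC; rewrite // inE ?eqxx ?js ?orbT.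
by apply: IH => // j js; apply: CC; rewrite inE js orbT.
Qed.

(** By uniqueness every blow-up is diffeomorphic to the constructed one, which is compact. *)
Lemma blowup_compact M B (beta : B -> M) C : compact [set: M] -> submfd C ->
  is_blowup C beta -> compact [set: B].
Proof.
move=> cM sC bl; have [B0 [beta0 [bl0 cB0]]] := blowup_exists cM sC.
have [F dF _] := blowup_unique sC bl0 bl; have [im _ _ _ _] := dF.
rewrite -im; apply: continuous_compact => //; apply: continuous_subspaceT => x.
exact: (d_cont dF Logic.I).
Qed.

Lemma lift_pic M B (beta : B -> M) (C : I -> set M) i s : lpic d C (i :: s) ->
  ordered C (i :: s) -> is_blowup (C i) beta ->
  lpic d (fun j => blift beta (C i) (C j)) s /\
  forall s', {subset s' <= s} -> ordered C s' -> ordered (fun j => blift beta (C i) (C j)) s'.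
Proof.
move=> lC [nis Hi os] bl; split; first exact: (blift_lpic lC nis Hi bl).
move=> s' ss' os'; apply: (ordered_sub _ os') => j js [b Lj].
by exists (beta b); exact: (blift_sub lC nis Hi bl (ss' _ js)).
Qed.

Lemma lpic_permissible M (C : I -> set M) s : compact [set: M] -> lpic d C s -> ordered C s ->
  permissible C s.
Proof.
elim: s M C => [|i s IH] M C cM lC os; first by exists M, id; exact: diffeo_id.
have [nis Hi os'] := os; have si : i \in i :: s by rewrite inE eqxx.
have [B [beta [bl cB]]] := blowup_exists cM (lpic_submfd lC si).
have [lL oL] := lift_pic lC os bl.
have [N [gamma res]] := IH B _ cB lL (oL s (fun _ h => h) os').
exists N, (beta \o gamma); split.
- by exists (d i); exact: lpic_psub lC si.
- by move=> j js; exact: (head_liftable lC nis Hi).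
- by exists B, beta, gamma.
Qed.

Lemma diffeo_inverse M N (F : M -> N) : diffeo F ->
  exists G : N -> M, [/\ diffeo G, cancel F G & cancel G F].
Proof.
move=> dF; have [im _ _ _ _] := dF.
have H y : exists x, F x = y by have : (F @` setT) y by [rewrite im]; case=> x _ <-; exists x.
have [G HG] := choice H.
have FG : cancel F G by move=> x; apply: (d_inj dF) => //; rewrite HG.
by exists G; split=> //; apply: (d_inv openT dF) => x _; exact: FG.
Qed.

Lemma closure_diffeo M N (F : M -> N) (A : set N) : diffeo F ->
  closure (F @^-1` A) = F @^-1` (closure A).
Proof.
move=> dF; have [_ _ _ op _] := dF; apply/seteqP; split=> x cl O nO.
  by have [y [Ay Oy]] := cl _ (d_cont dF Logic.I nO); exists (F y).
have /near_open[ O' [ oO' O'x O'O]] := nO.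
have oFO : open (F @` O') by exact: op.
have [z [Az [y O'y yz]]] := cl _ (open_nbhs_nbhs (conj oFO (ex_intro2 _ _ x O'x erefl))).
by exists y; split; [rewrite /preimage /= yz|exact: O'O].
Qed.

Lemma blift_transport M M' B B' (Psi : M -> M') (Psi' : B -> B') (beta : B -> M)
    (beta' : B' -> M') (C Q : set M') : diffeo Psi -> diffeo Psi' ->
  (forall b, beta' (Psi' b) = Psi (beta b)) ->
  blift beta (Psi @^-1` C) (Psi @^-1` Q) = Psi' @^-1` (blift beta' C Q).
Proof.
move=> dP dP' E.
have sub : (Psi @^-1` Q `<=` Psi @^-1` C) <-> (Q `<=` C).
  split=> [h y Qy|h x /h //]; have [G [_ _ GK]] := diffeo_inverse dP.
  by have := h (G y); rewrite /preimage /= GK; apply.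
have cE : closure (beta @^-1` ((Psi @^-1` Q) `\` (Psi @^-1` C))) =
    Psi' @^-1` (closure (beta' @^-1` (Q `\` C))).
  rewrite -closure_diffeo //; congr closure; apply/seteqP.
  by split=> b; rewrite /preimage /= E.
apply/seteqP; split=> b; rewrite /blift /preimage /= cE /preimage /= E.
  by move=> [[/sub h q]|[h q]]; [left|right; split=> // /sub].
by move=> [[h q]|[h q]]; [left; split=> //; exact/sub|right; split=> // /sub].
Qed.

(** A diffeomorphism is a blow-up of the empty set, so this is a case of [blowup_union]. *)
Lemma blowup_diffeo M M' B (Psi : M -> M') (beta : B -> M) (C : set M') : diffeo Psi ->
  submfd C -> is_blowup (Psi @^-1` C) beta -> is_blowup C (Psi \o beta).
Proof.
move=> dP sC bl; rewrite -[C]set0U; apply: blowup_union => //; [exact: closed0|exact: set0I|].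
split; first exact: diffeo_on_smooth.
  by rewrite setC0 preimage_setT.
by [].
Qed.

(** Uniqueness of iterated blow-ups. Two bases related by [Psi] are allowed because after one step
    the induction compares two different blow-ups. *)
Lemma same_list s M M' (Psi : M -> M') (C : I -> set M) (C' : I -> set M') N N'
    (gamma : N -> M) (gamma' : N' -> M') : diffeo Psi ->
  (forall j, j \in s -> C j = Psi @^-1` (C' j)) ->
  is_resolution C s gamma -> is_resolution C' s gamma' ->
  exists2 F : N -> N', diffeo F & forall x, gamma' (F x) = Psi (gamma x).
Proof.
elim: s M M' Psi C C' N N' gamma gamma' => [|i s IH] M M' Psi C C' N N' gamma gamma' dP CC /=.
  move=> dg dg'; have [G [dG _ GK]] := diffeo_inverse dg'.
  exists (G \o (Psi \o gamma)); last by move=> x /=; rewrite GK.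
  by apply: d_comp dG; [exact: openT|apply: d_comp dP; [exact: openT|]].
move=> [_ _ [B [beta [gamma1 [bl res ->]]]]] [[k psi] _ [B' [beta' [gamma1' [bl' res' ->]]]]].
have Ci : C i = Psi @^-1` (C' i) by apply: CC; rewrite inE eqxx.
rewrite Ci in bl; have sCi := psub_submfd psi.
have [Psi' dP' E] := blowup_unique sCi (blowup_diffeo dP sCi bl) bl'.
have [|F dF FE] := IH _ _ Psi' _ _ _ _ _ _ dP' _ res res'.
  move=> j js; rewrite Ci (CC j) ?inE ?js ?orbT //.
  exact: blift_transport.
by exists F => // x /=; rewrite FE E.
Qed.

(** Unlike in [same_resolution], the blow-down maps agree everywhere and not only off the centres;
    this form composes and passes through further blow-ups. *)
Definition equivres M (C : I -> set M) s t :=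
  forall N N' (gamma : N -> M) (gamma' : N' -> M),
    is_resolution C s gamma -> is_resolution C t gamma' ->
    exists2 F : N -> N', diffeo F & forall x, gamma' (F x) = gamma x.

Lemma equivres_refl M (C : I -> set M) s : equivres C s s.
Proof.
by move=> N N' gamma gamma'; apply: (same_list (Psi := id)) => //; exact: diffeo_id.
Qed.

(** The middle order must have a resolution through which to compose; otherwise both equivalences
    would hold vacuously. *)
Lemma equivres_trans M (C : I -> set M) s t u : permissible C t ->
  equivres C s t -> equivres C t u -> equivres C s u.
Proof.
move=> [N1 [g1 r1]] st tu N N' g g' r r'.
have [F dF FE] := st _ _ _ _ r r1; have [G dG GE] := tu _ _ _ _ r1 r'.
exists (G \o F); first by apply: d_comp dF dG; exact: openT.
by move=> x /=; rewrite GE FE.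
Qed.

(** The two resolutions may begin with different blow-ups of [C i]. On the first one the tails are
    exchanged, by way of an auxiliary resolution in the order [t]; [same_list] then leads to the
    second. *)
Lemma equivres_cons M (C : I -> set M) i s t : compact [set: M] -> lpic d C (i :: s) ->
  ordered C (i :: s) -> ordered C (i :: t) -> perm_eq s t ->
  (forall B (beta : B -> M), is_blowup (C i) beta ->
     equivres (fun j => blift beta (C i) (C j)) s t) ->
  equivres C (i :: s) (i :: t).
Proof.
move=> cM lC os ot st H N N' g g' /=.
move=> [_ _ [B [beta [g1 [bl res ->]]]]] [[k psi] _ [B' [beta' [g1' [bl' res' ->]]]]].
have sCi := psub_submfd psi; have [lL oL] := lift_pic lC os bl.
have cB := blowup_compact cM sCi bl.
have [_ _ ot'] := ot.
have st' : s =i t := perm_mem st.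
have oLt : ordered (fun j => blift beta (C i) (C j)) t.
  by apply: oL ot' => x; rewrite -st'.
have [N1 [g1'' res'']] := lpic_permissible cB (lpic_perm st' lL) oLt.
have [Psi dP E] := blowup_unique sCi bl bl'.
have [F dF FE] := H _ _ bl _ _ _ _ res res''.
have [|G dG GE] := same_list dP _ res'' res'.
  by move=> j _; exact: (blift_transport (C i) (C j) (diffeo_id M) dP).
exists (G \o F); first by apply: d_comp dF dG; exact: openT.
by move=> x /=; rewrite GE FE E.
Qed.

Lemma submfdU M (C D : set M) : submfd C -> submfd D -> C `&` D = set0 -> submfd (C `|` D).
Proof.
move=> sC sD CD; split; first by apply: closedU; [case: sC|case: sD].
have H (E E' : set M) p : submfd E -> closed E' -> ~ E' p -> E p ->
    exists c (J : {set 'I_n}), [/\ coordinates c, dom c p & locally_zero (E `|` E') c J p].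
  move=> [_ HE] cE' nE' Ep; have [c [J [cc cp lz]]] := HE p Ep.
  exists c, J; split=> //; apply: near_mono (near_and lz (open_nbhs_nbhs (conj (closed_openC cE') nE'))).
  by move=> q [<- nq]; split=> [[]//|]; left.
move=> p [Cp|Dp].
  apply: H => //; [by case: sD|by move=> Dp; have : (C `&` D) p by []; rewrite CD].
rewrite setUC; apply: H => //; [by case: sC|move=> Cp].
by have : (C `&` D) p by []; rewrite CD.
Qed.

(* The right-hand sides are symmetric in i and j: blow-ups with disjoint centres
   commute. *)
Lemma double_lift M B1 B2 (b1 : B1 -> M) (b2 : B2 -> B1) (C : I -> set M) i j u :
  C i `&` C j = set0 -> lpic d C (i :: j :: u) -> ordered C (i :: j :: u) ->
  is_blowup (C i) b1 -> is_blowup (blift b1 (C i) (C j)) b2 ->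
  is_blowup (C i `|` C j) (b1 \o b2) /\ forall l, l \in u ->
  blift b2 (blift b1 (C i) (C j)) (blift b1 (C i) (C l)) =
    closure ((b1 \o b2) @^-1` (C l `\` (C i `|` C j))).
Proof.
move=> dis lC os bl1 bl2; have [lL oL] := lift_pic lC os bl1.
have [nis Hi [njs Hj os']] := os.
have oLL : ordered (fun l => blift b1 (C i) (C l)) (j :: u) by exact: (oL _ (fun _ h => h)).
have [njs' Hj' _] := oLL.
have ju : j \in j :: u by rewrite inE eqxx.
have LjE : blift b1 (C i) (C j) = b1 @^-1` (C j).
  apply/seteqP; split=> b; first exact: (blift_sub lC nis Hi bl1 ju).
  move=> Cj; apply/(blift_off lC nis Hi bl1 ju) => // Ci.
  by have : (C i `&` C j) (b1 b) by []; rewrite dis.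
split.
  apply: blowup_union => //.
  - by apply: lC.1; rewrite inE eqxx.
  - by apply: (lpic_submfd lC); rewrite !inE eqxx orbT.
  - by rewrite -LjE.
move=> l lu; have lju : l \in j :: u by rewrite inE lu orbT.
rewrite (bliftE b2 lL njs' Hj' lu) (bliftE b1 lC nis Hi lju) LjE.
rewrite LjE in bl2; have [_ df _] := bl2; have [_ _ _ op _] := df.
have c2 := blowup_cont bl2.
have clCj : closed (b1 @^-1` C j) by rewrite -LjE; apply: lL.1.
apply/seteqP; split=> x cl O nO; last first.
  have [y [[Cl nCC] Oy]] := cl _ nO; exists y; split=> //.
  by split; [apply: subset_closure; split=> //|]; move=> h; apply: nCC; [left|right].
have [y [[clz nCj] Oy]] := cl _ (nbhs_interior nO).
have [ O' [ oO' O'y O'O]] := near_open Oy.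
pose O1 := O' `&` b2 @^-1` (~` (b1 @^-1` C j)).
have oO1 : open O1.
  by apply: openI => //; apply: open_comp => [z _|]; [exact: c2|rewrite openC].
have oI : open (b2 @` O1) by apply: op => // z [].
have O1y : O1 y by split.
have [w [[Clz nCiz] [z [ O'z nCjz] zw]]] := clz _ (open_nbhs_nbhs (conj oI (ex_intro2 _ _ y O1y erefl))).
exists z; split; last exact: O'O.
by rewrite -zw in Clz nCiz; split=> // -[].
Qed.

Lemma equivres_swap M (C : I -> set M) i j u : C i `&` C j = set0 ->
  lpic d C (i :: j :: u) -> ordered C (i :: j :: u) -> ordered C (j :: i :: u) ->
  equivres C (i :: j :: u) (j :: i :: u).
Proof.
move=> dis lC os os' N N' g g' /=.
move=> [psi _ [B1 [b1 [g1 [bl1 [_ _ [B2 [b2 [g2 [bl2 res ->]]]] ->]]]]]].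
move=> [psj _ [B1' [b1' [g1' [bl1' [_ _ [B2' [b2' [g2' [bl2' res' ->]]]] ->]]]]]].
have lC' : lpic d C (j :: i :: u).
  by apply: lpic_perm lC => x; rewrite !inE orbCA.
have dis' : C j `&` C i = set0 by rewrite setIC.
have sC : submfd (C i `|` C j).
  by apply: submfdU => //; [case: psi => k /psub_submfd|case: psj => k /psub_submfd].
have [bl12 L12] := double_lift dis lC os bl1 bl2.
have [bl21 L21] := double_lift dis' lC' os' bl1' bl2'.
rewrite setUC in bl21.
have [Psi dP E] := blowup_unique sC bl12 bl21.
have [|F dF FE] := same_list dP _ res res'.
  move=> l lu; rewrite L12 // L21 // -closure_diffeo // [C j `|` C i]setUC.
  by congr closure; apply/seteqP; split=> b; rewrite /preimage /= -[b1 _]/((b1 \o b2) b) -E.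
exists F => // x /=; rewrite FE; exact: E.
Qed.

(** At a common point the subspace of [i] would lie in that of [j] and have at least its rank, so
    the two would coincide, against distinctness. *)
Lemma disjoint_heads M (C : I -> set M) s i j : lpic d C s -> i \in s -> j \in s -> i != j ->
  (forall k, k \in s -> C i !=set0 -> C k !=set0 -> (d i <= d k)%N) ->
  (C j !=set0 -> C i !=set0 -> (d j <= d i)%N) -> C i `&` C j = set0.
Proof.
move=> lC si sj ij Hi Hji; rewrite -subset0 => p [Ci Cj].
have [c [V lc]] := lC.2 p; have [_ _ H1 _ H3] := lc.
have VV : (V i <= V j)%MS.
  by apply: (lclean_head lc) => // k sk Ck; apply: Hi => //; exists p.
have [_ ri _] := H1 _ si Ci; have [_ rj _] := H1 _ sj Cj.
move/eqP: ij; apply; apply: H3 => //; rewrite VV /= -(geq_leqif (mxrank_leqif_sup VV)) ri rj.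
by apply: Hji; exists p.
Qed.

(** As both lists are ordered, [i] and any [j] in [t1] bound each other's dimension and hence are
    disjoint. The first two entries are swapped, and the induction continues in the blow-up of
    [C j]. *)
Lemma equivres_bubble t1 M (C : I -> set M) i t2 : compact [set: M] ->
  lpic d C (i :: t1 ++ t2) -> ordered C (i :: t1 ++ t2) -> ordered C (t1 ++ i :: t2) ->
  equivres C (i :: t1 ++ t2) (t1 ++ i :: t2).
Proof.
elim: t1 M C => [|j t1 IH] M C cM lC os ot; first exact: equivres_refl.
have [nis Hi [njs Hj os']] := os; have [njt Hjt ot'] := ot.
rewrite !cat_cons in lC os ot nis Hi njs Hj os' njt Hjt ot' *.
have ij : i != j by move: nis; rewrite inE negb_or => /andP[].
have Y : ordered C (j :: i :: t1 ++ t2).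
  split=> //.
  - by rewrite inE negb_or eq_sym ij.
  - move=> k; rewrite inE => /orP[/eqP ->|ks]; last exact: Hj.
    by apply: Hjt; rewrite mem_cat inE eqxx orbT.
  - split=> //; first by move: nis; rewrite inE negb_or => /andP[].
    by move=> k ks; apply: Hi; rewrite inE ks orbT.
have dis : C i `&` C j = set0.
  apply: (disjoint_heads lC) => //; rewrite ?inE ?eqxx ?orbT //.
    by move=> k; rewrite inE => /orP[/eqP -> //|]; exact: Hi.
  by apply: Hjt; rewrite mem_cat inE eqxx orbT.
have lC' : lpic d C (j :: i :: t1 ++ t2) by apply: lpic_perm lC => x; rewrite !inE orbCA.
apply: equivres_trans (lpic_permissible cM lC' Y) (equivres_swap dis lC os Y) _.
apply: equivres_cons => //.
  by rewrite -(cat1s i (t1 ++ t2)) -(cat1s i t2) perm_catCA.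
move=> B beta bl; have [lL oL] := lift_pic lC' Y bl.
apply: IH => //.
- apply: blowup_compact cM _ bl; apply: (lpic_submfd lC'); rewrite inE eqxx //.
- by apply: oL => //; case: Y.
- apply: oL => // x; rewrite !mem_cat !inE mem_cat orbCA //.
Qed.

(** The head of [s] is moved to its place in [t] by [equivres_bubble]; the tails are compared in the
    blow-up of its centre. *)
Lemma equivres_perm s M (C : I -> set M) t : compact [set: M] -> lpic d C s ->
  ordered C s -> ordered C t -> perm_eq s t -> equivres C s t.
Proof.
elim: s M C t => [|i s IH] M C t cM lC os ot st.
  by move: st; rewrite perm_sym => /perm_nilP ->; exact: equivres_refl.
have it : i \in t by rewrite -(perm_mem st) inE eqxx.
case/splitPr: it ot st => t1 t2 ot st.
have st' : perm_eq s (t1 ++ t2).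
  by rewrite -(perm_cons i) (permPl st) -cat1s perm_catCA.
have oY : ordered C (i :: t1 ++ t2).
  have [nis Hi _] := os; split.
  - by rewrite -(perm_mem st').
  - by move=> j; rewrite -(perm_mem st'); exact: Hi.
  - elim: t1 ot {st st'} => [|k t1 IHt] /=; first by case.
    move=> [nk Hk /IHt ok]; split=> //.
      by move: nk; rewrite !mem_cat !inE orbCA !negb_or => /and3P[_ -> ->].
    by move=> j; rewrite mem_cat => /orP[j1|j2]; apply: Hk; rewrite mem_cat ?j1 ?inE ?j2 ?orbT.
have lY : lpic d C (i :: t1 ++ t2).
  by apply: lpic_perm lC => x; rewrite !inE (perm_mem st').
apply: equivres_trans (lpic_permissible cM lY oY) _ (equivres_bubble cM lY oY ot).
apply: equivres_cons => // B beta bl; have [lL oL] := lift_pic lC os bl.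
apply: IH => //.
- by apply: blowup_compact cM _ bl; apply: (lpic_submfd lC); rewrite inE eqxx.
- by apply: oL => //; case: os.
- by case: oY => _ _; apply: oL => x; rewrite (perm_mem st').
Qed.

End Resolution.

(** * From a pic to its local form *)

Section PicLocal.
Context {R : realType} {n : nat}.

(** A small positive multiple of an inward vector of [V] is realized by a point near [p], and
    membership in [V'] is homogeneous; the inward vectors of [V] generate it. *)
Lemma sub_of_near (M : premfd R n) (c : chart R n M) p (V V' : 'M[R]_n) : coordinates c ->
  dom c p -> c p = 0 -> stab V (bnd c) ->
  (\forall q \near p, (c q <= V)%MS -> (c q <= V')%MS) -> (V <= V')%MS.
Proof.
move=> cc cp cp0 st H.
have inw (w : 'rV[R]_n) : (forall j, j \in bnd c -> 0 <= w ord0 j) -> (w <= V)%MS -> (w <= V')%MS.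
  move=> w0 wV; have [|e e0 He] := inward_point cc cp (w := w) _ H; first by move=> j jb _; exact: w0.
  have [|q [_ HVV qE]] := He (e / 2).
    by rewrite divr_ge0 ?ltW //= ltr_pdivrMr // mulr_natr mulr2n ltrDl.
  move: HVV; rewrite qE cp0 add0r !scalemx_subP ?gt_eqF ?divr_gt0 //; exact.
apply/row_subP => l; have [w1 [w2 [wE w1p w2p wV]]] := inward_split (row l V) (bnd c).
have [w1V w2V] := wV _ st (row_sub _ _).
by rewrite wE addmx_sub ?eqmx_opp //; exact: inw.
Qed.

(** The dimension in [psub] is read off in its own charts; the inclusions between the two local
    descriptions, in both directions, identify it with the rank in any adapted chart where [Q] is
    linear. *)
Lemma psub_rank (M : premfd R n) k (Q : set M) p (c : chart R n M) (V : 'M[R]_n) :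
  psub k Q -> Q p -> adapted p c -> stab V (bnd c) ->
  (forall q, dom c q -> Q q <-> (c q <= V)%MS) -> \rank V = k.
Proof.
move=> [_ _ H] Qp [cc cp cp0 _] st HQ; have [c' [J [[cc' c'p c'p0 _] nJ HJ]]] := H p Qp.
have E q : dom c' q -> Q q <-> (c' q <= csp (~: J))%MS.
  move=> c'q; rewrite HJ // sub_csp.
  by split=> h l; [rewrite inE negbK|move=> lJ]; apply: h; rewrite ?inE ?negbK.
have nd := near_and (open_nbhs_nbhs (conj (coord_open cc) cp))
  (open_nbhs_nbhs (conj (coord_open cc') c'p)).
rewrite -nJ -(@rank_csp R n (~: J)%SET); apply/eqP; rewrite eqn_leq; apply/andP; split.
  apply: (rank_le_of_sub cc cc' cp c'p cp0 c'p0 st).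
  by apply: near_mono nd => q [cq c'q]; rewrite -HQ // -E.
apply: (rank_le_of_sub cc' cc c'p cp c'p0 cp0); first exact: stab_csp.
by apply: near_mono nd => q [cq c'q]; rewrite -HQ // -E.
Qed.

Context {I : finType} (d : I -> nat) (M : mfd R n) (C : I -> set M).
Hypothesis pic : is_pic C.
Hypothesis dC : forall i, psub (d i) (C i).

Lemma pic_clean p : exists c (V : I -> 'M[R]_n), adapted p c /\ forall i, C i p ->
  [/\ stab (V i) (bnd c), \rank (V i) = d i & forall q, dom c q -> C i q <-> (c q <= V i)%MS].
Proof.
have [[_ pc] _ _] := pic.
have [exC|nC] := pselect (exists i, C i p); last first.
  have [c0 /atlas_coordinates cc cp] := atlas_cover p.
  have [||c [ac _ _ _]] := @adapted_reparam _ _ _ c0 p setT 1%:M cc cp openT Logic.I.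
  - exact: unitmx1.
  - by move=> v j _ _; rewrite mulmx1.
  by exists c, (fun _ => 0); split=> // i Ci; case: nC; exists i.
have [c ac HC] := pc p exC.
have H i : exists V : 'M[R]_n, C i p -> stab V (bnd c) /\
    forall q, dom c q -> C i q <-> (c q <= V)%MS.
  have [Ci|nCi] := pselect (C i p); last by exists 0.
  have [A [m [L [Ab L0 HL]]]] := HC i Ci.
  exists (csp (~: A) :&: kermx L)%MS => _.
  have mE (v : 'rV[R]_n) : (v <= csp (~: A) :&: kermx L)%MS <->
      (forall j, j \in A -> v ord0 j = 0) /\ v *m L = 0.
    rewrite sub_capmx; split=> [/andP[/sub_csp h /sub_kermxP ->]|[h /sub_kermxP ->]].
      by split=> // j jA; apply: h; rewrite inE negbK.
    by rewrite andbT; apply/sub_csp => j; rewrite inE negbK; exact: h.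
  split; last by move=> q cq; rewrite HL // mE.
  apply/stabP => v j jb /mE[vA vL]; apply/mE; split=> [l lA|].
    rewrite !mxE eqxx /=; case: eqP => [lj|_]; last by rewrite mulr0.
    by rewrite -lj vA // mul0r.
  rewrite -scalemxAl -rowE (_ : row j L = 0) ?scaler0 //.
  by apply/rowP => k; rewrite !mxE L0.
have [V HV] := choice H.
exists c, V; split=> // i Ci; have [st HCi] := HV i Ci; split=> //.
exact: psub_rank (dC i) Ci ac st HCi.
Qed.

(** The points near which the two elements coincide form a closed set: in a chart at a limit point
    both are linear subspaces, and these are equal as soon as they coincide near one common point.
    The set is also open in [C i], so it contains the component. *)
Lemma pic_same_component i j p : C i p -> C j p -> (\forall q \near p, C i q <-> C j q) ->
  connected_component (C i) p `<=` C j.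
Proof.
move=> Ci Cj nE; have clC k : closed (C k) by case: (dC k).
pose G := [set q | C i q /\ \forall x \near q, C i x <-> C j x].
have GC : G `<=` C i `&` C j by move=> q [Ciq /nbhs_singleton h]; split=> //; exact/h.
suff AG : connected_component (C i) p `<=` G by move=> q /AG/GC[].
apply: (@connected_clopen _ _ _ p); first exact: component_connected.
- move=> q cl.
  have Ciq : C i q by apply: clC => O /cl[x [/GC[Cx _] Ox]]; exists x.
  have Cjq : C j q by apply: clC => O /cl[x [/GC[_ Cx] Ox]]; exists x.
  have [c [V [[cc cq cq0 _] HV]]] := pic_clean q.
  have [sti _ HCi] := HV _ Ciq; have [stj _ HCj] := HV _ Cjq.
  have dq := open_nbhs_nbhs (conj (coord_open cc) cq).
  have [y [[Ciy nEy] cy]] := cl _ dq.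
  have Cjy : C j y by apply/(nbhs_singleton nEy).
  (* Recentring at [y] does not change the two subspaces, since both contain [c y]. *)
  have [||c2 [[cc2 c2y c2y0 _] sc2 b2 c2E]] := @adapted_reparam _ _ _ c y setT 1%:M cc cy openT Logic.I.
  - exact: unitmx1.
  - by move=> v l _ _; rewrite mulmx1.
  have sub2 l : l \in bnd c2 -> l \in bnd c by rewrite b2 inE => /andP[].
  have shift k x : (c y <= V k)%MS -> (c2 x <= V k)%MS = (c x <= V k)%MS.
    by move=> yV; rewrite c2E mulmx1 addrC addmx_subP // eqmx_opp.
  have yi : (c y <= V i)%MS by apply/HCi.
  have yj : (c y <= V j)%MS by apply/HCj.
  have dy := open_nbhs_nbhs (conj (coord_open cc) cy).
  have nd := near_and nEy dy.
  have ij : (V i <= V j)%MS.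
    apply: (sub_of_near cc2 c2y c2y0); first by move=> l /sub2; exact: sti.
    by apply: near_mono nd => x [E cx]; rewrite !shift // -HCi // -HCj // E.
  have ji : (V j <= V i)%MS.
    apply: (sub_of_near cc2 c2y c2y0); first by move=> l /sub2; exact: stj.
    by apply: near_mono nd => x [E cx]; rewrite !shift // -HCi // -HCj // E.
  split=> //; apply: near_mono dq => x cx; rewrite HCi // HCj //.
  by split=> h; apply: submx_trans h _.
- move=> y Ay [Ciy nEy]; apply: near_mono (nbhs_interior nEy) => z nEz Az.
  by split=> //; exact: connected_component_sub Az.
- exact: connected_component_refl.
- by split.
Qed.

(** In an adapted chart all points of a linear element lie in the component of [p], so equality of
    components yields equality of subspaces. Conversely, equal subspaces give equal components by
    [pic_same_component], which turns distinctness of components into distinctness of subspaces. *)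
Lemma pic_lpic s : (forall i, i \in s) -> lpic d C s.
Proof.
move=> allS; have [_ pcap pdis] := pic.
split=> [i _|p]; first by case: (dC i).
have [c [V [ac HV]]] := pic_clean p; have [cc cp cp0 _] := ac.
have dp := open_nbhs_nbhs (conj (coord_open cc) cp).
exists c, V; split=> //.
- by move=> i _; exact: HV.
- move=> i j _ _ Ci Cj; have [k kE] := pcap i j p Ci Cj.
  have Ck : C k p.
    apply: (@connected_component_sub _ _ p); rewrite -kE.
    exact: connected_component_refl.
  have [sti _ HCi] := HV _ Ci; have [stj _ HCj] := HV _ Cj; have [stk _ HCk] := HV _ Ck.
  have Hij q : dom c q -> (C i `&` C j) q <-> (c q <= V i :&: V j)%MS.
    move=> cq; rewrite sub_capmx; split=> [[/HCi -> // /HCj -> //]|/andP[]].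
    by move=> /HCi h /HCj h'; split; [exact: h|exact: h'].
  have E q : dom c q -> (c q <= V k)%MS <-> (c q <= V i :&: V j)%MS.
    move=> cq; rewrite -HCk // -Hij //; split=> h.
      have := segment_component ac HCk cq h; rewrite -kE.
      exact: connected_component_sub.
    have := segment_component ac Hij cq h; rewrite kE.
    exact: connected_component_sub.
  exists k; split=> //; apply/andP; split; apply: (sub_of_near cc cp cp0) => //.
  + by apply: near_mono dp => q /E[].
  + exact: stab_cap.
  + by apply: near_mono dp => q /E[].
- move=> i j _ _ Ci Cj /andP[ij ji]; apply: (pdis i j p Ci Cj).
  have [_ _ HCi] := HV _ Ci; have [_ _ HCj] := HV _ Cj.
  have nE : \forall q \near p, C i q <-> C j q.
    apply: near_mono dp => q cq; rewrite HCi // HCj //.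
    by split=> h; apply: submx_trans h _.
  have nE' : \forall q \near p, C j q <-> C i q by apply: near_mono nE => q [].
  have sub k l : C k p -> C l p -> (\forall q \near p, C k q <-> C l q) ->
      connected_component (C k) p `<=` connected_component (C l) p.
    move=> Ck Cl nkl; apply: connected_component_max.
    - exact: connected_component_refl.
    - exact: pic_same_component.
    - exact: component_connected.
  by apply/seteqP; split; exact: sub.
Qed.

Lemma sorted_ordered (d' : I -> nat) s : uniq s ->
  (forall i, C i !=set0 -> d' i = d i) ->
  sorted (fun i j => (d' i <= d' j)%N) s -> ordered d C s.
Proof.
move=> + dd; elim: s => // i s IH /= /andP[nis us] ps; split=> //; last first.
  by apply: IH => //; exact: path_sorted ps.
have tr : transitive (fun i j => (d' i <= d' j)%N) by move=> x y z; exact: leq_trans.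
move=> j js Ci Cj; have /allP/(_ j js) := order_path_min tr ps.
by rewrite (dd i) ?(dd j).
Qed.

End PicLocal.

Theorem corollary1 (R : realType) (n : nat) (M : mfd R n) (I : finType)
    (C : I -> set M) (Mcompact : compact [set: M]) (Cpic : is_pic C) :
  (forall s : seq I, size_order C s -> permissible C s) /\
  (forall s t : seq I, size_order C s -> size_order C t ->
     same_resolution C s t).
Proof.
have mem s : perm_eq s (enum I) -> forall i, i \in s.
  by move=> /perm_mem E i; rewrite E mem_enum.
have un s : perm_eq s (enum I) -> uniq s by move=> /perm_uniq ->; exact: enum_uniq.
split=> [s [ps [d dC so]]|s t [ps [d dC so]] [pt [d' dC' so']]].
  apply: (lpic_permissible Mcompact (pic_lpic Cpic dC (mem s ps))).
  by apply: (@sorted_ordered _ _ _ d _ _ d) => //; exact: un.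
(* For a nonempty element both dimensions are the rank of its subspace in a common chart; for an
   empty one they may differ. *)
have dd i : C i !=set0 -> d' i = d i.
  move=> [p Ci]; have [c [V [ac HV]]] := pic_clean Cpic dC p.
  have [st <- HC] := HV i Ci; apply/esym; exact: psub_rank (dC' i) Ci ac st HC.
move=> N N' g g' r r'.
have st : perm_eq s t by rewrite (permPl ps) perm_sym.
have [||F dF FE] := equivres_perm Mcompact (pic_lpic Cpic dC (mem s ps)) _ _ st r r'.
- by apply: (@sorted_ordered _ _ _ d _ _ d) => //; exact: un.
- by apply: (sorted_ordered (un t pt) dd).
by exists F.
Qed.
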